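(* For $n\in\mathbb{Z}_{\ge0}$ and $k\in\mathbb{R}$ let $\overline{S}^n_k=\{(f,k)\in M_k\mid a(f,k)=0\text{ for some }a\in\overline{\mathcal{R}}\text{ with }\mathrm{ord}(a)=n\}$. Then for all $n,m\ge0$ and $k,l\in\mathbb{R}$: (1) $\overline{S}^n_k+\overline{S}^m_k\subset\overline{S}^{n+m}_k$; (2) $\overline{S}^n_k\,\overline{S}^m_l\subset\overline{S}^{nm}_{k+l}$; (3) $\overline{\mathcal{R}}_k\,\overline{S}^m_l\subset\overline{S}^m_{k+l}$; (4) $\overline{\mathcal{M}}_k\subset\overline{S}^1_k$.
   Context: Let $\mathrm{Mer}$ be the space of meromorphic functions on the upper half plane, $f'=\frac{1}{2\pi i}\frac{df}{dz}$, $E_2,E_4,E_6$ the Eisenstein series with constant term $1$, and $D_kf=f'-\frac{k}{12}E_2f$ for $k\in\mathbb{R}$. Let $M=\bigoplus_{k\in\mathbb{R}}M_k$ with each $M_k$ a copy of $\mathrm{Mer}$, elements written $(f,k)$, with product $(f,k)(g,l)=(fg,k+l)$. Let $\mathcal{M}=\mathbb{C}[E_4,E_6]$ be the graded ring of level-one holomorphic modular forms and $\overline{\mathcal{M}}=\{f/g: f\in\mathcal{M}, g\text{ a nonzero homogeneous element of }\mathcal{M}\}$ the graded ring of meromorphic modular forms, with $\mathrm{wt}(f/g)=\mathrm{wt}(f)-\mathrm{wt}(g)$ for homogeneous $f$; $\overline{\mathcal{M}}_k$ is its weight-$k$ part, viewed in $M_k$. An element $h\in\overline{\mathcal{M}}_w$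 acts on $M$ by $(f,k)\mapsto(hf,k+w)$, and $\delta(f,k)=(D_kf,k+2)$. $\overline{\mathcal{R}}=\bigoplus_k\overline{\mathcal{R}}_k$ is the graded subring of $\mathrm{End}(M)$ generated by $\delta$ and $\overline{\mathcal{M}}$; every element of $\overline{\mathcal{R}}$ is uniquely a finite sum $\sum_i h_i\delta^i$ with $h_i\in\overline{\mathcal{M}}$, and for nonzero $a$, $\mathrm{ord}(a)$ is the largest $i$ with $h_i\neq0$. *)

(* Defs.v *)
From Stdlib Require Import Reals List Arith ClassicalEpsilon.
From Coquelicot Require Import Coquelicot.
Open Scope R_scope.

Definition inH (z : C) : Prop := 0 < Im z.

(** Meromorphic functions on H are represented by total functions C -> C whose
    values at the (isolated) poles / removable points are irrelevant junk. *)

Definition mer_eq (f g : C -> C) : Prop :=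
  forall z0, inH z0 -> exists eps, 0 < eps /\
    forall z, inH z -> 0 < Cmod (z - z0) < eps -> f z = g z.

Definition mer_zero (f : C -> C) : Prop := mer_eq f (fun _ => RtoC 0).

Definition Mer (f : C -> C) : Prop :=
  forall z0, inH z0 -> exists eps, 0 < eps /\ eps <= Im z0 /\
    exists (m : nat) (g : C -> C),
      (forall z, Cmod (z - z0) < eps -> ex_derive g z) /\
      (forall z, 0 < Cmod (z - z0) < eps -> (Cpow (z - z0) m * f z = g z)%C).

(** complex derivative (0 where it does not exist: only junk points) *)
Definition Cderiv (f : C -> C) (z : C) : C :=
  match excluded_middle_informative (exists l : C, is_derive f z l) with
  | left H => proj1_sig (constructive_indefinite_description _ H)
  | right _ => RtoC 0
  end.

Definition fprime (f : C -> C) (z : C) : C :=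
  (Cderiv f z / (RtoC (2 * PI) * Ci))%C.

Definition qexp (z : C) : C :=
  (RtoC (exp (- (2 * PI * Im z))) * (cos (2 * PI * Re z), sin (2 * PI * Re z)))%C.

Definition sigma (r n : nat) : R :=
  fold_right Rplus 0
    (map (fun d => if Nat.eqb (n mod d) 0 then INR d ^ r else 0) (seq 1 n)).

Definition CSeries (a : nat -> C) : C :=
  (Series (fun n => Re (a n)), Series (fun n => Im (a n))).

Definition Eis (c : R) (r : nat) (z : C) : C :=
  (RtoC 1 + RtoC c * CSeries (fun n => RtoC (sigma r (S n)) * Cpow (qexp z) (S n)))%C.

Definition E2 : C -> C := Eis (-24) 1.
Definition E4 : C -> C := Eis 240 3.
Definition E6 : C -> C := Eis (-504) 5.

Definition Dop (k : R) (f : C -> C) : C -> C :=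
  fun z => (fprime f z - RtoC (k / 12) * E2 z * f z)%C.

(** delta^i (f,k) = (D_{k+2(i-1)} ... D_{k+2} D_k f, k + 2 i) *)
Fixpoint Dn (k : R) (i : nat) (f : C -> C) : C -> C :=
  match i with
  | O => f
  | S i' => Dop (k + 2 * INR i') (Dn k i' f)
  end.

(** Homogeneous element of weight w of M = C[E4,E6]:
    sum of c * E4^a * E6^b with 4a + 6b = w. *)
Definition MF (w : R) (h : C -> C) : Prop :=
  exists l : list (nat * nat * C)%type,
    List.Forall (fun t => INR (4 * fst (fst t) + 6 * snd (fst t))%nat = w) l /\
    forall z, inH z ->
      h z = fold_right Cplus (RtoC 0)
              (map (fun t => (snd t * Cpow (E4 z) (fst (fst t))
                                   * Cpow (E6 z) (snd (fst t)))%C) l).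

Definition Mbar (w : R) (h : C -> C) : Prop :=
  exists (v : R) (f g : C -> C),
    MF (w + v) f /\ MF v g /\ ~ mer_zero g /\ mer_eq h (fun z => (f z / g z)%C).

(** An element a of Rbar is a finite sum of terms h * delta^i with h in Mbar_w;
    a term is (i, w, h). *)
Definition term : Type := (nat * R * (C -> C))%type.
Definition t_ord (t : term) : nat := fst (fst t).
Definition t_wt (t : term) : R := snd (fst t).
Definition t_coef (t : term) : C -> C := snd t.

Definition valid (a : list term) : Prop :=
  List.Forall (fun t => Mbar (t_wt t) (t_coef t)) a.

Definition fsum (l : list (C -> C)) : C -> C :=
  fun z => fold_right Cplus (RtoC 0) (map (fun h => h z) l).

Definition Reqb (x y : R) : bool := if Req_EM_T x y then true else false.

Definition coef (a : list term) (i : nat) (w : R) : C -> C :=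
  fsum (map t_coef (filter (fun t => andb (Nat.eqb (t_ord t) i) (Reqb (t_wt t) w)) a)).

(** ord(a) = n: the coefficient of delta^n is nonzero (in the graded ring
    Mbar, i.e. some homogeneous component is nonzero) and all higher ones vanish *)
Definition ord_is (a : list term) (n : nat) : Prop :=
  (exists w, ~ mer_zero (coef a n w)) /\
  (forall i w, (n < i)%nat -> mer_zero (coef a i w)).

Definition act_comp (a : list term) (k : R) (f : C -> C) (v : R) : C -> C :=
  fsum (map (fun t => fun z => (t_coef t z * Dn k (t_ord t) f z)%C)
            (filter (fun t => Reqb (k + t_wt t + 2 * INR (t_ord t)) v) a)).

Definition annihilates (a : list term) (k : R) (f : C -> C) : Prop :=
  forall v, mer_zero (act_comp a k f v).

Definition Sbar (n : nat) (k : R) (f : C -> C) : Prop :=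
  Mer f /\ exists a, valid a /\ ord_is a n /\ annihilates a k f.

Definition homog (k : R) (b : list term) : Prop :=
  valid b /\ List.Forall (fun t => t_wt t + 2 * INR (t_ord t) = k) b.

(* Main.v *)
Require Import Defs.
From Stdlib Require Import Reals List Arith Lra Lia Psatz Permutation Classical ClassicalEpsilon.
From Coquelicot Require Import Coquelicot.
Open Scope R_scope.

(** An annihilator of [(f, k)] may be replaced by a homogeneous component with nonzero top
    coefficient, and then be made monic.  Thus [f] lies in some [Sbar n k] iff its iterated
    derivatives [delta^i f], [i < n], span a [delta]-stable space over the graded field [Mbar].
    Conversely, if [f] lies in a [delta]-stable space spanned by [N] homogeneous elements, the
    [N + 1] elements [f, delta f, .., delta^N f] are dependent, which gives an annihilator of
    order at most [N], and composing with powers of [delta] brings the order up to [N].  The four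
    claims use the spaces spanned by all [delta^i f] and [delta^j g], by all products
    [delta^i f * delta^j g], by the [delta^j g], and by the constant [1].

    Two facts from analysis enter.  That [Mbar] is stable under [delta] rests on Ramanujan's
    formulas for [E4'] and [E6'], equivalent to convolution identities for divisor sums; these
    come from the bijection [(a,b,x,y) -> (a-b,b,x,x+y)] between the solutions of [ax + by = n]
    with [a > b] and those with [x < y].  That derivatives of meromorphic functions are
    meromorphic, and that zeros of modular forms are isolated, rests on Cauchy's formula, obtained
    from Goursat's bisection argument applied to an explicit homotopy of circles. *)

(** * Complex differentiability *)

(** [Mbar] is a field only in the graded sense: a nonzero homogeneous element is invertible, a sum
    of several nonzero weights is not. So every linear-algebra step has to stay homogeneous, and
    generators, coefficients and vectors all carry real weights. Arguing with spans also means that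
    no product of two operators is ever computed. Functions are total and take arbitrary values at
    poles, so identities are proved off an exceptional set that is closed and discrete. Closedness
    is what allows differentiating such an identity; discreteness of the zeros of a modular form is
    what allows dividing by it. The bijection of quadruples yields an identity for each polynomial
    [P a b] invariant under [(a,b) -> (b,a)] and [(a,b) -> (a,a-b)]. These two reflections generate
    the dihedral group of order 12, the symmetries of the hexagonal lattice, with basic invariants
    [a^2 - a b + b^2] and [(a b (a - b))^2] of degrees 2 and 6. The square of the first gives the
    formula for [E4']; its cube together with the second gives the one for [E6']. *)

Definition cder (f : C -> C) (z l : C) : Prop :=
  forall eps, 0 < eps -> exists del, 0 < del /\
    forall w, Cmod (w - z) < del ->
      Cmod (f w - f z - (w - z) * l) <= eps * Cmod (w - z).

Lemma Cmod_sub_sym (a b : C) : Cmod (a - b) = Cmod (b - a).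
Proof. rewrite <- Cmod_opp. f_equal. ring. Qed.

Lemma Cmod_sub_triangle (a b c : C) : Cmod (a - c) <= Cmod (a - b) + Cmod (b - c).
Proof. replace (a - c)%C with ((a - b) + (b - c))%C by ring. apply Cmod_triangle. Qed.

Lemma Cmod_self (a : C) : Cmod (a - a) = 0.
Proof. replace (a - a)%C with (RtoC 0) by ring. apply Cmod_0. Qed.

Lemma Cmod_sub_0 (a b : C) : Cmod (a - b) = 0 -> a = b.
Proof.
  intros H. apply Cmod_eq_0 in H.
  replace a with ((a - b) + b)%C by ring. rewrite H. ring.
Qed.

Lemma Cmod_pos_sub (a b : C) : 0 < Cmod (a - b) -> (a - b)%C <> RtoC 0.
Proof. intros H E. rewrite E, Cmod_0 in H. lra. Qed.

Lemma im_le_Cmod (c : C) : Rabs (Im c) <= Cmod c.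
Proof. eapply Rle_trans; [|apply Rmax_Cmod]. apply Rmax_r. Qed.

Lemma Cmod_le_re_im (c : C) : Cmod c <= Rabs (Re c) + Rabs (Im c).
Proof.
  destruct c as [x y]. simpl.
  replace (x, y) with (RtoC x + RtoC y * Ci)%C.
  - eapply Rle_trans; [apply Cmod_triangle|].
    rewrite Cmod_mult, !Cmod_R, Cmod_Ci. lra.
  - apply injective_projections; simpl; ring.
Qed.

(** The bridge to the derivative used in [Mer] and [Cderiv]. The inequality form needs no division
    and no filter, so all calculus below is done with it. *)
Lemma cder_is_derive (f : C -> C) (z l : C) :
  cder f z l <-> is_derive (V := C_NormedModule) f z l.
Proof.
  split.
  - intros H. split.
    + apply is_linear_scal_l.
    + intros x Hx. assert (E := is_filter_lim_locally_unique (V:=AbsRing_NormedModule C_AbsRing) z x Hx). subst x.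
      intros eps. destruct (H eps (cond_pos eps)) as [d [d0 Hd]].
      exists (mkposreal d d0). intros w Hw. apply Hd, Hw.
  - intros [_ H] eps Heps.
    specialize (H z (fun P HP => HP) (mkposreal eps Heps)).
    destruct H as [[d d0] Hd]. exists d. split; [exact d0|].
    intros w Hw. apply (Hd w Hw).
Qed.

Lemma cder_ex (f : C -> C) (z : C) :
  ex_derive (V := C_NormedModule) f z <-> exists l, cder f z l.
Proof. split; intros [l H]; exists l; apply cder_is_derive; auto. Qed.

Lemma cder_unique (f : C -> C) (z l l' : C) : cder f z l -> cder f z l' -> l = l'.
Proof.
  intros H H'. apply cder_is_derive in H, H'.
  apply is_C_derive_unique in H, H'. congruence.
Qed.

Lemma Cderiv_eq (f : C -> C) (z l : C) : cder f z l -> Cderiv f z = l.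
Proof.
  intros H. unfold Cderiv.
  destruct (excluded_middle_informative _) as [E|E].
  - destruct (constructive_indefinite_description _ E) as [l' H']; simpl.
    apply cder_is_derive in H'. eapply cder_unique; eauto.
  - exfalso. apply E. exists l. apply cder_is_derive, H.
Qed.

Lemma cder_local (f g : C -> C) (z l : C) (d : R) :
  0 < d -> (forall w, Cmod (w - z) < d -> f w = g w) -> cder f z l -> cder g z l.
Proof.
  intros d0 Hd H eps Heps. destruct (H eps Heps) as [d' [d0' Hd']].
  exists (Rmin d d'). split. { apply Rmin_pos; auto. }
  intros w Hw.
  rewrite <- !Hd.
  - apply Hd'. eapply Rlt_le_trans; [apply Hw|apply Rmin_r].
  - rewrite Cmod_self; auto.
  - eapply Rlt_le_trans; [apply Hw|apply Rmin_l].
Qed.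

Lemma cder_ext (f g : C -> C) (z l : C) :
  (forall w, f w = g w) -> cder f z l -> cder g z l.
Proof. intros H. apply (cder_local f g z l 1); auto. lra. Qed.

(** Differentiability is itself a local property, so where one function has no derivative the other
    has none either, and both sides are the default value 0. *)
Lemma Cderiv_local (f g : C -> C) (z : C) (d : R) :
  0 < d -> (forall w, Cmod (w - z) < d -> f w = g w) -> Cderiv f z = Cderiv g z.
Proof.
  intros d0 H.
  destruct (classic (exists l, cder f z l)) as [[l Hl]|N].
  - rewrite (Cderiv_eq f z l Hl). symmetry. apply Cderiv_eq.
    eapply cder_local; eauto.
  - unfold Cderiv.
    destruct (excluded_middle_informative _) as [E|E].
    + exfalso. destruct E as [l E]. apply N. exists l. apply cder_is_derive; auto.
    + destruct (excluded_middle_informative _) as [E'|E']; auto.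
      exfalso. destruct E' as [l E']. apply N. exists l.
      apply cder_is_derive in E'. eapply cder_local; [apply d0| |apply E'].
      intros w Hw. symmetry. auto.
Qed.

Lemma cder_eq (f : C -> C) (z l l' : C) : cder f z l -> l = l' -> cder f z l'.
Proof. intros H <-. exact H. Qed.

Definition ccont (f : C -> C) (z : C) : Prop :=
  forall eps, 0 < eps -> exists del, 0 < del /\
    forall w, Cmod (w - z) < del -> Cmod (f w - f z) < eps.

Lemma cder_ccont (f : C -> C) (z l : C) : cder f z l -> ccont f z.
Proof.
  intros H eps Heps. destruct (H 1 Rlt_0_1) as [d [d0 Hd]].
  assert (Hl := Cmod_ge_0 l).
  set (e := eps / (2 + Cmod l)).
  assert (He : 0 < e) by (apply Rdiv_lt_0_compat; lra).
  exists (Rmin d e). split. { apply Rmin_pos; auto. }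
  intros w Hw.
  assert (H1 := Hd w (Rlt_le_trans _ _ _ Hw (Rmin_l _ _))).
  assert (H2 := Rlt_le_trans _ _ _ Hw (Rmin_r _ _)).
  replace (f w - f z)%C with ((f w - f z - (w - z) * l) + (w - z) * l)%C by ring.
  eapply Rle_lt_trans; [apply Cmod_triangle|]. rewrite Cmod_mult.
  assert (E : eps = e * (2 + Cmod l)) by (unfold e; field; lra).
  rewrite E. assert (H3 := Cmod_ge_0 (w - z)). nra.
Qed.

Lemma cder_const (c z : C) : cder (fun _ => c) z 0.
Proof.
  intros e He. exists 1. split; [lra|]. intros w _.
  replace (c - c - (w - z) * 0)%C with (RtoC 0) by ring. rewrite Cmod_0.
  assert (H3 := Cmod_ge_0 (w - z)). nra.
Qed.

Lemma cder_id (z : C) : cder (fun w => w) z 1.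
Proof.
  intros e He. exists 1. split; [lra|]. intros w _.
  replace (w - z - (w - z) * 1)%C with (RtoC 0) by ring. rewrite Cmod_0.
  assert (H3 := Cmod_ge_0 (w - z)). nra.
Qed.

Lemma cder_plus (f g : C -> C) (z a b : C) :
  cder f z a -> cder g z b -> cder (fun w => f w + g w)%C z (a + b).
Proof.
  intros Hf Hg e He.
  destruct (Hf (e/2)) as [d1 [P1 H1]]; [lra|].
  destruct (Hg (e/2)) as [d2 [P2 H2]]; [lra|].
  exists (Rmin d1 d2). split. { apply Rmin_pos; auto. }
  intros w Hw.
  specialize (H1 w (Rlt_le_trans _ _ _ Hw (Rmin_l _ _))).
  specialize (H2 w (Rlt_le_trans _ _ _ Hw (Rmin_r _ _))).
  replace (f w + g w - (f z + g z) - (w - z) * (a + b))%C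
    with ((f w - f z - (w - z) * a) + (g w - g z - (w - z) * b))%C by ring.
  eapply Rle_trans; [apply Cmod_triangle|]. lra.
Qed.

Lemma cder_mult (f g : C -> C) (z a b : C) :
  cder f z a -> cder g z b -> cder (fun w => f w * g w)%C z (a * g z + f z * b).
Proof.
  intros Hf Hg e He.
  assert (Hgc := cder_ccont _ _ _ Hg 1 Rlt_0_1).
  destruct Hgc as [d3 [P3 H3]].
  set (K := 1 + Cmod (g z)). set (F := 1 + Cmod (f z)). set (A := 1 + Cmod a).
  assert (GP := Cmod_ge_0 (g z)). assert (FP := Cmod_ge_0 (f z)).
  assert (AP := Cmod_ge_0 a).
  assert (E1 : 0 < e / (3 * K)) by (apply Rdiv_lt_0_compat; unfold K; lra).
  assert (E2 : 0 < e / (3 * F)) by (apply Rdiv_lt_0_compat; unfold F; lra).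
  assert (E3 : 0 < e / (3 * A)) by (apply Rdiv_lt_0_compat; unfold A; lra).
  destruct (Hf _ E1) as [d1 [P1 H1]].
  destruct (Hg _ E2) as [d2 [P2 H2]].
  destruct (cder_ccont _ _ _ Hg _ E3) as [d4 [P4 H4]].
  exists (Rmin (Rmin d1 d2) (Rmin d3 d4)).
  split. { repeat apply Rmin_pos; auto. }
  intros w Hw.
  destruct (Rmin_Rgt_l _ _ _ Hw) as [W12 W34].
  destruct (Rmin_Rgt_l _ _ _ W12) as [W1 W2]. destruct (Rmin_Rgt_l _ _ _ W34) as [W3 W4].
  specialize (H1 w W1). specialize (H2 w W2). specialize (H3 w W3). specialize (H4 w W4).
  replace (f w * g w - f z * g z - (w - z) * (a * g z + f z * b))%C
    with ((f w - f z - (w - z) * a) * g w + f z * (g w - g z - (w - z) * b)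
          + (w - z) * a * (g w - g z))%C by ring.
  eapply Rle_trans; [apply Cmod_triangle|].
  eapply Rle_trans; [apply Rplus_le_compat_r, Cmod_triangle|].
  rewrite !Cmod_mult.
  assert (GW : Cmod (g w) <= K).
  { unfold K. replace (g w) with ((g w - g z) + g z)%C by ring.
    eapply Rle_trans; [apply Cmod_triangle|]. lra. }
  set (x := Cmod (w - z)) in *. assert (X := Cmod_ge_0 (w - z)). fold x in X.
  assert (T1 : Cmod (f w - f z - (w - z) * a) * Cmod (g w) <= e / (3 * K) * x * K).
  { apply Rmult_le_compat; auto using Cmod_ge_0. }
  assert (T2 : Cmod (f z) * Cmod (g w - g z - (w - z) * b) <= F * (e / (3 * F) * x)).
  { apply Rmult_le_compat; auto using Cmod_ge_0. unfold F; lra. }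
  assert (T3 : x * Cmod a * Cmod (g w - g z) <= x * A * (e / (3 * A))).
  { apply Rmult_le_compat; auto using Cmod_ge_0.
    - apply Rmult_le_pos; auto.
    - apply Rmult_le_compat_l; auto. unfold A; lra.
    - lra. }
  replace (e * x) with (e / (3 * K) * x * K + F * (e / (3 * F) * x) + x * A * (e / (3 * A))).
  - lra.
  - field. unfold K, F, A; lra.
Qed.

Lemma cder_comp (f g : C -> C) (z a b : C) :
  cder g z a -> cder f (g z) b -> cder (fun w => f (g w)) z (a * b).
Proof.
  intros Hg Hf e He.
  assert (AP := Cmod_ge_0 a). assert (BP := Cmod_ge_0 b).
  set (A := 1 + Cmod a). set (B := 1 + Cmod b).
  assert (E1 : 0 < e / (2 * A)) by (apply Rdiv_lt_0_compat; unfold A; lra).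
  assert (E2 : 0 < e / (2 * B)) by (apply Rdiv_lt_0_compat; unfold B; lra).
  destruct (Hf _ E1) as [d1 [P1 H1]].
  destruct (Hg _ E2) as [d2 [P2 H2]].
  destruct (Hg 1 Rlt_0_1) as [d3 [P3 H3]].
  destruct (cder_ccont _ _ _ Hg _ P1) as [d4 [P4 H4]].
  exists (Rmin d2 (Rmin d3 d4)). split. { repeat apply Rmin_pos; auto. }
  intros w Hw.
  destruct (Rmin_Rgt_l _ _ _ Hw) as [W2 W34]. destruct (Rmin_Rgt_l _ _ _ W34) as [W3 W4].
  specialize (H2 w W2). specialize (H3 w W3). specialize (H4 w W4).
  specialize (H1 (g w) H4).
  replace (f (g w) - f (g z) - (w - z) * (a * b))%C
    with ((f (g w) - f (g z) - (g w - g z) * b) + (g w - g z - (w - z) * a) * b)%C by ring.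
  eapply Rle_trans; [apply Cmod_triangle|]. rewrite Cmod_mult.
  set (x := Cmod (w - z)) in *. assert (X := Cmod_ge_0 (w - z)). fold x in X.
  assert (G : Cmod (g w - g z) <= A * x).
  { replace (g w - g z)%C with ((g w - g z - (w - z) * a) + (w - z) * a)%C by ring.
    eapply Rle_trans; [apply Cmod_triangle|]. rewrite Cmod_mult. fold x. unfold A. lra. }
  assert (T1 : e / (2 * A) * Cmod (g w - g z) <= e / (2 * A) * (A * x)).
  { apply Rmult_le_compat_l; lra. }
  assert (T2 : Cmod (g w - g z - (w - z) * a) * Cmod b <= e / (2 * B) * x * B).
  { apply Rmult_le_compat; auto using Cmod_ge_0. unfold B; lra. }
  replace (e * x) with (e / (2 * A) * (A * x) + e / (2 * B) * x * B).
  - lra.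
  - field. unfold A, B; lra.
Qed.

Lemma cder_inv_id (z : C) : z <> RtoC 0 -> cder (fun w => / w)%C z (- (/ (z * z)))%C.
Proof.
  intros Hz e He.
  assert (P : 0 < Cmod z) by (apply Cmod_gt_0; auto).
  set (m := Cmod z) in *.
  assert (P3 : 0 < e * (m * m * m) / 2).
  { assert (0 < e * (m * m * m)) by (repeat apply Rmult_lt_0_compat; auto). lra. }
  exists (Rmin (m / 2) (e * (m * m * m) / 2)). split. { apply Rmin_pos; lra. }
  intros w Hw.
  destruct (Rmin_Rgt_l _ _ _ Hw) as [W1 W2].
  assert (MW : m / 2 < Cmod w).
  { assert (T := Cmod_sub_triangle z w 0). rewrite Cmod_sub_sym in W1.
    replace (z - 0)%C with z in T by ring. replace (w - 0)%C with w in T by ring.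
    fold m in T. lra. }
  assert (Hw0 : w <> RtoC 0). { intros E. rewrite E, Cmod_0 in MW. lra. }
  (* The error is exactly [(w - z)^2 / (w z^2)]; the radius [m / 2] keeps [w] away from 0. *)
  replace (/ w - / z - (w - z) * - / (z * z))%C with ((w - z) * ((w - z) * / (w * (z * z))))%C
    by (field; auto).
  rewrite Cmod_mult, Rmult_comm. apply Rmult_le_compat_r; [apply Cmod_ge_0|].
  rewrite Cmod_mult, Cmod_inv, !Cmod_mult by (repeat apply Cmult_neq_0; auto).
  fold m.
  apply Rle_trans with (Cmod (w - z) * / (m / 2 * (m * m))).
  - apply Rmult_le_compat_l; [apply Cmod_ge_0|].
    apply Rinv_le_contravar. { repeat apply Rmult_lt_0_compat; lra. }
    apply Rmult_le_compat_r; [apply Rmult_le_pos; lra|lra].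
  - apply Rle_trans with (e * (m * m * m) / 2 * / (m / 2 * (m * m))).
    + apply Rmult_le_compat_r; [|lra]. left. apply Rinv_0_lt_compat.
      repeat apply Rmult_lt_0_compat; lra.
    + right. field. lra.
Qed.

Lemma cder_inv (f : C -> C) (z a : C) :
  cder f z a -> f z <> RtoC 0 -> cder (fun w => / f w)%C z (- (a / (f z * f z)))%C.
Proof.
  intros H Hz. replace (- (a / (f z * f z)))%C with (a * - / (f z * f z))%C.
  - apply (cder_comp (fun w => / w)%C f); auto. apply cder_inv_id; auto.
  - unfold Cdiv. ring.
Qed.

Lemma cder_minus (f g : C -> C) (z a b : C) :
  cder f z a -> cder g z b -> cder (fun w => f w - g w)%C z (a - b).
Proof.
  intros Hf Hg.
  replace (a - b)%C with (a + (0 * g z + (-(1)) * b))%C by ring.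
  apply (cder_ext (fun w => f w + (-(1)) * g w)%C); [intros; ring|].
  apply cder_plus; auto. apply (cder_mult (fun _ => -(1))%C); auto. apply cder_const.
Qed.

Definition cdiff (f : C -> C) (z : C) : Prop := exists l, cder f z l.

Lemma cdiff_ccont f z : cdiff f z -> ccont f z.
Proof. intros [l H]. eapply cder_ccont; eauto. Qed.
Lemma cdiff_const c z : cdiff (fun _ => c) z.
Proof. eexists; apply cder_const. Qed.
Lemma cdiff_id z : cdiff (fun w => w) z.
Proof. eexists; apply cder_id. Qed.
Lemma cdiff_plus f g z : cdiff f z -> cdiff g z -> cdiff (fun w => f w + g w)%C z.
Proof. intros [a Ha] [b Hb]. eexists; apply cder_plus; eauto. Qed.
Lemma cdiff_minus f g z : cdiff f z -> cdiff g z -> cdiff (fun w => f w - g w)%C z.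
Proof. intros [a Ha] [b Hb]. eexists; apply cder_minus; eauto. Qed.
Lemma cdiff_mult f g z : cdiff f z -> cdiff g z -> cdiff (fun w => f w * g w)%C z.
Proof. intros [a Ha] [b Hb]. eexists; apply cder_mult; eauto. Qed.
Lemma cdiff_inv f z : cdiff f z -> f z <> RtoC 0 -> cdiff (fun w => / f w)%C z.
Proof. intros [a Ha] H. eexists; apply cder_inv; eauto. Qed.
Lemma cdiff_div f g z : cdiff f z -> cdiff g z -> g z <> RtoC 0 -> cdiff (fun w => f w / g w)%C z.
Proof. intros H1 H2 H3. apply cdiff_mult; auto. apply cdiff_inv; auto. Qed.
Lemma cdiff_pow f n z : cdiff f z -> cdiff (fun w => f w ^ n)%C z.
Proof.
  intros H. induction n as [|n IH]; simpl; [apply cdiff_const|]. apply cdiff_mult; auto.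
Qed.
Lemma cdiff_shift c z : cdiff (fun w => w - c)%C z.
Proof. apply cdiff_minus; [apply cdiff_id|apply cdiff_const]. Qed.
Lemma cdiff_local f g z d :
  0 < d -> (forall w, Cmod (w - z) < d -> f w = g w) -> cdiff f z -> cdiff g z.
Proof. intros H1 H2 [l H]. exists l. eapply cder_local; eauto. Qed.
Lemma cdiff_comp f g z : cdiff g z -> cdiff f (g z) -> cdiff (fun w => f (g w)) z.
Proof. intros [a Ha] [b Hb]. eexists. apply (cder_comp f g); eauto. Qed.

(** * Integrals along paths and Goursat's theorem *)

(** The intervals [[u k, u k + a / 2^k]] are nested, and the supremum of their left ends lies in
    each of them. *)
Lemma nested_point (u : nat -> R) (a : R) :
  (forall k, u k <= u (S k) /\ u (S k) + a * (/2) ^ (S k) <= u k + a * (/2) ^ k) ->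
  0 <= a ->
  exists p, forall k, u k <= p <= u k + a * (/2) ^ k.
Proof.
  intros H Ha.
  assert (P : forall k, 0 <= a * (/2) ^ k).
  { intros k. apply Rmult_le_pos; auto. apply pow_le. lra. }
  assert (M : forall j i, u i <= u (i + j)%nat).
  { induction j as [|j IH]; intros i. { rewrite Nat.add_0_r; lra. }
    rewrite Nat.add_succ_r. eapply Rle_trans; [apply IH|apply H]. }
  assert (M' : forall j i, u (i + j)%nat + a * (/2) ^ (i + j) <= u i + a * (/2) ^ i).
  { induction j as [|j IH]; intros i. { rewrite Nat.add_0_r; lra. }
    rewrite Nat.add_succ_r. eapply Rle_trans; [apply H|apply IH]. }
  assert (B : forall i j, u i <= u j + a * (/2) ^ j).
  { intros i j. destruct (Nat.le_ge_cases i j) as [L|L].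
    - replace j with (i + (j - i))%nat by lia. specialize (M (j - i)%nat i).
      specialize (P (i + (j - i))%nat). lra.
    - replace i with (j + (i - j))%nat by lia. specialize (M' (i - j)%nat j).
      specialize (P (j + (i - j))%nat). lra. }
  destruct (completeness (EUn u)) as [p [Hp1 Hp2]].
  - exists (u O + a * (/2) ^ 0). intros x [i ->]. apply B.
  - exists (u O). exists O. reflexivity.
  - exists p. intros k. split.
    + apply Hp1. exists k. reflexivity.
    + apply Hp2. intros x [i ->]. apply B.
Qed.

Lemma half_pow_small (a d : R) : 0 <= a -> 0 < d -> exists k, a * (/2) ^ k < d.
Proof.
  intros Ha Hd.
  destruct (pow_lt_1_zero (/2)) with (y := d / (a + 1)) as [N HN].
  - rewrite Rabs_pos_eq; lra.
  - apply Rdiv_lt_0_compat; lra.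
  - exists N. specialize (HN N (le_n _)). rewrite Rabs_pos_eq in HN by (apply pow_le; lra).
    assert (P : 0 < (/2) ^ N) by (apply pow_lt; lra).
    apply Rle_lt_trans with ((a + 1) * (/2) ^ N); [nra|].
    apply Rlt_le_trans with ((a + 1) * (d / (a + 1))).
    + apply Rmult_lt_compat_l; lra.
    + right. field. lra.
Qed.

(* Goursat's bisection argument, for an abstract additive function of rectangles. *)
Lemma additive_rectangle_zero (Q : R -> R -> R -> R -> C) (a b : R) :
  0 < a -> 0 < b ->
  (forall s0 s1 s2 t0 t1, 0 <= s0 <= s1 -> s1 <= s2 <= a -> 0 <= t0 <= t1 -> t1 <= b ->
     Q s0 s2 t0 t1 = Q s0 s1 t0 t1 + Q s1 s2 t0 t1)%C ->
  (forall s0 s1 t0 t1 t2, 0 <= s0 <= s1 -> s1 <= a -> 0 <= t0 <= t1 -> t1 <= t2 <= b ->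
     Q s0 s1 t0 t2 = Q s0 s1 t0 t1 + Q s0 s1 t1 t2)%C ->
  (forall s t, 0 <= s <= a -> 0 <= t <= b -> forall eps, 0 < eps -> exists del, 0 < del /\
     forall s0 s1 t0 t1, 0 <= s0 <= s -> s <= s1 <= a -> 0 <= t0 <= t -> t <= t1 <= b ->
       s1 - s0 < del -> t1 - t0 < del ->
       Cmod (Q s0 s1 t0 t1) <= eps * ((s1 - s0) + (t1 - t0)) ^ 2) ->
  Q 0 a 0 b = 0.
Proof.
  intros Ha Hb Hs Ht Hloc.
  apply Cmod_eq_0. destruct (Rle_lt_or_eq_dec _ _ (Cmod_ge_0 (Q 0 a 0 b))) as [c0|]; auto.
  exfalso. set (c := Cmod (Q 0 a 0 b)) in *.
  (* A subrectangle of depth [k], given by its lower corner, is bad if [Q] has lost at most a factor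
     [4^k] on it. By additivity one of the four quarters of a bad rectangle is bad. *)
  set (bad := fun (k : nat) (p : R * R) =>
    0 <= fst p /\ fst p + a * (/2) ^ k <= a /\ 0 <= snd p /\ snd p + b * (/2) ^ k <= b /\
    c * (/4) ^ k <= Cmod (Q (fst p) (fst p + a * (/2) ^ k) (snd p) (snd p + b * (/2) ^ k))).
  set (sub := fun (k : nat) (p p' : R * R) =>
    fst p <= fst p' /\ fst p' + a * (/2) ^ (S k) <= fst p + a * (/2) ^ k /\
    snd p <= snd p' /\ snd p' + b * (/2) ^ (S k) <= snd p + b * (/2) ^ k).
  assert (step : forall k p, bad k p -> exists p', bad (S k) p' /\ sub k p p').
  { intros k [s t] (B1 & B2 & B3 & B4 & B5). simpl in B1, B2, B3, B4, B5.
    set (da := a * (/2) ^ (S k)). set (db := b * (/2) ^ (S k)).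
    assert (Pk : 0 < (/2) ^ k) by (apply pow_lt; lra).
    assert (Ea : a * (/2) ^ k = da + da) by (unfold da; simpl; lra).
    assert (Eb : b * (/2) ^ k = db + db) by (unfold db; simpl; lra).
    assert (Pa : 0 < da) by (unfold da; simpl; nra).
    assert (Pb : 0 < db) by (unfold db; simpl; nra).
    rewrite Ea, Eb in *.
    assert (E : Q s (s + (da + da)) t (t + (db + db)) =
       Cplus (Cplus (Q s (s + da) t (t + db)) (Q s (s + da) (t + db) (t + db + db)))
       (Cplus (Q (s + da) (s + da + da) t (t + db)) (Q (s + da) (s + da + da) (t + db) (t + db + db)))).
    { rewrite (Hs s (s + da)) by lra. rewrite !(Ht _ _ t (t + db) (t + (db + db))) by lra.
      rewrite <- !Rplus_assoc. reflexivity. }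
    assert (E4 : c * (/4) ^ k = 4 * (c * (/4) ^ (S k))) by (simpl; field; apply pow_nonzero; lra).
    destruct (Rle_lt_dec (c * (/4) ^ (S k)) (Cmod (Q s (s + da) t (t + db)))) as [G|G1].
    { exists (s, t). unfold bad, sub; simpl fst; simpl snd. fold da db. rewrite Ea, Eb. repeat split; lra. }
    destruct (Rle_lt_dec (c * (/4) ^ (S k)) (Cmod (Q s (s + da) (t + db) (t + db + db)))) as [G|G2].
    { exists (s, t + db). unfold bad, sub; simpl fst; simpl snd. fold da db. rewrite Ea, Eb. repeat split; lra. }
    destruct (Rle_lt_dec (c * (/4) ^ (S k)) (Cmod (Q (s + da) (s + da + da) t (t + db)))) as [G|G3].
    { exists (s + da, t). unfold bad, sub; simpl fst; simpl snd. fold da db. rewrite Ea, Eb. repeat split; lra. }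
    destruct (Rle_lt_dec (c * (/4) ^ (S k)) (Cmod (Q (s + da) (s + da + da) (t + db) (t + db + db)))) as [G|G4].
    { exists (s + da, t + db). unfold bad, sub; simpl fst; simpl snd. fold da db. rewrite Ea, Eb. repeat split; lra. }
    exfalso. rewrite E in B5.
    assert (T1 := Cmod_triangle (Cplus (Q s (s + da) t (t + db)) (Q s (s + da) (t + db) (t + db + db)))
       (Cplus (Q (s + da) (s + da + da) t (t + db)) (Q (s + da) (s + da + da) (t + db) (t + db + db)))).
    assert (T2 := Cmod_triangle (Q s (s + da) t (t + db)) (Q s (s + da) (t + db) (t + db + db))).
    assert (T3 := Cmod_triangle (Q (s + da) (s + da + da) t (t + db)) (Q (s + da) (s + da + da) (t + db) (t + db + db))).
    lra. }
  assert (B0 : bad O (0, 0)).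
  { unfold bad; simpl. replace (0 + a * 1) with a by ring. replace (0 + b * 1) with b by ring.
    fold c. lra. }
  set (nxt := fun k (x : {p | bad k p}) =>
    constructive_indefinite_description _ (step k (proj1_sig x) (proj2_sig x))).
  set (u := fix u (k : nat) : {p | bad k p} :=
    match k with
    | O => exist _ (0, 0) B0
    | S k' => exist _ (proj1_sig (nxt k' (u k'))) (proj1 (proj2_sig (nxt k' (u k'))))
    end).
  assert (Hu : forall k, sub k (proj1_sig (u k)) (proj1_sig (u (S k)))).
  { intros k. simpl. exact (proj2 (proj2_sig (nxt k (u k)))). }
  destruct (nested_point (fun k => fst (proj1_sig (u k))) a) as [s Ss]; [|lra|].
  { intros k. destruct (Hu k) as (H1 & H2 & H3 & H4). split; auto. }
  destruct (nested_point (fun k => snd (proj1_sig (u k))) b) as [t St]; [|lra|].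
  { intros k. destruct (Hu k) as (H1 & H2 & H3 & H4). split; auto. }
  (* With this [eps] the local bound at depth [k] equals [(c / 2) / 4^k], half of what badness
     guarantees. *)
  set (eps := c / (2 * (a + b) ^ 2)).
  assert (Pab : 0 < (a + b) ^ 2) by (apply pow_lt; lra).
  assert (He : 0 < eps) by (apply Rdiv_lt_0_compat; lra).
  destruct (Hloc s t) with (eps := eps) as [d [d0 Hd]]; auto.
  { specialize (Ss O). simpl in Ss. lra. }
  { specialize (St O). simpl in St. lra. }
  destruct (half_pow_small (a + b) d) as [k Hk]; [lra|auto|].
  destruct (proj2_sig (u k)) as (B1 & B2 & B3 & B4 & B5).
  specialize (Ss k). specialize (St k). simpl in Ss, St.
  set (p := proj1_sig (u k)) in *.
  assert (Pk : 0 < (/2) ^ k) by (apply pow_lt; lra).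
  assert (K : Cmod (Q (fst p) (fst p + a * (/2) ^ k) (snd p) (snd p + b * (/2) ^ k))
     <= eps * ((fst p + a * (/2) ^ k - fst p) + (snd p + b * (/2) ^ k - snd p)) ^ 2).
  { apply Hd; try lra; nra. }
  assert (E : eps * ((fst p + a * (/2) ^ k - fst p) + (snd p + b * (/2) ^ k - snd p)) ^ 2
     = (c / 2) * (/4) ^ k).
  { replace (/4) with (/2 * /2) by lra. rewrite Rpow_mult_distr. unfold eps. field. lra. }
  rewrite E in K. assert (P4 : 0 < (/4) ^ k) by (apply pow_lt; lra). nra.
Qed.

(** * The complex exponential *)

Definition cexp (z : C) : C := (RtoC (exp (Re z)) * (cos (Im z), sin (Im z)))%C.

Lemma cexp_plus (z w : C) : cexp (z + w) = (cexp z * cexp w)%C.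
Proof.
  unfold cexp. destruct z as [a b], w as [x y]. simpl. rewrite exp_plus, cos_plus, sin_plus.
  apply injective_projections; simpl; ring.
Qed.

Lemma cexp_0 : cexp 0 = 1.
Proof.
  unfold cexp. simpl. rewrite exp_0, cos_0, sin_0.
  apply injective_projections; simpl; ring.
Qed.

Lemma derivable_pt_lim_bound (f : R -> R) (x l eps : R) :
  derivable_pt_lim f x l -> 0 < eps ->
  exists d, 0 < d /\ forall h, Rabs h < d -> Rabs (f (x + h) - f x - h * l) <= eps * Rabs h.
Proof.
  intros H He. destruct (H eps He) as [[d d0] Hd]. exists d. split; auto.
  intros h Hh. destruct (Req_dec h 0) as [->|N].
  - rewrite Rplus_0_r, Rabs_R0. replace (f x - f x - 0 * l) with 0 by ring. rewrite Rabs_R0. lra.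
  - specialize (Hd h N Hh).
    replace (f (x + h) - f x - h * l) with (((f (x + h) - f x) / h - l) * h) by (field; auto).
    rewrite Rabs_mult. apply Rmult_le_compat_r; [apply Rabs_pos|lra].
Qed.

Lemma cder_cexp_0 : cder cexp 0 1.
Proof.
  (* The real and imaginary parts of the error add up to at most [9 e |w|]; the bound [e <= 1]
     controls the products of two small terms. *)
  intros e' He'. set (e := Rmin 1 (e' / 10)).
  assert (He : 0 < e) by (apply Rmin_pos; lra).
  assert (e1 : e <= 1) by apply Rmin_l.
  assert (e2 : e <= e' / 10) by apply Rmin_r.
  destruct (derivable_pt_lim_bound _ 0 _ e derivable_pt_lim_exp_0 He) as [d1 [P1 H1]].
  destruct (derivable_pt_lim_bound _ 0 _ e (derivable_pt_lim_sin 0) He) as [d2 [P2 H2]].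
  destruct (derivable_pt_lim_bound _ 0 _ e (derivable_pt_lim_cos 0) He) as [d3 [P3 H3]].
  exists (Rmin (Rmin d1 d2) (Rmin d3 e)). split. { repeat apply Rmin_pos; auto; lra. }
  intros w Hw. replace (w - 0)%C with w in * by ring.
  destruct (Rmin_Rgt_l _ _ _ Hw) as [Q12 Q34].
  destruct (Rmin_Rgt_l _ _ _ Q12) as [Q1 Q2]. destruct (Rmin_Rgt_l _ _ _ Q34) as [Q3 Q4].
  assert (R1 := re_le_Cmod w). assert (R2 := im_le_Cmod w).
  specialize (H1 (Re w)). specialize (H2 (Im w)). specialize (H3 (Im w)).
  rewrite cexp_0. unfold cexp.
  set (a := Re w) in *. set (b := Im w) in *.
  rewrite !Rplus_0_l in *. rewrite exp_0 in H1. rewrite sin_0, cos_0 in H2. rewrite cos_0, sin_0 in H3.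
  specialize (H1 (Rle_lt_trans _ _ _ R1 Q1)). specialize (H2 (Rle_lt_trans _ _ _ R2 Q2)).
  specialize (H3 (Rle_lt_trans _ _ _ R2 Q3)).
  eapply Rle_trans; [apply Cmod_le_re_im|]. simpl. change (fst w) with a. change (snd w) with b.
  change (Re w) with a. change (Im w) with b.
  set (x := exp a) in *. set (al := x - 1 - a * 1) in *.
  set (be := cos b - 1 - b * - 0) in *. set (ga := sin b - 0 - b * 1) in *.
  assert (Ex : x = 1 + a + al) by (unfold al; ring).
  replace (x * cos b - 0 * sin b + - (1) + - (a * 1 - b * 0)) with (al + x * be) by (unfold be, al; ring).
  replace (x * sin b + 0 * cos b + - 0 + - (a * 0 + b * 1)) with (x * ga + (a + al) * b).
  2:{ unfold ga. rewrite Ex. ring. }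
  assert (Pa := Rabs_pos a). assert (Pb := Rabs_pos b).
  assert (Hx : Rabs x <= 3).
  { rewrite Ex. eapply Rle_trans; [apply Rabs_triang|]. eapply Rle_trans; [apply Rplus_le_compat_r, Rabs_triang|].
    rewrite Rabs_R1. nra. }
  assert (Haa : Rabs (a + al) <= 2 * e).
  { eapply Rle_trans; [apply Rabs_triang|]. nra. }
  assert (T1 : Rabs (al + x * be) <= e * Rabs a + 3 * (e * Rabs b)).
  { eapply Rle_trans; [apply Rabs_triang|]. rewrite Rabs_mult.
    apply Rplus_le_compat; auto. apply Rmult_le_compat; auto using Rabs_pos. }
  assert (T2 : Rabs (x * ga + (a + al) * b) <= 3 * (e * Rabs b) + 2 * e * Rabs b).
  { eapply Rle_trans; [apply Rabs_triang|]. rewrite !Rabs_mult.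
    apply Rplus_le_compat; apply Rmult_le_compat; auto using Rabs_pos; lra. }
  assert (U1 : e * Rabs a <= e * Cmod w) by (apply Rmult_le_compat_l; lra).
  assert (U2 : e * Rabs b <= e * Cmod w) by (apply Rmult_le_compat_l; lra).
  assert (U3 : e * Cmod w <= e' / 10 * Cmod w) by (apply Rmult_le_compat_r; [apply Cmod_ge_0|lra]).
  assert (U4 := Rmult_le_pos _ _ (Rlt_le _ _ He') (Cmod_ge_0 w)). lra.
Qed.

(** The functional equation carries the derivative at 0 to every other point. *)
Lemma cder_cexp (z : C) : cder cexp z (cexp z).
Proof.
  apply (cder_ext (fun w => cexp z * cexp (w - z))%C).
  { intros w. rewrite <- cexp_plus. f_equal. ring. }
  eapply cder_eq.
  - apply (cder_mult (fun _ => cexp z)). { apply cder_const. }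
    apply (cder_comp cexp (fun w => w - z)%C).
    + apply cder_minus; [apply cder_id|apply cder_const].
    + replace (z - z)%C with (RtoC 0) by ring. apply cder_cexp_0.
  - ring.
Qed.

Lemma Cmod_cexp_i (t : R) : Cmod (cexp (Ci * t)) = 1.
Proof.
  unfold cexp. rewrite Cmod_mult, Cmod_R. simpl.
  replace (0 * t - 1 * 0) with 0 by ring. replace (0 * 0 + 1 * t) with t by ring.
  rewrite exp_0, Rabs_R1. unfold Cmod. simpl.
  replace (cos t * (cos t * 1) + sin t * (sin t * 1)) with 1.
  - rewrite sqrt_1. ring.
  - assert (H := sin2_cos2 t). unfold Rsqr in H. lra.
Qed.

Lemma cexp_2pi : cexp (Ci * RtoC (2 * PI)) = 1.
Proof.
  unfold cexp. simpl. replace (0 * (2 * PI) - 1 * 0) with 0 by ring.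
  replace (0 * 0 + 1 * (2 * PI)) with (2 * PI) by ring. rewrite exp_0, cos_2PI, sin_2PI.
  apply injective_projections; simpl; ring.
Qed.

(** * Integrals over real segments and along paths *)

Definition RIntC (g : C -> C) (a b : R) : C :=
  RInt (V := C_R_CompleteNormedModule) (fun x : R => g (RtoC x)) a b.

(** Paths and integrands stay functions of a complex variable, so that the rules for [cder] apply to
    them, while conditions are imposed only at the real points of the segment. *)
Definition on_seg (P : C -> Prop) (a b : R) : Prop := forall x, a <= x <= b -> P (RtoC x).

Lemma Cmod_RtoC_sub (x y : R) : Cmod (RtoC x - RtoC y) = Rabs (x - y).
Proof. rewrite <- RtoC_minus. apply Cmod_R. Qed.

Lemma ccont_continuous (g : C -> C) (x : R) :
  ccont g x -> continuous (U := C_R_CompleteNormedModule) (fun y : R => g (RtoC y)) x.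
Proof.
  intros H. apply filterlim_locally. intros eps.
  destruct (H eps (cond_pos eps)) as [d [d0 Hd]].
  exists (mkposreal d d0). intros y Hy.
  assert (K : Cmod (g (RtoC y) - g (RtoC x)) < eps).
  { apply Hd. rewrite Cmod_RtoC_sub. exact Hy. }
  apply (C_NormedModule_mixin_compat1 _ _ _ K).
Qed.

Lemma RIntC_ex (g : C -> C) (a b : R) :
  a <= b -> on_seg (ccont g) a b ->
  ex_RInt (V := C_R_CompleteNormedModule) (fun x : R => g (RtoC x)) a b.
Proof.
  intros Hab H. apply ex_RInt_continuous. intros z Hz.
  rewrite Rmin_left, Rmax_right in Hz by auto. apply ccont_continuous, H, Hz.
Qed.

Lemma RIntC_correct (g : C -> C) (a b : R) :
  a <= b -> on_seg (ccont g) a b ->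
  is_RInt (V := C_R_NormedModule) (fun x : R => g (RtoC x)) a b (RIntC g a b).
Proof. intros. apply (RInt_correct (V := C_R_CompleteNormedModule)). apply RIntC_ex; auto. Qed.

Lemma RIntC_ext (f g : C -> C) (a b : R) :
  a <= b -> on_seg (fun z => f z = g z) a b -> RIntC f a b = RIntC g a b.
Proof.
  intros Hab H. apply (RInt_ext (V := C_R_CompleteNormedModule)). intros x Hx.
  rewrite Rmin_left, Rmax_right in Hx by auto. apply H. lra.
Qed.

Lemma RIntC_Chasles (g : C -> C) (a b c : R) :
  a <= b <= c -> on_seg (ccont g) a c ->
  (RIntC g a c = RIntC g a b + RIntC g b c)%C.
Proof.
  intros [H1 H2] H. symmetry.
  apply (RInt_Chasles (V := C_R_CompleteNormedModule)); apply RIntC_ex; auto;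
    intros x Hx; apply H; lra.
Qed.

(** The integral takes values in [C] as a real vector space, so a complex scalar is moved out
    componentwise. *)
Lemma RIntC_scal (c : C) (g : C -> C) (a b : R) :
  a <= b -> on_seg (ccont g) a b ->
  (RIntC (fun z => c * g z) a b = c * RIntC g a b)%C.
Proof.
  intros Hab Hg. apply (is_RInt_unique (V := C_R_CompleteNormedModule)).
  assert (H := RIntC_correct g a b Hab Hg).
  set (l := RIntC g a b) in *.
  assert (H1 := is_RInt_fct_extend_fst _ _ _ _ H).
  assert (H2 := is_RInt_fct_extend_snd _ _ _ _ H).
  apply (is_RInt_fct_extend_pair (U := R_NormedModule) (V := R_NormedModule)); simpl.
  - apply (is_RInt_minus (V := R_NormedModule));
      apply (is_RInt_scal (V := R_NormedModule)); auto.
  - apply (is_RInt_plus (V := R_NormedModule));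
      apply (is_RInt_scal (V := R_NormedModule)); auto.
Qed.

Lemma RIntC_minus (f g : C -> C) (a b : R) :
  a <= b -> on_seg (ccont f) a b -> on_seg (ccont g) a b ->
  (RIntC (fun z => f z - g z) a b = RIntC f a b - RIntC g a b)%C.
Proof.
  intros Hab Hf Hg.
  apply (RInt_minus (V := C_R_CompleteNormedModule)); apply RIntC_ex; auto.
Qed.

Lemma RIntC_bound (g : C -> C) (a b M : R) :
  a <= b -> on_seg (ccont g) a b -> on_seg (fun z => Cmod (g z) <= M) a b ->
  Cmod (RIntC g a b) <= M * (b - a).
Proof.
  intros Hab Hg HM. rewrite Cmod_norm.
  eapply (norm_RInt_le (V := C_R_NormedModule) (fun x : R => g (RtoC x)) (fun _ => M) a b); auto.
  - intros x Hx. eapply Rle_trans; [right; symmetry; apply (Cmod_norm (g (RtoC x)))|]. apply HM, Hx.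
  - apply RIntC_correct; auto.
  - replace (M * (b - a)) with (scal (b - a) M) by (unfold scal; simpl; unfold mult; simpl; ring).
    apply (is_RInt_const (V := R_NormedModule)).
Qed.

Lemma RIntC_FTC (F F' : C -> C) (a b : R) :
  a <= b -> on_seg (fun z => cder F z (F' z)) a b -> on_seg (ccont F') a b ->
  (RIntC F' a b = F b - F a)%C.
Proof.
  intros Hab HF HF'. apply (is_RInt_unique (V := C_R_CompleteNormedModule)).
  apply (is_RInt_derive (V := C_R_CompleteNormedModule) (fun x : R => F (RtoC x)) (fun x : R => F' (RtoC x)));
    rewrite Rmin_left, Rmax_right by auto; intros x Hx.
  - split. { apply is_linear_scal_l. }
    intros y Hy. assert (E := is_filter_lim_locally_unique (V := R_NormedModule) x y Hy). subst y.
    intros eps. destruct (HF x Hx eps (cond_pos eps)) as [d [d0 Hd]].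
    exists (mkposreal d d0). intros w Hw.
    assert (K : Cmod (RtoC w - RtoC x) < d). { rewrite Cmod_RtoC_sub. exact Hw. }
    specialize (Hd _ K). rewrite Cmod_RtoC_sub in Hd.
    replace (norm (minus w x)) with (Rabs (w - x)) by reflexivity.
    eapply Rle_trans; [|apply Hd]. right. rewrite (Cmod_norm (_ - _)). f_equal.
    apply injective_projections; unfold minus, plus, opp, scal; simpl;
      unfold mult, plus, opp, minus, scal; simpl; unfold mult, plus, opp, minus; simpl; ring.
  - apply ccont_continuous, HF', Hx.
Qed.

Definition path_int (f g g' : C -> C) (a b : R) : C :=
  RIntC (fun x => f (g x) * g' x)%C a b.

Definition is_path (g g' : C -> C) (a b : R) : Prop :=
  on_seg (fun x => cder g x (g' x) /\ cdiff g' x) a b.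

Lemma path_integrand_ccont f g g' a b :
  is_path g g' a b -> on_seg (fun x => cdiff f (g x)) a b ->
  on_seg (ccont (fun x => f (g x) * g' x)%C) a b.
Proof.
  intros Hg Hf x Hx. destruct (Hg x Hx) as [H1 H2]. apply cdiff_ccont, cdiff_mult; auto.
  apply cdiff_comp; [eexists; eauto|apply Hf, Hx].
Qed.

(** An affine function has the primitive [p z + q (z - z0)^2 / 2], so its integral depends on the
    endpoints only and cancels around a closed boundary. *)
Lemma path_int_affine (p q z0 : C) (g g' : C -> C) (a b : R) :
  a <= b -> is_path g g' a b ->
  path_int (fun z => p + (z - z0) * q)%C g g' a b =
  (p * g b + (g b - z0) * (g b - z0) * (q * RtoC (/2)) - (p * g a + (g a - z0) * (g a - z0) * (q * RtoC (/2))))%C.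
Proof.
  intros Hab Hg. unfold path_int.
  rewrite (RIntC_FTC (fun x => p * g x + (g x - z0) * (g x - z0) * (q * RtoC (/2)))%C _ a b Hab); auto.
  - intros x Hx. destruct (Hg x Hx) as [H1 _].
    assert (D : cder (fun w => g w - z0)%C x (g' x)).
    { eapply cder_eq; [apply cder_minus; [apply H1|apply cder_const]|ring]. }
    eapply cder_eq.
    + apply cder_plus.
      * apply (cder_mult (fun _ => p)); [apply cder_const|apply H1].
      * apply cder_mult; [|apply cder_const]. apply cder_mult; apply D.
    + assert (E : q = (q * RtoC (/2) + q * RtoC (/2))%C).
      { rewrite <- Cmult_plus_distr_l, <- RtoC_plus. replace (/2 + /2) with 1 by lra. ring. }
      set (r := (q * RtoC (/2))%C) in *. rewrite E. ring.
  - apply (path_integrand_ccont (fun z => p + (z - z0) * q)%C); auto.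
    intros x Hx. apply cdiff_plus; [apply cdiff_const|].
    apply cdiff_mult; [|apply cdiff_const]. apply cdiff_shift.
Qed.

Lemma path_int_remainder (f : C -> C) (p q z0 : C) (g g' : C -> C) (a b M K : R) :
  a <= b -> is_path g g' a b -> on_seg (fun x => cdiff f (g x)) a b ->
  on_seg (fun x => Cmod (f (g x) - p - (g x - z0) * q) <= M /\ Cmod (g' x) <= K) a b ->
  Cmod (path_int f g g' a b - path_int (fun z => p + (z - z0) * q)%C g g' a b) <= M * K * (b - a).
Proof.
  intros Hab Hg Hf HM.
  assert (HA : forall z, cdiff (fun z => p + (z - z0) * q)%C z).
  { intros z. apply cdiff_plus; [apply cdiff_const|].
    apply cdiff_mult; [|apply cdiff_const]. apply cdiff_shift. }
  unfold path_int. rewrite <- RIntC_minus; auto.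
  - apply RIntC_bound; auto.
    + intros x Hx. destruct (Hg x Hx) as [H1 H2]. apply cdiff_ccont, cdiff_minus.
      * apply cdiff_mult; auto. apply cdiff_comp; [eexists; eauto|]. apply Hf, Hx.
      * apply cdiff_mult; auto. apply (cdiff_comp (fun z => p + (z - z0) * q)%C); [eexists; eauto|apply HA].
    + intros x Hx. destruct (HM x Hx) as [H1 H2].
      replace (f (g x) * g' x - (p + (g x - z0) * q) * g' x)%C
        with ((f (g x) - p - (g x - z0) * q) * g' x)%C by ring.
      rewrite Cmod_mult. apply Rmult_le_compat; auto using Cmod_ge_0.
  - apply path_integrand_ccont; auto.
  - apply (path_integrand_ccont (fun z => p + (z - z0) * q)%C); auto. intros x _; apply HA.
Qed.

(* Boundary integral of [f dz] over the image under [h] of a parameter rectangle. *)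
Definition bdry (f : C -> C) (h hs ht : C -> C -> C) (s0 s1 t0 t1 : R) : C :=
  (path_int f (h s1) (ht s1) t0 t1 - path_int f (h s0) (ht s0) t0 t1
   - path_int f (fun s => h s t1) (fun s => hs s t1) s0 s1
   + path_int f (fun s => h s t0) (fun s => hs s t0) s0 s1)%C.

(** Near a parameter point, [f] differs from its affine approximation by little compared with the
    size of the rectangle. The affine part has boundary integral zero, and the sides have length of
    the order of that size, so the boundary integral is of smaller order than the squared size.
    [additive_rectangle_zero] then applies; continuity of the derivative of [f] is not assumed. *)
Lemma goursat (f : C -> C) (h hs ht : C -> C -> C) (a b K : R) :
  0 < a -> 0 < b -> 0 < K ->
  (forall s t : R, 0 <= s <= a -> 0 <= t <= b ->
     cder (fun x => h x t) s (hs s t) /\ cdiff (fun x => hs x t) s /\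
     cder (fun x => h s x) t (ht s t) /\ cdiff (fun x => ht s x) t /\
     Cmod (hs s t) <= K /\ Cmod (ht s t) <= K /\ cdiff f (h s t)) ->
  (forall s t s' t' : R, 0 <= s <= a -> 0 <= t <= b -> 0 <= s' <= a -> 0 <= t' <= b ->
     Cmod (h s t - h s' t') <= K * (Rabs (s - s') + Rabs (t - t'))) ->
  bdry f h hs ht 0 a 0 b = 0.
Proof.
  intros Ha Hb HK H HL.
  assert (PT : forall s t0 t1 : R, 0 <= s <= a -> 0 <= t0 -> t1 <= b -> is_path (h s) (ht s) t0 t1).
  { intros s t0 t1 Hs H0 H1 x Hx. split; apply (H s x); lra. }
  assert (PS : forall t s0 s1 : R, 0 <= t <= b -> 0 <= s0 -> s1 <= a ->
      is_path (fun s => h s t) (fun s => hs s t) s0 s1).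
  { intros t s0 s1 Hs H0 H1 x Hx. split; apply (H x t); lra. }
  assert (FT : forall s t0 t1 : R, 0 <= s <= a -> 0 <= t0 -> t1 <= b -> on_seg (fun x => cdiff f (h s x)) t0 t1).
  { intros s t0 t1 Hs H0 H1 x Hx. apply (H s x); lra. }
  assert (FS : forall t s0 s1 : R, 0 <= t <= b -> 0 <= s0 -> s1 <= a ->
      on_seg (fun x => cdiff f (h x t)) s0 s1).
  { intros t s0 s1 Hs H0 H1 x Hx. apply (H x t); lra. }
  apply additive_rectangle_zero with (Q := bdry f h hs ht); auto.
  - intros s0 s1 s2 t0 t1 H1 H2 H3 H4. unfold bdry.
    unfold path_int at 3 4. rewrite !(RIntC_Chasles _ s0 s1 s2); try lra.
    + fold (path_int f (fun s => h s t1) (fun s => hs s t1) s0 s1).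
      fold (path_int f (fun s => h s t1) (fun s => hs s t1) s1 s2).
      fold (path_int f (fun s => h s t0) (fun s => hs s t0) s0 s1).
      fold (path_int f (fun s => h s t0) (fun s => hs s t0) s1 s2). ring.
    + apply (path_integrand_ccont f (fun s => h s t0)); [apply PS|apply FS]; lra.
    + apply (path_integrand_ccont f (fun s => h s t1)); [apply PS|apply FS]; lra.
  - intros s0 s1 t0 t1 t2 H1 H2 H3 H4. unfold bdry.
    unfold path_int at 1 2. rewrite !(RIntC_Chasles _ t0 t1 t2); try lra.
    + fold (path_int f (h s0) (ht s0) t0 t1). fold (path_int f (h s0) (ht s0) t1 t2).
      fold (path_int f (h s1) (ht s1) t0 t1). fold (path_int f (h s1) (ht s1) t1 t2). ring.
    + apply (path_integrand_ccont f (h s0)); [apply PT|apply FT]; lra.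
    + apply (path_integrand_ccont f (h s1)); [apply PT|apply FT]; lra.
  - intros s t Hs Ht eps He.
    destruct (H s t Hs Ht) as (_ & _ & _ & _ & _ & _ & [l Hl]).
    (* Each side contributes at most [e K^2 D] times its parameter length; the four sides together
       give [2 e K^2 D^2 = eps D^2]. *)
    set (e := eps / (2 * K ^ 2)).
    assert (K2 : 0 < K ^ 2) by (apply pow_lt; auto).
    assert (e0 : 0 < e) by (apply Rdiv_lt_0_compat; lra).
    destruct (Hl e e0) as [d [d0 Hd]].
    set (z0 := h s t) in *. set (p := f z0) in *.
    (* By the Lipschitz bound on [h], the image of the rectangle stays within [d] of [z0]. *)
    exists (d / (2 * K)). split. { apply Rdiv_lt_0_compat; lra. }
    intros s0 s1 t0 t1 S0 S1 T0 T1 Ls Lt.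
    set (D := (s1 - s0) + (t1 - t0)).
    assert (HD : K * D < d).
    { apply Rlt_le_trans with (K * (d / (2 * K) + d / (2 * K))).
      - apply Rmult_lt_compat_l; auto. unfold D. lra.
      - right. field. lra. }
    assert (D0 : 0 <= D) by (unfold D; lra).
    assert (B : forall x y : R, s0 <= x <= s1 -> t0 <= y <= t1 ->
       Cmod (f (h x y) - p - (h x y - z0) * l) <= e * (K * D)).
    { intros x y Hx Hy. assert (L : Cmod (h x y - z0) <= K * D).
      { eapply Rle_trans; [apply HL; lra|]. apply Rmult_le_compat_l; [lra|].
        unfold D. apply Rplus_le_compat; apply Rabs_le; lra. }
      eapply Rle_trans; [apply Hd; lra|]. apply Rmult_le_compat_l; lra. }
    set (aff := fun z : C => (p + (z - z0) * l)%C).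
    assert (Z : bdry aff h hs ht s0 s1 t0 t1 = 0).
    { unfold bdry, aff. rewrite !path_int_affine; try lra; try (apply PS; lra); try (apply PT; lra). ring. }
    assert (E : bdry f h hs ht s0 s1 t0 t1 =
      ((path_int f (h s1) (ht s1) t0 t1 - path_int aff (h s1) (ht s1) t0 t1)
       - (path_int f (h s0) (ht s0) t0 t1 - path_int aff (h s0) (ht s0) t0 t1)
       - (path_int f (fun s => h s t1) (fun s => hs s t1) s0 s1 - path_int aff (fun s => h s t1) (fun s => hs s t1) s0 s1)
       + (path_int f (fun s => h s t0) (fun s => hs s t0) s0 s1 - path_int aff (fun s => h s t0) (fun s => hs s t0) s0 s1))%C).
    { replace (bdry f h hs ht s0 s1 t0 t1) with (bdry f h hs ht s0 s1 t0 t1 - bdry aff h hs ht s0 s1 t0 t1)%C.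
      - unfold bdry. ring.
      - rewrite Z. ring. }
    rewrite E.
    assert (B1 : forall x : R, s0 <= x <= s1 ->
      Cmod (path_int f (h x) (ht x) t0 t1 - path_int aff (h x) (ht x) t0 t1) <= e * (K * D) * K * (t1 - t0)).
    { intros x Hx. apply path_int_remainder; try lra; [apply PT; lra|apply FT; lra|].
      intros y Hy. split; [apply B; auto|]. apply H; lra. }
    assert (B2 : forall y : R, t0 <= y <= t1 ->
      Cmod (path_int f (fun s => h s y) (fun s => hs s y) s0 s1 - path_int aff (fun s => h s y) (fun s => hs s y) s0 s1)
        <= e * (K * D) * K * (s1 - s0)).
    { intros y Hy. apply path_int_remainder; try lra; [apply PS; lra|apply FS; lra|].
      intros x Hx. split; [apply B; auto|]. apply H; lra. }
    assert (X1 := B1 s1 ltac:(lra)). assert (X2 := B1 s0 ltac:(lra)).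
    assert (X3 := B2 t1 ltac:(lra)). assert (X4 := B2 t0 ltac:(lra)).
    assert (EE : eps * D ^ 2 = 2 * (e * (K * D) * K * (t1 - t0)) + 2 * (e * (K * D) * K * (s1 - s0))).
    { unfold e, D. field. lra. }
    rewrite EE.
    unfold Cminus at 1 2.
    eapply Rle_trans; [apply Cmod_triangle|].
    eapply Rle_trans; [apply Rplus_le_compat_r, Cmod_triangle|].
    eapply Rle_trans; [apply Rplus_le_compat_r, Rplus_le_compat_r, Cmod_triangle|].
    rewrite !Cmod_opp. lra.
Qed.

(** * Cauchy's formula and its consequences *)

Definition cis (t : C) : C := cexp (Ci * t).

Lemma cder_cis (t : C) : cder cis t (Ci * cis t).
Proof.
  unfold cis. eapply cder_eq.
  - apply (cder_comp cexp (fun t => Ci * t)%C); [|apply cder_cexp].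
    apply (cder_mult (fun _ => Ci)); [apply cder_const|apply cder_id].
  - ring.
Qed.

Lemma cdiff_cis (t : C) : cdiff cis t.
Proof. eexists; apply cder_cis. Qed.

Lemma Cmod_cis (t : R) : Cmod (cis t) = 1.
Proof. apply Cmod_cexp_i. Qed.

Lemma cis_neq_0 (t : R) : cis t <> 0.
Proof. intros E. assert (H := Cmod_cis t). rewrite E, Cmod_0 in H. lra. Qed.

Lemma cis_0 : cis 0 = 1.
Proof. unfold cis. rewrite Cmult_0_r. apply cexp_0. Qed.

Lemma cis_2pi : cis (RtoC (2 * PI)) = 1.
Proof. apply cexp_2pi. Qed.

Lemma cis_lipschitz (t t' : R) : Cmod (cis t - cis t') <= Rabs (t - t').
Proof.
  assert (L : forall a b : R, a <= b -> Cmod (cis b - cis a) <= b - a).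
  { intros a b Hab. rewrite <- (RIntC_FTC cis (fun x => Ci * cis x)%C a b); auto.
    - eapply Rle_trans; [apply (RIntC_bound _ a b 1); auto|lra].
      + intros x _. apply cdiff_ccont, cdiff_mult; [apply cdiff_const|apply cdiff_cis].
      + intros x _. rewrite Cmod_mult, Cmod_Ci, Cmod_cis. lra.
    - intros x _. apply cder_cis.
    - intros x _. apply cdiff_ccont, cdiff_mult; [apply cdiff_const|apply cdiff_cis]. }
  destruct (Rle_dec t t').
  - rewrite Cmod_sub_sym, Rabs_minus_sym, Rabs_pos_eq by lra. apply L; auto.
  - rewrite Rabs_pos_eq by lra. apply L; lra.
Qed.

Definition circ (c : C) (r : R) (t : C) : C := (c + r * cis t)%C.

Lemma cdiff_circ c r t : cdiff (circ c r) t.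
Proof.
  apply (cdiff_plus (fun _ => c)); [apply cdiff_const|].
  apply cdiff_mult; [apply cdiff_const|apply cdiff_cis].
Qed.

Lemma cdiff_circ_minus c r w t : cdiff (fun t => circ c r t - w)%C t.
Proof. apply cdiff_minus; [apply cdiff_circ|apply cdiff_const]. Qed.

Lemma circ_dist (c : C) (r t : R) : 0 <= r -> Cmod (circ c r t - c) = r.
Proof.
  intros Hr. unfold circ. replace (c + r * cis t - c)%C with (r * cis t)%C by ring.
  rewrite Cmod_mult, Cmod_cis, Cmod_R, Rabs_pos_eq by auto. ring.
Qed.

Lemma circ_neq (c : C) (r t : R) (w : C) : 0 < r -> Cmod (w - c) < r -> (circ c r t - w)%C <> 0.
Proof.
  intros Hr Hw E. assert (D := circ_dist c r t (Rlt_le _ _ Hr)).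
  replace (circ c r t - c)%C with ((circ c r t - w) + (w - c))%C in D by ring.
  rewrite E, Cplus_0_l in D. lra.
Qed.

Lemma PI2_pos : 0 < 2 * PI.
Proof. assert (H := PI_RGT_0). lra. Qed.

(* The circle around [c] is deformed linearly to a small circle around [w]. *)
Lemma cauchy_homotopy (f : C -> C) (c w : C) (rad r rho : R) :
  r < rad -> 0 < rho -> Cmod (w - c) + rho < r ->
  (forall z, Cmod (z - c) < rad -> cdiff f z) ->
  RIntC (fun t => f (circ c r t) * (r * (Ci * cis t)) / (circ c r t - w))%C 0 (2 * PI) =
  RIntC (fun t => Ci * f (circ w rho t))%C 0 (2 * PI).
Proof.
  intros HrR Hrho Hw Hf.
  assert (W0 := Cmod_ge_0 (w - c)). assert (P2 := PI2_pos).
  set (F := fun z => (f z / (z - w))%C).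
  set (h := fun s t : C => (c + s * (w - c) + ((1 - s) * r + s * rho) * cis t)%C).
  set (hs := fun s t : C => (w - c + (rho - r) * cis t)%C).
  set (ht := fun s t : C => (((1 - s) * r + s * rho) * (Ci * cis t))%C).
  assert (RAD : forall s : R, 0 <= s <= 1 ->
     Cmod ((1 - s) * r + s * rho)%C = (1 - s) * r + s * rho).
  { intros s Hs. rewrite <- RtoC_minus, <- !RtoC_mult, <- RtoC_plus, Cmod_R.
    apply Rabs_pos_eq. nra. }
  assert (G : bdry F h hs ht 0 1 0 (2 * PI) = 0).
  (* All centres and radii involved are bounded by [r], so [4 r] bounds both partial derivatives and
     the Lipschitz constant. *)
  { apply goursat with (K := 4 * r); auto; try lra.
    - intros s t Hs Ht. repeat split.
      + unfold h. eapply cder_eq.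
        * apply cder_plus; [apply cder_plus; [apply cder_const|apply cder_mult; [apply cder_id|apply cder_const]]|].
          apply cder_mult; [|apply cder_const].
          apply cder_plus; [apply cder_mult; [apply cder_minus; [apply cder_const|apply cder_id]|apply cder_const]|].
          apply cder_mult; [apply cder_id|apply cder_const].
        * unfold hs. ring.
      + unfold hs. apply cdiff_const.
      + unfold h. eapply cder_eq.
        * apply cder_plus; [apply cder_const|]. apply cder_mult; [apply cder_const|apply cder_cis].
        * unfold ht. ring.
      + unfold ht. apply cdiff_mult; [apply cdiff_const|]. apply cdiff_mult; [apply cdiff_const|apply cdiff_cis].
      + unfold hs. eapply Rle_trans; [apply Cmod_triangle|].
        rewrite Cmod_mult, Cmod_cis, Cmod_RtoC_sub, Rabs_minus_sym, Rabs_pos_eq; lra.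
      + unfold ht. rewrite !Cmod_mult, RAD, Cmod_Ci, Cmod_cis by auto. nra.
      + unfold F. apply cdiff_div.
        * apply Hf. unfold h.
          replace (c + s * (w - c) + ((1 - s) * r + s * rho) * cis t - c)%C
            with (s * (w - c) + ((1 - s) * r + s * rho) * cis t)%C by ring.
          eapply Rle_lt_trans; [apply Cmod_triangle|].
          rewrite !Cmod_mult, RAD, Cmod_cis, Cmod_R, Rabs_pos_eq by (auto; lra). nra.
        * apply cdiff_shift.
        (* The moving circle never meets [w]: its radius [(1-s) r + s rho] exceeds the distance
           [(1-s) |w - c|] from its centre to [w]. *)
        * intros E. unfold h in E.
          assert (E' : (((1 - s) * r + s * rho) * cis t)%C = ((1 - s) * (w - c))%C).
          { replace (((1 - s) * r + s * rho) * cis t)%C with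
             ((c + s * (w - c) + ((1 - s) * r + s * rho) * cis t - w) + (1 - s) * (w - c))%C by ring.
            rewrite E. ring. }
          apply (f_equal Cmod) in E'. rewrite !Cmod_mult, RAD, Cmod_cis, Cmod_RtoC_sub, Rabs_pos_eq in E' by (auto; lra).
          nra.
    - intros s t s' t' Hs Ht Hs' Ht'. unfold h.
      replace (c + s * (w - c) + ((1 - s) * r + s * rho) * cis t -
         (c + s' * (w - c) + ((1 - s') * r + s' * rho) * cis t'))%C with
        ((s - s') * (w - c + (rho - r) * cis t) + ((1 - s') * r + s' * rho) * (cis t - cis t'))%C by ring.
      eapply Rle_trans; [apply Cmod_triangle|].
      rewrite Cmod_mult, (Cmod_mult (_ + _)), RAD, Cmod_RtoC_sub by auto.
      assert (L := cis_lipschitz t t').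
      assert (L2 : Cmod (w - c + (rho - r) * cis t) <= 4 * r).
      { eapply Rle_trans; [apply Cmod_triangle|].
        rewrite Cmod_mult, Cmod_cis, Cmod_RtoC_sub, Rabs_minus_sym, Rabs_pos_eq; lra. }
      rewrite Rmult_plus_distr_l. apply Rplus_le_compat.
      + rewrite Rmult_comm. apply Rmult_le_compat_r; auto using Rabs_pos.
      + apply Rmult_le_compat; auto using Cmod_ge_0; nra. }
  unfold bdry in G.
  (* By periodicity of [cis] the sides [t = 0] and [t = 2 PI] have the same image and cancel. *)
  assert (E : path_int F (fun s => h s (RtoC (2 * PI))) (fun s => hs s (RtoC (2 * PI))) 0 1 =
              path_int F (fun s => h s 0) (fun s => hs s 0) 0 1).
  { unfold path_int. apply RIntC_ext; [lra|]. intros x _. unfold h, hs.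
    rewrite cis_0, cis_2pi. reflexivity. }
  rewrite E in G.
  assert (E1 : path_int F (h 1) (ht 1) 0 (2 * PI) = RIntC (fun t => Ci * f (circ w rho t))%C 0 (2 * PI)).
  { unfold path_int. apply RIntC_ext; [lra|]. intros x _. unfold F, h, ht, circ.
    replace (c + 1 * (w - c) + ((1 - 1) * r + 1 * rho) * cis x)%C with (w + rho * cis x)%C by ring.
    replace (w + rho * cis x - w)%C with (rho * cis x)%C by ring.
    replace ((1 - 1) * r + 1 * rho)%C with (RtoC rho) by ring.
    field. split.
    - apply cis_neq_0.
    - intros E0. injection E0. lra. }
  assert (E0 : path_int F (h 0) (ht 0) 0 (2 * PI) =
    RIntC (fun t => f (circ c r t) * (r * (Ci * cis t)) / (circ c r t - w))%C 0 (2 * PI)).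
  { unfold path_int. apply RIntC_ext; [lra|]. intros x _. unfold F, h, ht, circ.
    replace (c + 0 * (w - c) + ((1 - 0) * r + 0 * rho) * cis x)%C with (c + r * cis x)%C by ring.
    replace ((1 - 0) * r + 0 * rho)%C with (RtoC r) by ring. unfold Cdiv. ring. }
  rewrite <- E0, <- E1.
  set (A := path_int F (h 0) _ _ _) in *. set (B := path_int F (h 1) _ _ _) in *.
  set (D := path_int F _ _ _ _) in G.
  replace (B - A - D + D)%C with (B - A)%C in G by ring.
  replace B with ((B - A) + A)%C by ring. rewrite G. ring.
Qed.

(** The integral equals that of [Ci * f] over an arbitrarily small circle around [w]. Continuity at
    [w] makes the latter as close as desired to [2 PI Ci f w]; a positive discrepancy [e] would be
    at most [e / 2]. *)
Theorem cauchy_formula (f : C -> C) (c w : C) (rad r : R) :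
  r < rad -> Cmod (w - c) < r ->
  (forall z, Cmod (z - c) < rad -> cdiff f z) ->
  RIntC (fun t => f (circ c r t) * (r * (Ci * cis t)) / (circ c r t - w))%C 0 (2 * PI) =
  (RtoC (2 * PI) * Ci * f w)%C.
Proof.
  intros HrR Hw Hf. apply Cmod_sub_0.
  assert (P2 := PI2_pos). assert (W0 := Cmod_ge_0 (w - c)).
  set (I := RIntC _ 0 (2 * PI)).
  destruct (Rle_lt_or_eq_dec _ _ (Cmod_ge_0 (I - RtoC (2 * PI) * Ci * f w))) as [P|]; auto.
  exfalso. set (e := Cmod (I - RtoC (2 * PI) * Ci * f w)) in *.
  assert (Fc : ccont f w) by (apply cdiff_ccont, Hf; lra).
  destruct (Fc (e / (2 * (2 * PI)))) as [d [d0 Hd]]. { apply Rdiv_lt_0_compat; lra. }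
  set (rho := Rmin (d / 2) ((r - Cmod (w - c)) / 2)).
  assert (R1 : 0 < rho) by (apply Rmin_pos; lra).
  assert (R2 : rho <= d / 2) by apply Rmin_l.
  assert (R3 : rho <= (r - Cmod (w - c)) / 2) by apply Rmin_r.
  assert (CD : forall x : R, Cmod (circ w rho x - w) = rho) by (intros; apply circ_dist; lra).
  assert (FD : forall x : R, cdiff f (circ w rho x)).
  { intros x. apply Hf. assert (T := Cmod_sub_triangle (circ w rho x) w c). rewrite CD in T. lra. }
  assert (E : I = RIntC (fun t => Ci * f (circ w rho t))%C 0 (2 * PI)).
  { apply (cauchy_homotopy f c w rad r rho); auto. lra. }
  assert (E2 : (RtoC (2 * PI) * Ci * f w)%C = RIntC (fun t => Ci * f w)%C 0 (2 * PI)).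
  { rewrite (RIntC_FTC (fun t => t * (Ci * f w))%C (fun t => Ci * f w)%C); try lra.
    - ring.
    - intros x _. eapply cder_eq; [apply cder_mult; [apply cder_id|apply cder_const]|]. cbv beta. ring.
    - intros x _. apply cdiff_ccont, cdiff_const. }
  assert (B : e <= e / (2 * (2 * PI)) * (2 * PI - 0)).
  { assert (Ee : Cmod (I - RtoC (2 * PI) * Ci * f w) = e) by reflexivity.
    clearbody e. rewrite E, E2 in Ee. rewrite <- Ee at 1. rewrite <- RIntC_minus; try lra.
    - apply RIntC_bound; try lra.
      + intros x _. apply cdiff_ccont. apply cdiff_minus; [|apply cdiff_const].
        apply cdiff_mult; [apply cdiff_const|]. apply cdiff_comp; auto. apply cdiff_circ.
      + intros x _. replace (Ci * f (circ w rho x) - Ci * f w)%C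
          with (Ci * (f (circ w rho x) - f w))%C by ring.
        rewrite Cmod_mult, Cmod_Ci, Rmult_1_l. left. apply Hd. rewrite CD. lra.
    - intros x _. apply cdiff_ccont. apply cdiff_mult; [apply cdiff_const|]. apply cdiff_comp; auto. apply cdiff_circ.
    - intros x _. apply cdiff_ccont, cdiff_const. }
  assert (e / (2 * (2 * PI)) * (2 * PI - 0) = e / 2) by (field; lra). lra.
Qed.

Lemma ccont_bounded (g : C -> C) (a b : R) :
  on_seg (ccont g) a b -> exists M, 0 < M /\ on_seg (fun x => Cmod (g x) <= M) a b.
Proof.
  intros H.
  destruct (bounded_continuity (V := C_R_NormedModule) (fun x : R => g (RtoC x)) a b) as [M HM].
  - intros x Hx. exact (ccont_continuous g x (H x Hx)).
  - exists (Rmax M 1). split. { eapply Rlt_le_trans; [|apply Rmax_r]. lra. }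
    intros x Hx. eapply Rle_trans; [|apply Rmax_l]. left.
    eapply Rle_lt_trans; [|apply (HM x Hx)]. right. apply (Cmod_norm (g (RtoC x))).
Qed.

Lemma on_seg_ccont g a b : on_seg (cdiff g) a b -> on_seg (ccont g) a b.
Proof. intros H x Hx. apply cdiff_ccont, H, Hx. Qed.

(** A quadratic remainder bound uniform in [t] integrates to a quadratic bound for the integral,
    which is all that differentiation under the integral sign requires here. *)
Lemma cder_param_integral (k k' : C -> C -> C) (w : C) (a b B d : R) :
  a <= b -> 0 <= B -> 0 < d ->
  (forall u, Cmod (u - w) < d -> on_seg (cdiff (fun t => k t u)) a b) ->
  on_seg (cdiff (fun t => k' t w)) a b ->
  (forall u, Cmod (u - w) < d ->
     on_seg (fun t => Cmod (k t u - k t w - (u - w) * k' t w) <= B * Cmod (u - w) ^ 2) a b) ->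
  cder (fun u => RIntC (fun t => k t u) a b) w (RIntC (fun t => k' t w) a b).
Proof.
  intros Hab HB Hd Hk Hk' Hq eps He.
  set (K := B * (b - a) + 1).
  assert (K0 : 0 < K) by (unfold K; nra).
  exists (Rmin d (eps / K)). split. { apply Rmin_pos; auto. apply Rdiv_lt_0_compat; auto. }
  intros u Hu.
  destruct (Rmin_Rgt_l _ _ _ Hu) as [U1 U2].
  assert (W : Cmod (w - w) < d) by (rewrite Cmod_self; auto).
  assert (C0 : on_seg (cdiff (fun t => k t u - k t w)%C) a b).
  { intros t Ht. apply cdiff_minus; apply Hk; auto. }
  assert (C0' : on_seg (cdiff (fun t => (u - w) * k' t w)%C) a b).
  { intros t Ht. apply cdiff_mult; [apply cdiff_const|apply Hk', Ht]. }
  assert (C1 : on_seg (cdiff (fun t => k t u - k t w - (u - w) * k' t w)%C) a b).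
  { intros t Ht. apply (cdiff_minus (fun t => k t u - k t w)%C); auto. }
  rewrite <- (RIntC_scal (u - w)%C (fun t => k' t w)) by auto using on_seg_ccont.
  rewrite <- (RIntC_minus (fun t => k t u) (fun t => k t w)) by auto using on_seg_ccont.
  rewrite <- (RIntC_minus (fun t => k t u - k t w)%C (fun t => (u - w) * k' t w)%C) by auto using on_seg_ccont.
  eapply Rle_trans; [apply (RIntC_bound _ a b (B * Cmod (u - w) ^ 2)); auto using on_seg_ccont|].
  assert (X := Cmod_ge_0 (u - w)). set (x := Cmod (u - w)) in *.
  apply Rle_trans with (K * x * x).
  - unfold K. nra.
  - apply Rmult_le_compat_r; auto. left.
    apply Rlt_le_trans with (K * (eps / K)); [apply Rmult_lt_compat_l; auto|]. right. field. lra.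
Qed.

(** Cauchy-type integrals with density [phi]. When [phi] comes from [f], the exponents 1, 2, 3
    represent [f], [f'] and [f'' / 2] up to the factor [2 PI i]. *)
Definition cauchy_ker (phi : C -> C) (c : C) (r : R) (n : nat) (u : C) : C :=
  RIntC (fun t => phi t / (circ c r t - u) ^ n)%C 0 (2 * PI).

Lemma circ_dist_ge (c : C) (r t : R) (u : C) : 0 < r ->
  r - Cmod (u - c) <= Cmod (circ c r t - u).
Proof.
  intros Hr. assert (T := Cmod_sub_triangle (circ c r t) u c).
  rewrite circ_dist in T; lra.
Qed.

Lemma cauchy_ker_cdiff phi c r n u : 0 < r -> on_seg (cdiff phi) 0 (2 * PI) -> Cmod (u - c) < r ->
  on_seg (cdiff (fun t => phi t / (circ c r t - u) ^ n)%C) 0 (2 * PI).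
Proof.
  intros Hr Hphi Hu t Ht. apply cdiff_div; [apply Hphi, Ht| |].
  - apply (cdiff_pow (fun t => circ c r t - u)%C).
    apply cdiff_circ_minus.
  - apply Cpow_nz, circ_neq; auto.
Qed.

Lemma cauchy_ker_cder1 phi c r w : 0 < r -> Cmod (w - c) < r -> on_seg (cdiff phi) 0 (2 * PI) ->
  cder (cauchy_ker phi c r 1) w (cauchy_ker phi c r 2 w).
Proof.
  intros Hr Hw Hphi.
  destruct (ccont_bounded phi 0 (2 * PI)) as [M [M0 HM]]; [apply on_seg_ccont, Hphi|].
  set (m := r - Cmod (w - c)). assert (m0 : 0 < m) by (unfold m; lra).
  assert (P2 := PI2_pos).
  assert (Hd : forall u, Cmod (u - w) < m / 2 -> Cmod (u - c) < r).
  { intros u Hu. assert (T := Cmod_sub_triangle u w c). unfold m in Hu. lra. }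
  (* With [a], [b] the differences of the circle point to [w] and [u], the remainder is
     [phi (u - w)^2 / (a^2 b)]. Since [|a| >= m] and [|b| >= m / 2], this yields the constant
     [2 / m^3]. *)
  apply (cder_param_integral (fun t u => phi t / (circ c r t - u) ^ 1)%C
    (fun t u => phi t / (circ c r t - u) ^ 2)%C w 0 (2 * PI) (M * (2 / m ^ 3)) (m / 2)); try lra.
  - apply Rmult_le_pos; [lra|]. left. apply Rdiv_lt_0_compat; [lra|]. apply pow_lt; auto.
  - intros u Hu. apply (cauchy_ker_cdiff phi c r 1); auto.
  - apply (cauchy_ker_cdiff phi c r 2); auto.
  - intros u Hu t Ht.
    assert (A1 := circ_dist_ge c r t w Hr). fold m in A1.
    assert (A2 : m / 2 <= Cmod (circ c r t - u)).
    { assert (T := Cmod_sub_triangle (circ c r t) u w). lra. }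
    set (a := (circ c r t - w)%C) in *. set (b := (circ c r t - u)%C) in *.
    assert (a0 : a <> 0) by (apply Cmod_gt_0; lra).
    assert (b0 : b <> 0) by (apply Cmod_gt_0; lra).
    assert (E : (phi t / b ^ 1 - phi t / a ^ 1 - (u - w) * (phi t / a ^ 2))%C =
      (phi t * ((u - w) * (u - w) * / (a * a * b)))%C).
    { replace (u - w)%C with (a - b)%C by (unfold a, b; ring). simpl. field. auto. }
    rewrite E, !Cmod_mult, Cmod_inv, !Cmod_mult by (repeat apply Cmult_neq_0; auto).
    set (x := Cmod (u - w)). assert (X := Cmod_ge_0 (u - w)). fold x in X.
    replace (M * (2 / m ^ 3) * x ^ 2) with (M * (x * x * / (m * m * (m / 2)))) by (field; lra).
    apply Rmult_le_compat; auto using Cmod_ge_0.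
    + repeat apply Rmult_le_pos; auto. left. apply Rinv_0_lt_compat. repeat apply Rmult_lt_0_compat; lra.
    + apply Rmult_le_compat_l; [nra|]. apply Rinv_le_contravar. { repeat apply Rmult_lt_0_compat; lra. }
      apply Rmult_le_compat; try lra; nra.
Qed.

Lemma cauchy_ker_cder2 phi c r w : 0 < r -> Cmod (w - c) < r -> on_seg (cdiff phi) 0 (2 * PI) ->
  cder (cauchy_ker phi c r 2) w (2 * cauchy_ker phi c r 3 w).
Proof.
  intros Hr Hw Hphi.
  destruct (ccont_bounded phi 0 (2 * PI)) as [M [M0 HM]]; [apply on_seg_ccont, Hphi|].
  set (m := r - Cmod (w - c)). assert (m0 : 0 < m) by (unfold m; lra).
  assert (P2 := PI2_pos).
  assert (Hd : forall u, Cmod (u - w) < m / 2 -> Cmod (u - c) < r).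
  { intros u Hu. assert (T := Cmod_sub_triangle u w c). unfold m in Hu. lra. }
  unfold cauchy_ker at 2. rewrite <- RIntC_scal; [|lra|apply on_seg_ccont, cauchy_ker_cdiff; auto].
  (* The remainder is now [phi (u - w)^2 (a + 2 b) / (a^3 b^2)]. From [|a + 2 b| <= 4 |a|],
     [|a| >= m] and [|b| >= m / 2] comes [16 / m^4]. *)
  apply (cder_param_integral (fun t u => phi t / (circ c r t - u) ^ 2)%C
    (fun t u => 2 * (phi t / (circ c r t - u) ^ 3))%C w 0 (2 * PI) (M * (16 / m ^ 4)) (m / 2)); try lra.
  - apply Rmult_le_pos; [lra|]. left. apply Rdiv_lt_0_compat; [lra|]. apply pow_lt; auto.
  - intros u Hu. apply (cauchy_ker_cdiff phi c r 2); auto.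
  - intros t Ht. apply cdiff_mult; [apply cdiff_const|]. apply cauchy_ker_cdiff; auto.
  - intros u Hu t Ht.
    assert (A1 := circ_dist_ge c r t w Hr). fold m in A1.
    assert (A2 : m / 2 <= Cmod (circ c r t - u)).
    { assert (T := Cmod_sub_triangle (circ c r t) u w). lra. }
    set (a := (circ c r t - w)%C) in *. set (b := (circ c r t - u)%C) in *.
    assert (a0 : a <> 0) by (apply Cmod_gt_0; lra).
    assert (b0 : b <> 0) by (apply Cmod_gt_0; lra).
    assert (E : (phi t / b ^ 2 - phi t / a ^ 2 - (u - w) * (2 * (phi t / a ^ 3)))%C =
      (phi t * ((u - w) * (u - w) * ((a + (b + b)) * / (a * a * (a * (b * b))))))%C).
    { replace (u - w)%C with (a - b)%C by (unfold a, b; ring). simpl.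
      replace (RtoC 2) with (1 + 1)%C by (rewrite <- RtoC_plus; reflexivity). field. auto. }
    rewrite E, !Cmod_mult, Cmod_inv, !Cmod_mult by (repeat apply Cmult_neq_0; auto).
    set (x := Cmod (u - w)) in *. assert (X := Cmod_ge_0 (u - w)). fold x in X.
    replace (M * (16 / m ^ 4) * x ^ 2) with (M * (x * x * (4 * / (m * m * (m / 2 * (m / 2)))))) by (field; lra).
    assert (AB : Cmod (a + (b + b)) <= 4 * Cmod a).
    { replace (a + (b + b))%C with ((a + a + a) + - ((u - w) + (u - w)))%C by (unfold a, b; ring).
      assert (T1 := Cmod_triangle (a + a + a) (- ((u - w) + (u - w)))). rewrite Cmod_opp in T1.
      assert (T2 := Cmod_triangle (u - w) (u - w)). fold x in T2.
      assert (T3 := Cmod_triangle (a + a) a). assert (T4 := Cmod_triangle a a). lra. }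
    assert (Pa : 0 < Cmod a) by lra. assert (Pb : 0 < Cmod b) by lra.
    apply Rmult_le_compat; auto using Cmod_ge_0.
    { repeat apply Rmult_le_pos; auto using Cmod_ge_0. left. apply Rinv_0_lt_compat. repeat apply Rmult_lt_0_compat; lra. }
    apply Rmult_le_compat_l; [nra|].
    apply Rle_trans with (4 * / (Cmod a * Cmod a * (Cmod b * Cmod b))).
    + apply Rle_trans with (4 * Cmod a * / (Cmod a * Cmod a * (Cmod a * (Cmod b * Cmod b)))).
      * apply Rmult_le_compat_r; auto. left. apply Rinv_0_lt_compat. repeat apply Rmult_lt_0_compat; lra.
      * right. field. lra.
    + apply Rmult_le_compat_l; [lra|]. apply Rinv_le_contravar. { repeat apply Rmult_lt_0_compat; lra. }
      apply Rmult_le_compat; nra.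
Qed.

Definition cdiff_disc (f : C -> C) (c : C) (rad : R) : Prop :=
  forall z, Cmod (z - c) < rad -> cdiff f z.

Lemma two_pi_i_neq_0 : (RtoC (2 * PI) * Ci)%C <> 0.
Proof.
  assert (P2 := PI2_pos). intros E. apply (f_equal Cmod) in E.
  rewrite Cmod_mult, Cmod_Ci, Cmod_R, Cmod_0, Rabs_pos_eq in E; lra.
Qed.

Lemma cauchy_phi_cdiff f c rad r :
  0 < r < rad -> cdiff_disc f c rad ->
  forall t : R, cdiff (fun t => f (circ c r t) * (r * (Ci * cis t)))%C t.
Proof.
  intros Hr Hf t. apply cdiff_mult.
  - apply cdiff_comp; [apply cdiff_circ|]. apply Hf. rewrite circ_dist; lra.
  - apply cdiff_mult; [apply cdiff_const|]. apply cdiff_mult; [apply cdiff_const|apply cdiff_cis].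
Qed.

(** On a smaller disc [f] is a Cauchy integral, hence [f'] is the one with the kernel squared, and
    that one can be differentiated again. *)
Lemma derivative_cdiff (f : C -> C) (c : C) (rad : R) :
  0 < rad -> cdiff_disc f c rad -> cdiff (Cderiv f) c.
Proof.
  intros Hrad Hf. set (r := rad / 2).
  assert (Hr : 0 < r < rad) by (unfold r; lra).
  set (phi := fun t => (f (circ c r t) * (r * (Ci * cis t)))%C).
  assert (Hphi : on_seg (cdiff phi) 0 (2 * PI)).
  { intros t _. eapply cauchy_phi_cdiff; eauto. }
  set (I := (RtoC (2 * PI) * Ci)%C). assert (I0 : I <> 0) by apply two_pi_i_neq_0.
  assert (F : forall w, Cmod (w - c) < r -> (/ I * cauchy_ker phi c r 1 w)%C = f w).
  { intros w Hw. unfold cauchy_ker.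
    rewrite <- (Cmult_1_l (f w)), <- (Cinv_l I I0), <- Cmult_assoc. f_equal.
    unfold I. rewrite <- (cauchy_formula f c w rad r); try lra; auto.
    apply RIntC_ext; [assert (P2 := PI2_pos); lra|]. intros t _. unfold phi. rewrite Cpow_1_r. reflexivity. }
  assert (D : forall w, Cmod (w - c) < r -> Cderiv f w = (/ I * cauchy_ker phi c r 2 w)%C).
  { intros w Hw. apply Cderiv_eq.
    apply (cder_local (fun w => / I * cauchy_ker phi c r 1 w)%C f w _ (r - Cmod (w - c))); [lra| |].
    - intros v Hv. apply F. assert (T := Cmod_sub_triangle v w c). lra.
    - eapply cder_eq.
      + apply (cder_mult (fun _ => / I)%C (cauchy_ker phi c r 1)); [apply cder_const|].
        apply cauchy_ker_cder1; auto; lra.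
      + cbv beta. ring. }
  apply (cdiff_local (fun w => / I * cauchy_ker phi c r 2 w)%C _ c r); [lra| |].
  - intros w Hw. symmetry. auto.
  - apply cdiff_mult; [apply cdiff_const|]. eexists. apply cauchy_ker_cder2; auto; try lra.
    rewrite Cmod_self. lra.
Qed.

(** Subtracting Cauchy's formulas at [w] and [c] and using [1/(z-w) - 1/(z-c) = (w-c)/((z-w)(z-c))]
    exhibits [f w - f c] as [w - c] times a Cauchy-type integral, which is holomorphic at [c]
    too. *)
Lemma divide_zero (f : C -> C) (c : C) (rad : R) :
  0 < rad -> cdiff_disc f c rad -> f c = 0 ->
  exists g, cdiff_disc g c rad /\ forall z, Cmod (z - c) < rad -> f z = ((z - c) * g z)%C.
Proof.
  intros Hrad Hf Hc. set (r := rad / 2).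
  assert (P2 := PI2_pos).
  assert (Hr : 0 < r < rad) by (unfold r; lra).
  set (phi := fun t => (f (circ c r t) * (r * (Ci * cis t)))%C).
  set (psi := fun t => (phi t / (circ c r t - c))%C).
  assert (CC : Cmod (c - c) < r) by (rewrite Cmod_self; lra).
  assert (Hphi : forall t : R, cdiff phi t).
  { intros t. eapply cauchy_phi_cdiff; eauto. }
  assert (Hpsi : on_seg (cdiff psi) 0 (2 * PI)).
  { intros t _. apply cdiff_div; auto.
    - apply cdiff_circ_minus.
    - apply circ_neq; auto; lra. }
  set (I := (RtoC (2 * PI) * Ci)%C). assert (I0 : I <> 0) by apply two_pi_i_neq_0.
  set (g1 := fun w => (/ I * cauchy_ker psi c r 1 w)%C).
  assert (F : forall w, Cmod (w - c) < r -> f w = ((w - c) * g1 w)%C).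
  { intros w Hw. unfold g1, cauchy_ker.
    assert (E : (I * f w - I * f c)%C = ((w - c) * RIntC (fun t => psi t / (circ c r t - w) ^ 1) 0 (2 * PI))%C).
    { unfold I. rewrite <- (cauchy_formula f c w rad r), <- (cauchy_formula f c c rad r); try lra; auto.
      assert (CD : forall u, Cmod (u - c) < r ->
         on_seg (ccont (fun t => f (circ c r t) * (r * (Ci * cis t)) / (circ c r t - u))%C) 0 (2 * PI)).
      { intros u Hu t Ht. apply cdiff_ccont, cdiff_div; [apply Hphi| |apply circ_neq; auto; lra].
        apply cdiff_circ_minus. }
      rewrite <- RIntC_minus, <- RIntC_scal; auto; try lra.
      - apply RIntC_ext; [lra|]. intros t _. unfold psi, phi. simpl. field.
        split; apply circ_neq; auto; lra.
      - apply on_seg_ccont, cauchy_ker_cdiff; auto; lra. }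
    rewrite Hc in E. apply (f_equal (fun x => / I * x)%C) in E.
    transitivity (/ I * (I * f w - I * 0))%C; [field; auto|]. rewrite E. ring. }
  assert (G : forall w, Cmod (w - c) < r -> cdiff g1 w).
  { intros w Hw. apply cdiff_mult; [apply cdiff_const|]. eexists. apply cauchy_ker_cder1; auto; lra. }
  (* The integral defines the quotient only inside the circle; outside, plain division does. They
     agree where both make sense, so the result is holomorphic on the full disc. *)
  exists (fun z => if Rlt_dec (Cmod (z - c)) r then g1 z else (f z / (z - c))%C).
  split.
  - intros z Hz. destruct (Rlt_dec (Cmod (z - c)) r) as [L|L].
    + apply (cdiff_local g1 _ z (r - Cmod (z - c))); auto; [lra|].
      intros w Hw. destruct (Rlt_dec (Cmod (w - c)) r) as [L'|L']; auto.
      exfalso. apply L'. assert (T := Cmod_sub_triangle w z c). lra.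
    + apply (cdiff_local (fun z => f z / (z - c))%C _ z r); [lra| |].
      * intros w Hw. destruct (Rlt_dec (Cmod (w - c)) r) as [L'|L']; auto.
        rewrite (F w L'). field. apply Cmod_gt_0.
        assert (T := Cmod_sub_triangle z w c). rewrite (Cmod_sub_sym z w) in T. lra.
      * apply cdiff_div; auto.
        -- apply cdiff_shift.
        -- apply Cmod_gt_0. lra.
  - intros z Hz. destruct (Rlt_dec (Cmod (z - c)) r) as [L|L]; auto.
    field. apply Cmod_gt_0. lra.
Qed.

(** If no finite order exists, [divide_zero] gives [f = (z - c)^n g_n] for every [n]. Cauchy's
    formula for [g_n] on a circle of radius [r] bounds [f w] by a constant times [(|w - c| / r)^n],
    which tends to 0. This gives vanishing on the whole disc without power series. *)
Lemma zero_order (f : C -> C) (c : C) (rad : R) :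
  0 < rad -> cdiff_disc f c rad ->
  (forall z, Cmod (z - c) < rad -> f z = 0) \/
  exists n g, cdiff_disc g c rad /\ g c <> 0 /\
    forall z, Cmod (z - c) < rad -> f z = ((z - c) ^ n * g z)%C.
Proof.
  intros Hrad Hf.
  destruct (classic (exists n g, cdiff_disc g c rad /\ g c <> 0 /\
    forall z, Cmod (z - c) < rad -> f z = ((z - c) ^ n * g z)%C)) as [|N]; auto.
  left. assert (P2 := PI2_pos).
  assert (A : forall n, exists g, cdiff_disc g c rad /\
    forall z, Cmod (z - c) < rad -> f z = ((z - c) ^ n * g z)%C).
  { induction n as [|n (g & Hg & E)].
    - exists f. split; auto. intros z _. simpl. ring.
    - destruct (divide_zero g c rad) as (g' & Hg' & E'); auto.
      + destruct (classic (g c = 0)) as [|N']; auto. exfalso. apply N. exists n, g. auto.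
      + exists g'. split; auto. intros z Hz. rewrite E, E' by auto. simpl. ring. }
  intros w Hw.
  (* The circle must enclose [w] and stay inside the disc, so its radius depends on [w]. *)
  set (r := (Cmod (w - c) + rad) / 2). assert (W0 := Cmod_ge_0 (w - c)).
  assert (Hr : Cmod (w - c) < r < rad) by (unfold r; lra).
  destruct (ccont_bounded (fun t => f (circ c r t) * (r * (Ci * cis t)))%C 0 (2 * PI)) as [M [M0 HM]].
  { intros t Ht. apply cdiff_ccont. eapply cauchy_phi_cdiff; eauto. lra. }
  set (x := Cmod (w - c)) in *. set (m := r - x). assert (m0 : 0 < m) by (unfold m; lra).
  set (I := (RtoC (2 * PI) * Ci)%C). assert (I0 : I <> 0) by apply two_pi_i_neq_0.
  set (K := M / m * (2 * PI)).
  assert (K0 : 0 < K). { apply Rmult_lt_0_compat; auto. apply Rdiv_lt_0_compat; auto. }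
  assert (B : forall n, Cmod (I * f w) <= K * (x / r) ^ n).
  { intros n. destruct (A n) as (g & Hg & E).
    rewrite (E w) by exact Hw.
    replace (I * ((w - c) ^ n * g w))%C with ((w - c) ^ n * (I * g w))%C by ring.
    rewrite Cmod_mult, Cmod_pow. fold x.
    unfold I. rewrite <- (cauchy_formula g c w rad r); try lra; auto; try exact (proj1 Hr).
    assert (RN : 0 < r ^ n) by (apply pow_lt; lra).
    apply Rle_trans with (x ^ n * (M / m / r ^ n * (2 * PI - 0))).
    - apply Rmult_le_compat_l; [apply pow_le; auto|]. apply RIntC_bound; [lra| |].
      + intros t Ht. apply cdiff_ccont, cdiff_div.
        * apply (cauchy_phi_cdiff g c rad r); auto. lra.
        * apply cdiff_circ_minus.
        * apply circ_neq; auto; try exact (proj1 Hr); lra.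
      + intros t Ht. specialize (HM t Ht). simpl in HM.
        assert (CN : (circ c r t - w)%C <> 0) by (apply circ_neq; [lra|exact (proj1 Hr)]).
        rewrite (E (circ c r t)) in HM by (rewrite circ_dist; lra).
        rewrite !Cmod_mult, Cmod_pow, circ_dist in HM by lra.
        rewrite Cmod_div, !Cmod_mult by auto.
        assert (D := circ_dist_ge c r t w ltac:(lra)). fold x in D. fold m in D.
        set (q := Cmod (g (circ c r t)) * (Cmod r * (Cmod Ci * Cmod (cis t)))) in *.
        assert (q0 : 0 <= q) by (unfold q; repeat apply Rmult_le_pos; apply Cmod_ge_0).
        replace (M / m / r ^ n) with (M / r ^ n * / m) by (field; lra).
        apply Rmult_le_compat; auto.
        * left. apply Rinv_0_lt_compat. lra.
        * apply Rmult_le_reg_l with (r ^ n); auto.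
          replace (r ^ n * (M / r ^ n)) with M by (field; lra). unfold q. lra.
        * apply Rinv_le_contravar; auto.
    - right. unfold K, Rdiv. rewrite Rpow_mult_distr, pow_inv. field. lra. }
  assert (Z : Cmod (I * f w) = 0).
  { apply Rle_antisym; [|apply Cmod_ge_0]. apply le_epsilon. intros e He.
    destruct (pow_lt_1_zero (x / r)) with (y := e / K) as [n Hn].
    - rewrite Rabs_pos_eq by (apply Rdiv_le_0_compat; lra).
      apply Rmult_lt_reg_r with r; [lra|]. unfold Rdiv. rewrite Rmult_assoc, Rinv_l; lra.
    - apply Rdiv_lt_0_compat; auto.
    - specialize (Hn n (le_n _)). specialize (B n).
      assert (L := Rle_abs ((x / r) ^ n)).
      apply Rle_trans with (K * (e / K)); [|right; field; lra].
      eapply Rle_trans; [apply B|]. apply Rmult_le_compat_l; lra. }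
  rewrite Cmod_mult in Z. apply Rmult_integral in Z. destruct Z as [Z|Z].
  - exfalso. apply I0, Cmod_eq_0, Z.
  - apply Cmod_eq_0, Z.
Qed.

(** * Zeros of holomorphic functions on the upper half plane *)

Lemma ccont_neq_0 (g : C -> C) (c : C) :
  ccont g c -> g c <> 0 -> exists d, 0 < d /\ forall z, Cmod (z - c) < d -> g z <> 0.
Proof.
  intros H N. destruct (H (Cmod (g c))) as [d [d0 Hd]]. { apply Cmod_gt_0; auto. }
  exists d. split; auto. intros z Hz E. specialize (Hd z Hz).
  rewrite E, Cmod_sub_sym in Hd. replace (g c - 0)%C with (g c) in Hd by ring. lra.
Qed.

Lemma inH_disc (c z : C) : Cmod (z - c) < Im c -> inH z.
Proof.
  intros H. unfold inH. assert (L := im_le_Cmod (z - c)).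
  assert (E : Im (z - c) = Im z - Im c) by (destruct z, c; simpl; ring).
  rewrite E in L. apply Rabs_le_between in L. lra.
Qed.

Definition holH (f : C -> C) : Prop := forall z, inH z -> cdiff f z.

Lemma holH_disc f c : holH f -> cdiff_disc f c (Im c).
Proof. intros H z Hz. apply H, (inH_disc c z Hz). Qed.

(** Both discs touch the real axis at [x], and the centre of the larger one lies inside the smaller
    one, at distance [y / 2] from its centre. So [f] cannot have finite order at the new centre. *)
Lemma holH_zero_up (f : C -> C) (x y : R) :
  holH f -> 0 < y -> (forall z, Cmod (z - (x, y)) < y -> f z = 0) ->
  forall z, Cmod (z - (x, y * (3 / 2))) < y * (3 / 2) -> f z = 0.
Proof.
  intros Hf Hy H.
  set (c := (x, y * (3 / 2)) : C).
  destruct (zero_order f c (y * (3 / 2))) as [|(n & g & Hg & N & E)]; auto.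
  - lra.
  - apply (holH_disc f c Hf).
  - exfalso.
    destruct (ccont_neq_0 g c) as [d [d0 Hd]]; auto.
    { apply cdiff_ccont, Hg. rewrite Cmod_self. lra. }
    set (e := Rmin (d / 2) (y / 4)).
    assert (e0 : 0 < e) by (apply Rmin_pos; lra).
    assert (e1 : e <= d / 2) by apply Rmin_l. assert (e2 : e <= y / 4) by apply Rmin_r.
    set (z := (c + e)%C).
    assert (Dz : Cmod (z - c) = e).
    { unfold z. replace (c + e - c)%C with (RtoC e) by ring. rewrite Cmod_R, Rabs_pos_eq; lra. }
    assert (Fz : f z = 0).
    { apply H. assert (T := Cmod_sub_triangle z c (x, y)).
      assert (Cmod (c - (x, y)) = y / 2).
      { replace (c - (x, y))%C with (RtoC (y / 2) * Ci)%C.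
        - rewrite Cmod_mult, Cmod_Ci, Cmod_R, Rabs_pos_eq; lra.
        - unfold c. apply injective_projections; simpl; field. }
      lra. }
    rewrite E in Fz by lra.
    assert (ZC : (z - c)%C <> 0) by (apply Cmod_gt_0; lra).
    apply (Cmult_neq_0 ((z - c) ^ n)%C (g z)); auto.
    + apply Cpow_nz; auto.
    + apply Hd. lra.
Qed.

Lemma pow_ge_linear (k : nat) : 1 + INR k / 2 <= (3 / 2) ^ k.
Proof.
  induction k as [|k IH]; [simpl; lra|]. rewrite S_INR. simpl. assert (P := pos_INR k). lra.
Qed.

(** The discs tangent to the real axis at the real part of [c], of radii [y (3/2)^k], exhaust the
    upper half plane. This growing family takes the place of a connectedness argument. *)
Lemma holH_identity (f : C -> C) (c : C) :
  holH f -> inH c -> (forall z, Cmod (z - c) < Im c -> f z = 0) -> forall z, inH z -> f z = 0.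
Proof.
  intros Hf Hc H. destruct c as [x y]. unfold inH in Hc. simpl in Hc.
  assert (A : forall k : nat, forall z, Cmod (z - (x, y * (3 / 2) ^ k)) < y * (3 / 2) ^ k -> f z = 0).
  { induction k as [|k IH].
    - simpl. rewrite Rmult_1_r. apply H.
    - assert (P : 0 < (3 / 2) ^ k) by (apply pow_lt; lra).
      replace (y * (3 / 2) ^ S k) with (y * (3 / 2) ^ k * (3 / 2)) by (simpl; ring).
      apply holH_zero_up; auto. apply Rmult_lt_0_compat; auto. }
  intros [x1 y1] Hz. unfold inH in Hz. simpl in Hz.
  (* The point [(x1, y1)] lies in the tangent disc of radius [Y] exactly when [T < 2 Y y1]. *)
  set (T := (x1 - x) ^ 2 + y1 ^ 2).
  destruct (INR_unbounded (T / (y * y1))) as [k Hk].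
  apply (A k). set (Y := y * (3 / 2) ^ k).
  assert (HY : T < 2 * Y * y1).
  { assert (L := pow_ge_linear k). unfold Y.
    apply (Rmult_lt_compat_r (y * y1)) in Hk; [|nra].
    replace (T / (y * y1) * (y * y1)) with T in Hk by (field; split; lra).
    assert (P : 0 < y * y1) by nra.
    assert (Q := Rmult_le_compat_l _ _ _ (Rlt_le _ _ P) L).
    replace (2 * (y * (3 / 2) ^ k) * y1) with (2 * (y * y1 * (3 / 2) ^ k)) by ring. nra. }
  assert (Y0 : 0 < Y). { unfold Y. apply Rmult_lt_0_compat; auto. apply pow_lt; lra. }
  unfold Cmod. simpl. apply Rlt_le_trans with (sqrt (Y ^ 2)).
  - apply sqrt_lt_1_alt. unfold T in HY.
    replace ((x1 + - x) * ((x1 + - x) * 1) + (y1 + - Y) * ((y1 + - Y) * 1))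
      with ((x1 - x) ^ 2 + y1 ^ 2 - 2 * Y * y1 + Y ^ 2) by ring.
    split; [|lra].
    replace ((x1 - x) ^ 2 + y1 ^ 2 - 2 * Y * y1 + Y ^ 2) with ((x1 - x) ^ 2 + (y1 - Y) ^ 2) by ring.
    apply Rplus_le_le_0_compat; apply pow2_ge_0.
  - right. apply sqrt_pow2. lra.
Qed.

Lemma holH_zero_order (f : C -> C) :
  holH f ->
  (forall z, inH z -> f z = 0) \/
  (forall z0, inH z0 -> exists n g, cdiff_disc g z0 (Im z0) /\ g z0 <> 0 /\
     forall z, Cmod (z - z0) < Im z0 -> f z = ((z - z0) ^ n * g z)%C).
Proof.
  intros Hf.
  destruct (classic (forall z, inH z -> f z = 0)) as [|N]; auto.
  right. intros z0 Hz0.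
  destruct (zero_order f z0 (Im z0) Hz0 (holH_disc f z0 Hf)) as [Z|]; auto.
  exfalso. apply N. apply (holH_identity f z0); auto.
Qed.

(** * Convolution sums of divisor functions *)

Definition lsum {T : Type} (f : T -> R) (l : list T) : R := fold_right Rplus 0 (map f l).

Lemma lsum_app {T} (f : T -> R) l l' : lsum f (l ++ l') = lsum f l + lsum f l'.
Proof. unfold lsum. induction l as [|x l IH]; simpl; [ring|]. rewrite IH. ring. Qed.

Lemma lsum_ext {T} (f g : T -> R) l : (forall x, In x l -> f x = g x) -> lsum f l = lsum g l.
Proof.
  unfold lsum. induction l as [|x l IH]; simpl; intros H; auto. rewrite H, IH; auto.
Qed.

Lemma lsum_lin {T} (f g : T -> R) c l : lsum (fun x => f x + c * g x) l = lsum f l + c * lsum g l.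
Proof. unfold lsum. induction l as [|x l IH]; simpl; [ring|]. rewrite IH. ring. Qed.

Lemma lsum_scal {T} (f : T -> R) c l : lsum (fun x => c * f x) l = c * lsum f l.
Proof. unfold lsum. induction l as [|x l IH]; simpl; [ring|]. rewrite IH. ring. Qed.

Lemma lsum_map {T U} (h : T -> U) (f : U -> R) l : lsum f (map h l) = lsum (fun x => f (h x)) l.
Proof. unfold lsum. rewrite map_map. reflexivity. Qed.

Lemma lsum_perm {T} (f : T -> R) l l' : Permutation l l' -> lsum f l = lsum f l'.
Proof.
  unfold lsum. intros P. induction P; simpl; auto; try congruence. ring.
Qed.

Lemma lsum_filter_if {T} (p : T -> bool) (f : T -> R) l :
  lsum f (filter p l) = lsum (fun x => if p x then f x else 0) l.
Proof.
  unfold lsum. induction l as [|x l IH]; simpl; auto. destruct (p x); simpl; rewrite IH; ring.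
Qed.

Lemma lsum_bij {T U} (phi : T -> U) (psi : U -> T) (f : T -> R) (g : U -> R) l l' :
  NoDup l -> NoDup l' ->
  (forall x, In x l -> In (phi x) l' /\ psi (phi x) = x /\ f x = g (phi x)) ->
  (forall y, In y l' -> In (psi y) l /\ phi (psi y) = y) ->
  lsum f l = lsum g l'.
Proof.
  intros N N' H H'.
  rewrite (lsum_ext f (fun x => g (phi x)) l) by (intros x Hx; apply H, Hx).
  rewrite <- lsum_map. apply lsum_perm. apply NoDup_Permutation; auto.
  - apply NoDup_map_NoDup_ForallPairs; auto. intros x y Hx Hy E.
    destruct (H x Hx) as (_ & <- & _). destruct (H y Hy) as (_ & <- & _). congruence.
  - intros y. rewrite in_map_iff. split.
    + intros (x & <- & Hx). apply H, Hx.
    + intros Hy. exists (psi y). destruct (H' y Hy). auto.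
Qed.

Definition dprod {T U : Type} (l : list T) (g : T -> list U) : list (T * U) :=
  flat_map (fun x => map (pair x) (g x)) l.

Lemma In_dprod {T U} (l : list T) (g : T -> list U) x y :
  In (x, y) (dprod l g) <-> In x l /\ In y (g x).
Proof.
  unfold dprod. rewrite in_flat_map. split.
  - intros (x' & Hx' & H). apply in_map_iff in H. destruct H as (y' & E & Hy').
    injection E as -> ->. auto.
  - intros [Hx Hy]. exists x. split; auto. apply in_map; auto.
Qed.

Lemma NoDup_dprod {T U} (l : list T) (g : T -> list U) :
  NoDup l -> (forall x, In x l -> NoDup (g x)) -> NoDup (dprod l g).
Proof.
  induction l as [|x l IH]; intros N H; [constructor|].
  simpl. inversion N as [|? ? Nx Nl]; subst. apply NoDup_app.
  - apply NoDup_map_NoDup_ForallPairs; [|apply H; left; auto].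
    intros a b _ _ E. injection E. auto.
  - apply IH; auto. intros; apply H; right; auto.
  - intros [a b] Hab Hab'. apply in_map_iff in Hab. destruct Hab as (b' & E & _).
    injection E as -> ->. fold (dprod l g) in Hab'. apply In_dprod in Hab'. tauto.
Qed.

Lemma lsum_dprod {T U} (l : list T) (g : T -> list U) (f : T * U -> R) :
  lsum f (dprod l g) = lsum (fun x => lsum (fun y => f (x, y)) (g x)) l.
Proof.
  induction l as [|x l IH]; auto.
  change (dprod (x :: l) g) with (map (pair x) (g x) ++ dprod l g).
  rewrite lsum_app, lsum_map, IH. reflexivity.
Qed.

Definition divs (n : nat) : list nat := filter (fun d => Nat.eqb (n mod d) 0) (seq 1 n).

Lemma In_divs n d : (0 < n)%nat -> In d (divs n) <-> (0 < d)%nat /\ exists e, (n = d * e)%nat.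
Proof.
  intros Hn. unfold divs. rewrite filter_In, in_seq, Nat.eqb_eq. split.
  - intros [H1 H2]. split; [lia|]. apply Nat.Lcm0.mod_divide in H2.
    destruct H2 as [e ->]. exists e. lia.
  - intros [H1 [e ->]]. split; [destruct e; nia|]. rewrite Nat.mul_comm. apply Nat.Div0.mod_mul.
Qed.

Lemma NoDup_divs n : NoDup (divs n).
Proof. apply NoDup_filter, seq_NoDup. Qed.

Lemma sigma_lsum r n : Defs.sigma r n = lsum (fun d => INR d ^ r) (divs n).
Proof. unfold divs. rewrite lsum_filter_if. reflexivity. Qed.

(** [((a, b), (x, y))] runs over the positive solutions of [a x + b y = n]; every entry of a
    solution is at most [n], so the box loses none. *)
Definition quads (n : nat) : list (nat * nat * (nat * nat)) :=
  filter (fun q => Nat.eqb (fst (fst q) * fst (snd q) + snd (fst q) * snd (snd q)) n)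
    (dprod (dprod (seq 1 n) (fun _ => seq 1 n)) (fun _ => dprod (seq 1 n) (fun _ => seq 1 n))).

Lemma In_quads n a b x y :
  In (a, b, (x, y)) (quads n) <->
  (0 < a /\ 0 < b /\ 0 < x /\ 0 < y /\ a * x + b * y = n)%nat.
Proof.
  unfold quads. rewrite filter_In, !In_dprod, !in_seq, Nat.eqb_eq. simpl. split.
  - intros [[[H1 H2] [H3 H4]] H5]. lia.
  - intros (H1 & H2 & H3 & H4 & H5). repeat split; try lia; nia.
Qed.

Lemma NoDup_quads n : NoDup (quads n).
Proof. apply NoDup_filter. repeat (apply NoDup_dprod; intros); apply seq_NoDup. Qed.

Definition conv (i j n : nat) : R := lsum (fun k => Defs.sigma i k * Defs.sigma j (n - k)) (seq 1 (n - 1)).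

(** Expanding both divisor sums, [a] divides [k] and [b] divides [n - k]; the cofactors [x = k / a]
    and [y = (n - k) / b] make the pair a quadruple. *)
Lemma conv_quads i j n :
  conv i j n = lsum (fun q => INR (fst (fst q)) ^ i * INR (snd (fst q)) ^ j) (quads n).
Proof.
  unfold conv.
  transitivity (lsum (fun p : nat * (nat * nat) => INR (fst (snd p)) ^ i * INR (snd (snd p)) ^ j)
    (dprod (seq 1 (n - 1)) (fun k => dprod (divs k) (fun _ => divs (n - k))))).
  - rewrite lsum_dprod. apply lsum_ext. intros k Hk. rewrite lsum_dprod. simpl.
    rewrite !sigma_lsum, Rmult_comm, <- lsum_scal. apply lsum_ext. intros a Ha.
    rewrite lsum_scal. ring.
  - apply (lsum_bij (fun p => (fst (snd p), snd (snd p), (fst p / fst (snd p), (n - fst p) / snd (snd p))%nat))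
      (fun q => (fst (fst q) * fst (snd q), (fst (fst q), snd (fst q)))%nat)).
    + apply NoDup_dprod; [apply seq_NoDup|]. intros k _. apply NoDup_dprod; [apply NoDup_divs|].
      intros; apply NoDup_divs.
    + apply NoDup_quads.
    + intros [k [a b]] H. rewrite !In_dprod, in_seq in H. destruct H as (Hk & Ha & Hb).
      apply In_divs in Ha; [|lia]. apply In_divs in Hb; [|lia].
      destruct Ha as (a0 & x & Ex). destruct Hb as (b0 & y & Ey). cbn [fst snd].
      assert (E1 : (k / a = x)%nat) by (rewrite Ex, Nat.mul_comm; apply Nat.div_mul; lia).
      assert (E2 : ((n - k) / b = y)%nat) by (rewrite Ey, Nat.mul_comm; apply Nat.div_mul; lia).
      rewrite E1, E2. split; [|split; [rewrite <- Ex; reflexivity|reflexivity]].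
      apply In_quads. repeat split; try lia; nia.
    + intros [[a b] [x y]] H. apply In_quads in H. destruct H as (Ha & Hb & Hx & Hy & E). cbn [fst snd].
      assert (E1 : (a * x / a = x)%nat) by (rewrite Nat.mul_comm; apply Nat.div_mul; lia).
      assert (E2 : ((n - a * x) / b = y)%nat).
      { replace (n - a * x)%nat with (y * b)%nat by lia. apply Nat.div_mul; lia. }
      rewrite E1, E2. split; auto. rewrite !In_dprod, in_seq. split; [nia|]. split.
      * apply In_divs; [nia|]. split; auto. exists x; auto.
      * apply In_divs; [nia|]. split; auto. exists y. lia.
Qed.

Lemma NoDup_quads_filter p n : NoDup (filter p (quads n)).
Proof. apply NoDup_filter, NoDup_quads. Qed.

Definition swapq (q : nat * nat * (nat * nat)) : nat * nat * (nat * nat) :=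
  (snd (fst q), fst (fst q), (snd (snd q), fst (snd q))).

Lemma swapqK q : swapq (swapq q) = q.
Proof. destruct q as [[a b] [x y]]. reflexivity. Qed.

Lemma In_quads_swapq n q : In q (quads n) -> In (swapq q) (quads n).
Proof.
  destruct q as [[a b] [x y]]. intros Hq. apply In_quads in Hq. apply In_quads. simpl in *. lia.
Qed.

Lemma lsum_swap (p p' : nat * nat * (nat * nat) -> bool) (f g : nat * nat * (nat * nat) -> R) n :
  (forall q, In q (quads n) -> p' (swapq q) = p q /\ f q = g (swapq q)) ->
  lsum f (filter p (quads n)) = lsum g (filter p' (quads n)).
Proof.
  intros H. assert (S := In_quads_swapq n). assert (I := swapqK).
  apply (lsum_bij swapq swapq); try apply NoDup_quads_filter.
  - intros q Hq. apply filter_In in Hq. destruct Hq as [Hq P]. destruct (H q Hq) as [E1 E2].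
    rewrite filter_In, E1. auto.
  - intros q Hq. apply filter_In in Hq. destruct Hq as [Hq P].
    destruct (H (swapq q) (S q Hq)) as [E1 E2]. rewrite I in E1. rewrite filter_In, <- E1. auto.
Qed.

Lemma lsum_trichotomy {T} (u v : T -> nat) (f : T -> R) l :
  lsum f l = lsum f (filter (fun q => Nat.ltb (u q) (v q)) l)
    + lsum f (filter (fun q => Nat.ltb (v q) (u q)) l)
    + lsum f (filter (fun q => Nat.eqb (u q) (v q)) l).
Proof.
  rewrite !lsum_filter_if. unfold lsum. induction l as [|q l IH]; simpl; [ring|]. rewrite IH.
  destruct (Nat.ltb_spec (u q) (v q)), (Nat.ltb_spec (v q) (u q)), (Nat.eqb_spec (u q) (v q));
    try lia; ring.
Qed.

(* The bijection (a,b,x,y) -> (a-b,b,x,x+y) from {a > b} to {x < y} preserves ax + by. *)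
Lemma quads_identity (P : R -> R -> R) n :
  (forall a b, P a b = P b a) -> (forall a b, P a b = P a (a - b)) ->
  lsum (fun q => P (INR (fst (fst q)) + INR (snd (fst q))) (INR (snd (fst q)))
                 - P (INR (fst (fst q))) (INR (snd (fst q)))) (quads n) =
  lsum (fun q => P (INR (fst (fst q)) + INR (snd (fst q))) (INR (snd (fst q))))
    (filter (fun q => Nat.eqb (fst (snd q)) (snd (snd q))) (quads n)) -
  lsum (fun q => P (INR (fst (fst q))) (INR (snd (fst q))))
    (filter (fun q => Nat.eqb (fst (fst q)) (snd (fst q))) (quads n)).
Proof.
  intros H1 H2.
  set (f := fun q : nat * nat * (nat * nat) => P (INR (fst (fst q)) + INR (snd (fst q))) (INR (snd (fst q)))).
  set (g := fun q : nat * nat * (nat * nat) => P (INR (fst (fst q))) (INR (snd (fst q)))).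
  rewrite (lsum_ext _ (fun q => f q + (-1) * g q)) by (intros; unfold f, g; ring).
  rewrite lsum_lin.
  (* The sum of [f] is split by comparing [x] with [y], that of [g] by comparing [a] with [b]. The
     two strict parts of each are equal by symmetry, and the bijection matches them across. *)
  rewrite (lsum_trichotomy (fun q => fst (snd q)) (fun q => snd (snd q)) f).
  rewrite (lsum_trichotomy (fun q => fst (fst q)) (fun q => snd (fst q)) g).
  (* Exchanging the two pairs preserves [f] because [P (a + b) b = P (a + b) a], an instance of the
     second invariance. *)
  rewrite (lsum_swap (fun q => Nat.ltb (snd (snd q)) (fst (snd q)))
      (fun q => Nat.ltb (fst (snd q)) (snd (snd q))) f f).
  2:{ intros [[a b] [x y]] _. split; auto. unfold f; simpl.
      rewrite (H2 (INR b + INR a)). rewrite (Rplus_comm (INR b)). f_equal. ring. }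
  rewrite (lsum_swap (fun q => Nat.ltb (fst (fst q)) (snd (fst q)))
      (fun q => Nat.ltb (snd (fst q)) (fst (fst q))) g g).
  2:{ intros [[a b] [x y]] _. split; auto. unfold g; simpl. apply H1. }
  replace (lsum g (filter (fun q => Nat.ltb (snd (fst q)) (fst (fst q))) (quads n)))
    with (lsum f (filter (fun q => Nat.ltb (fst (snd q)) (snd (snd q))) (quads n))).
  - ring.
  (* The bijection is used in the direction from [x < y] to [a > b], where [P (a + b) b] becomes
     [P a b]. *)
  - apply (lsum_bij
      (fun q => ((fst (fst q) + snd (fst q), snd (fst q)), (fst (snd q), snd (snd q) - fst (snd q))))%nat
      (fun q => ((fst (fst q) - snd (fst q), snd (fst q)), (fst (snd q), snd (snd q) + fst (snd q))))%nat);
    try apply NoDup_quads_filter.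
    + intros [[a b] [x y]] H. apply filter_In in H. destruct H as [H L]. apply In_quads in H.
      apply Nat.ltb_lt in L. cbn [fst snd] in *. split; [|split].
      * apply filter_In. split; [apply In_quads; nia|]. apply Nat.ltb_lt. simpl. lia.
      * repeat f_equal; lia.
      * unfold f, g. cbn [fst snd]. rewrite plus_INR. reflexivity.
    + intros [[a b] [x y]] H. apply filter_In in H. destruct H as [H L]. apply In_quads in H.
      apply Nat.ltb_lt in L. cbn [fst snd] in *. split.
      * apply filter_In. split; [apply In_quads; nia|]. apply Nat.ltb_lt. simpl. lia.
      * repeat f_equal; lia.
Qed.

(** For [x = y] the equation reads [(a + b) x = n]: the sum [d = a + b] is a divisor of [n], and [b]
    runs freely from 1 to [d - 1]. *)
Lemma quads_eq_xy (F : nat -> nat -> R) n : (0 < n)%nat ->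
  lsum (fun q => F (fst (fst q) + snd (fst q))%nat (snd (fst q)))
    (filter (fun q => Nat.eqb (fst (snd q)) (snd (snd q))) (quads n)) =
  lsum (fun d => lsum (fun b => F d b) (seq 1 (d - 1))) (divs n).
Proof.
  intros Hn.
  transitivity (lsum (fun p => F (fst p) (snd p)) (dprod (divs n) (fun d => seq 1 (d - 1))));
    [|apply lsum_dprod].
  apply (lsum_bij (fun q => (fst (fst q) + snd (fst q), snd (fst q)))%nat
    (fun p => ((fst p - snd p, snd p), (n / fst p, n / fst p)))%nat).
  - apply NoDup_quads_filter.
  - apply NoDup_dprod; [apply NoDup_divs|]. intros; apply seq_NoDup.
  - intros [[a b] [x y]] H. apply filter_In in H. destruct H as [H L]. apply In_quads in H.
    apply Nat.eqb_eq in L. cbn [fst snd] in *. subst y.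
    assert (E : (n / (a + b) = x)%nat).
    { replace n with (x * (a + b))%nat by lia. apply Nat.div_mul. lia. }
    rewrite E. split; [|split]; auto.
    + apply In_dprod. split; [|apply in_seq; lia]. apply In_divs; auto. split; [lia|]. exists x. lia.
    + repeat f_equal; lia.
  - intros [d b] H. apply In_dprod in H. destruct H as [H1 H2]. apply In_divs in H1; auto.
    destruct H1 as (d0 & e & E). apply in_seq in H2. cbn [fst snd].
    assert (E' : (n / d = e)%nat). { rewrite E, Nat.mul_comm. apply Nat.div_mul. lia. }
    rewrite E'. split.
    + apply filter_In. split; [apply In_quads; nia|]. simpl. apply Nat.eqb_refl.
    + repeat f_equal; lia.
Qed.

Lemma lsum_const {T} (c : R) (l : list T) : lsum (fun _ => c) l = INR (length l) * c.
Proof.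
  induction l as [|x l IH]; [unfold lsum; simpl; ring|].
  change (lsum (fun _ => c) (x :: l)) with (c + lsum (fun _ : T => c) l). rewrite IH.
  simpl length. rewrite S_INR. ring.
Qed.

(** For [a = b] the equation reads [a (x + y) = n]: [a] is a divisor, and there are [n / a - 1] ways
    to split the cofactor. *)
Lemma quads_eq_ab (F : nat -> R) n : (0 < n)%nat ->
  lsum (fun q => F (fst (fst q)))
    (filter (fun q => Nat.eqb (fst (fst q)) (snd (fst q))) (quads n)) =
  lsum (fun a => (INR n / INR a - 1) * F a) (divs n).
Proof.
  intros Hn.
  transitivity (lsum (fun p => F (fst p)) (dprod (divs n) (fun a => seq 1 (n / a - 1)))).
  - apply (lsum_bij (fun q => (fst (fst q), fst (snd q)))
      (fun p => ((fst p, fst p), (snd p, n / fst p - snd p)))%nat).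
    + apply NoDup_quads_filter.
    + apply NoDup_dprod; [apply NoDup_divs|]. intros; apply seq_NoDup.
    + intros [[a b] [x y]] H. apply filter_In in H. destruct H as [H L]. apply In_quads in H.
      apply Nat.eqb_eq in L. cbn [fst snd] in *. subst b.
      assert (E : (n / a = x + y)%nat).
      { replace n with ((x + y) * a)%nat by lia. apply Nat.div_mul. lia. }
      rewrite E. split; [|split]; auto.
      * apply In_dprod. rewrite E. split; [|apply in_seq; lia].
        apply In_divs; auto. split; [lia|]. exists (x + y)%nat. lia.
      * repeat f_equal; lia.
    + intros [a x] H. apply In_dprod in H. destruct H as [H1 H2]. apply In_divs in H1; auto.
      destruct H1 as (d0 & e & E). apply in_seq in H2. cbn [fst snd].
      assert (E' : (n / a = e)%nat). { rewrite E, Nat.mul_comm. apply Nat.div_mul. lia. }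
      rewrite E' in *. split; auto.
      apply filter_In. split; [apply In_quads; nia|]. simpl. apply Nat.eqb_refl.
  - rewrite lsum_dprod. apply lsum_ext. intros a Ha. apply In_divs in Ha; auto.
    destruct Ha as (d0 & e & E). cbn [fst]. rewrite lsum_const, length_seq.
    assert (E' : (n / a = e)%nat). { rewrite E, Nat.mul_comm. apply Nat.div_mul. lia. }
    assert (e0 : (1 <= e)%nat) by nia.
    rewrite E', E, minus_INR, mult_INR by auto. simpl (INR 1). field.
    apply not_0_INR. lia.
Qed.

Lemma divisor_identity (P : R -> R -> R) n : (0 < n)%nat ->
  (forall a b, P a b = P b a) -> (forall a b, P a b = P a (a - b)) ->
  lsum (fun q => P (INR (fst (fst q)) + INR (snd (fst q))) (INR (snd (fst q)))
                 - P (INR (fst (fst q))) (INR (snd (fst q)))) (quads n) =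
  lsum (fun d => lsum (fun b => P (INR d) (INR b)) (seq 1 (d - 1))
                 - (INR n / INR d - 1) * P (INR d) (INR d)) (divs n).
Proof.
  intros Hn H1 H2. rewrite quads_identity by auto.
  rewrite (lsum_ext (fun d => lsum _ (seq 1 (d - 1)) - _)
    (fun d => lsum (fun b => P (INR d) (INR b)) (seq 1 (d - 1))
                 + (-1) * ((INR n / INR d - 1) * P (INR d) (INR d)))) by (intros; ring).
  rewrite lsum_lin, <- (quads_eq_xy (fun d b => P (INR d) (INR b)) n Hn),
    <- (quads_eq_ab (fun d => P (INR d) (INR d)) n Hn).
  unfold Rminus. f_equal.
  - apply lsum_ext. intros q _. rewrite plus_INR. reflexivity.
  - match goal with |- _ = -1 * ?x => replace (-1 * x) with (- x) by ring end.
    f_equal. apply lsum_ext. intros q Hq.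
    apply filter_In in Hq. destruct Hq as [_ Hq]. apply Nat.eqb_eq in Hq. rewrite Hq. reflexivity.
Qed.

Lemma lsum_seq_closed (F : nat -> R) (G : R -> R) m :
  G 0 = 0 -> (forall k : nat, F (S k) = G (INR k + 1) - G (INR k)) ->
  lsum F (seq 1 m) = G (INR m).
Proof.
  intros H0 H. induction m as [|m IH]; [unfold lsum; simpl; auto|].
  rewrite seq_S, lsum_app, IH. unfold lsum; cbn [map fold_right]. rewrite Nat.add_1_l, H, <- S_INR. ring.
Qed.
Lemma lsum_seq_pred (F : nat -> R) (G : R -> R) d :
  (0 < d)%nat -> G 0 = 0 -> (forall k : nat, F (S k) = G (INR k + 1) - G (INR k)) ->
  lsum F (seq 1 (d - 1)) = G (INR d - 1).
Proof.
  intros Hd H0 H. rewrite (lsum_seq_closed F G) by auto. rewrite minus_INR by lia. reflexivity.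
Qed.

Lemma conv_sym i j n : conv i j n = conv j i n.
Proof.
  rewrite !conv_quads.
  assert (S := In_quads_swapq n). assert (I := swapqK).
  apply (lsum_bij swapq swapq); try apply NoDup_quads; auto.
  intros q Hq. split; [|split]; auto. simpl. ring.
Qed.

(** Faulhaber's polynomials for [1^k + ... + m^k], [k <= 6]; the catch-all branch is the formula for
    [k = 6]. A real argument lets them be evaluated at [d - 1] and treated by [ring]. *)
Definition psum (k : nat) (m : R) : R :=
  match k with
  | 0 => m
  | 1 => m * (m + 1) / 2
  | 2 => m * (m + 1) * (2 * m + 1) / 6
  | 3 => m ^ 2 * (m + 1) ^ 2 / 4
  | 4 => m * (m + 1) * (2 * m + 1) * (3 * m ^ 2 + 3 * m - 1) / 30
  | 5 => m ^ 2 * (m + 1) ^ 2 * (2 * m ^ 2 + 2 * m - 1) / 12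
  | _ => m * (m + 1) * (2 * m + 1) * (3 * m ^ 4 + 6 * m ^ 3 - 3 * m + 1) / 42
  end.

Lemma quads_conv_lin i j i' j' c c' (F : R -> R -> R) n :
  (forall a b, F a b = c * (a ^ i * b ^ j) + c' * (a ^ i' * b ^ j')) ->
  lsum (fun q => F (INR (fst (fst q))) (INR (snd (fst q)))) (quads n)
  = c * conv i j n + c' * conv i' j' n.
Proof.
  intros H. rewrite !conv_quads, <- lsum_scal, <- lsum_lin. apply lsum_ext. intros; apply H.
Qed.

Lemma lsum_lin4 {T} (f1 f2 f3 f4 : T -> R) c1 c2 c3 c4 l :
  lsum (fun x => c1 * f1 x + c2 * f2 x + c3 * f3 x + c4 * f4 x) l
  = c1 * lsum f1 l + c2 * lsum f2 l + c3 * lsum f3 l + c4 * lsum f4 l.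
Proof. unfold lsum. induction l as [|x l IH]; simpl; [ring|]. rewrite IH. ring. Qed.

Lemma In_divs_pos n d : In d (divs n) -> 0 < INR d.
Proof. unfold divs. rewrite filter_In, in_seq. intros [H _]. apply lt_0_INR. lia. Qed.

(** For [P] polynomial of degree at most 6 in [b], the sum over [b < d] has a closed form, so a
    double sum becomes a combination of divisor sums. *)
Lemma divs_inner_sum (P : R -> R -> R) (c0 c1 c2 c3 c4 c5 c6 : R -> R) n :
  (forall d b, P d b = c0 d + c1 d * b + c2 d * b ^ 2 + c3 d * b ^ 3 + c4 d * b ^ 4 + c5 d * b ^ 5 + c6 d * b ^ 6) ->
  lsum (fun d => lsum (fun b => P (INR d) (INR b)) (seq 1 (d - 1))
                 - (INR n / INR d - 1) * P (INR d) (INR d)) (divs n) =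
  lsum (fun d => let x := INR d in
     c0 x * psum 0 (x - 1) + c1 x * psum 1 (x - 1) + c2 x * psum 2 (x - 1) + c3 x * psum 3 (x - 1)
     + c4 x * psum 4 (x - 1) + c5 x * psum 5 (x - 1) + c6 x * psum 6 (x - 1)
     - (INR n / x - 1) * P x x) (divs n).
Proof.
  intros H. apply lsum_ext. intros d Hd. cbv zeta. f_equal.
  assert (D : (0 < d)%nat) by (apply INR_lt, In_divs_pos with n; auto).
  set (x := INR d).
  rewrite (lsum_seq_pred (fun b => P x (INR b)) (fun m =>
     c0 x * psum 0 m + c1 x * psum 1 m + c2 x * psum 2 m + c3 x * psum 3 m
     + c4 x * psum 4 m + c5 x * psum 5 m + c6 x * psum 6 m)); auto.
  - unfold psum. field.
  - intros k. rewrite H, S_INR. unfold psum. field.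
Qed.

(** The coefficient form of [E2 E4 = 3 E4' + E6]. For this [P],
    [P (a + b) b - P a b = 4 a^3 b + 4 a b^3], so the quadruple sum is [8 conv 1 3 n]. *)
Lemma conv_1_3 n : (0 < n)%nat ->
  240 * conv 1 3 n = 21 * Defs.sigma 5 n + (10 - 30 * INR n) * Defs.sigma 3 n - Defs.sigma 1 n.
Proof.
  intros Hn.
  set (P := fun a b : R => (a ^ 2 - a * b + b ^ 2) ^ 2).
  assert (H := divisor_identity P n Hn ltac:(intros; unfold P; ring) ltac:(intros; unfold P; ring)).
  rewrite (quads_conv_lin 1 3 3 1 4 4 (fun a b => P (a + b) b - P a b)) in H
    by (intros; unfold P; ring).
  rewrite (conv_sym 3 1) in H.
  rewrite (divs_inner_sum P (fun d => d ^ 4) (fun d => -2 * d ^ 3) (fun d => 3 * d ^ 2) (fun d => -2 * d)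
    (fun _ => 1) (fun _ => 0) (fun _ => 0)) in H by (intros; unfold P; ring).
  replace (240 * conv 1 3 n) with (30 * (4 * conv 1 3 n + 4 * conv 1 3 n)) by ring.
  rewrite H, !sigma_lsum, <- lsum_scal.
  transitivity (lsum (fun d => 21 * INR d ^ 5 + (10 - 30 * INR n) * INR d ^ 3 + (-1) * INR d ^ 1 + 0 * 0) (divs n)).
  - apply lsum_ext. intros d Hd. apply In_divs_pos in Hd. cbv zeta. unfold P, psum. field. lra.
  - rewrite (lsum_lin4 (fun d => INR d ^ 5) (fun d => INR d ^ 3) (fun d => INR d ^ 1) (fun _ => 0)). ring.
Qed.

(** The coefficient form of [E2 E6 - E4^2 = 2 E6'], with [12096 = 24 * 504] and [57600 = 240^2]. The
    cube [P] yields [6 a^5 b + 14 a^3 b^3 + 6 a b^5], the second invariant [Q] yields [4 a^3 b^3],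
    and a combination produces the required ratio. *)
Lemma conv_1_5_3_3 n : (0 < n)%nat ->
  12096 * conv 1 5 n - 57600 * conv 3 3 n =
  504 * Defs.sigma 5 n + 24 * Defs.sigma 1 n + 480 * Defs.sigma 3 n - 1008 * INR n * Defs.sigma 5 n.
Proof.
  intros Hn.
  set (P := fun a b : R => (a ^ 2 - a * b + b ^ 2) ^ 3).
  set (Q := fun a b : R => (a * b * (a - b)) ^ 2).
  assert (H := divisor_identity P n Hn ltac:(intros; unfold P; ring) ltac:(intros; unfold P; ring)).
  assert (H' := divisor_identity Q n Hn ltac:(intros; unfold Q; ring) ltac:(intros; unfold Q; ring)).
  (* The three monomials are regrouped with an antisymmetric remainder [a^5 b - a b^5], whose sum
     vanishes by [conv_sym]. *)
  rewrite (lsum_ext _ (fun q => (fun a b => 12 * (a ^ 1 * b ^ 5) + 14 * (a ^ 3 * b ^ 3)) (INR (fst (fst q))) (INR (snd (fst q)))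
     + 6 * ((fun a b => a ^ 5 * b ^ 1 - a ^ 1 * b ^ 5) (INR (fst (fst q))) (INR (snd (fst q)))))) in H
    by (intros; unfold P; ring).
  rewrite lsum_lin in H.
  rewrite (quads_conv_lin 1 5 3 3 12 14 (fun a b => 12 * (a ^ 1 * b ^ 5) + 14 * (a ^ 3 * b ^ 3))) in H by (intros; ring).
  rewrite (quads_conv_lin 5 1 1 5 1 (-1) (fun a b => a ^ 5 * b ^ 1 - a ^ 1 * b ^ 5)) in H by (intros; ring).
  rewrite (conv_sym 5 1) in H.
  rewrite (quads_conv_lin 3 3 3 3 4 0 (fun a b => Q (a + b) b - Q a b)) in H' by (intros; unfold Q; ring).
  rewrite (divs_inner_sum P (fun d => d ^ 6) (fun d => -3 * d ^ 5) (fun d => 6 * d ^ 4) (fun d => -7 * d ^ 3)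
    (fun d => 6 * d ^ 2) (fun d => -3 * d) (fun _ => 1)) in H by (intros; unfold P; ring).
  rewrite (divs_inner_sum Q (fun d => 0) (fun d => 0) (fun d => d ^ 4) (fun d => -2 * d ^ 3)
    (fun d => d ^ 2) (fun d => 0) (fun _ => 0)) in H' by (intros; unfold Q; ring).
  match type of H with _ = ?x => set (X := x) in H end.
  match type of H' with _ = ?x => set (Y := x) in H' end.
  (* The multipliers solve [12 * 1008 = 12096] and [14 * 1008 - 4 * 17928 = -57600]. *)
  replace (12096 * conv 1 5 n - 57600 * conv 3 3 n) with (1008 * X + (-17928) * Y)
    by (rewrite <- H, <- H'; ring).
  unfold X, Y. rewrite !sigma_lsum, <- lsum_scal, <- lsum_lin.
  transitivity (lsum (fun d => (504 - 1008 * INR n) * INR d ^ 5 + 24 * INR d ^ 1 + 480 * INR d ^ 3 + 0 * 0) (divs n)).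
  - apply lsum_ext. intros d Hd. apply In_divs_pos in Hd. cbv zeta. unfold P, Q, psum. field. lra.
  - rewrite (lsum_lin4 (fun d => INR d ^ 5) (fun d => INR d ^ 1) (fun d => INR d ^ 3) (fun _ => 0)). ring.
Qed.

(** * Ramanujan's identities *)

Definition cabs (t : nat -> C) : Prop := ex_series (fun n => Cmod (t n)).

Lemma ex_series_Rscal (c : R) (a : nat -> R) : ex_series a -> ex_series (fun n => c * a n).
Proof. apply (ex_series_scal (K := R_AbsRing) (V := R_NormedModule) c a). Qed.

Lemma ex_series_Rle (a b : nat -> R) :
  (forall n, Rabs (a n) <= b n) -> ex_series b -> ex_series a.
Proof. apply (ex_series_le (K := R_AbsRing) (V := R_CompleteNormedModule) a b). Qed.

Lemma cabs_re t : cabs t -> ex_series (fun n => Rabs (Re (t n))).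
Proof.
  intros H. apply (ex_series_Rle _ (fun n => Cmod (t n))); auto.
  intros n. rewrite Rabs_Rabsolu. apply re_le_Cmod.
Qed.

Lemma cabs_im t : cabs t -> ex_series (fun n => Rabs (Im (t n))).
Proof.
  intros H. apply (ex_series_Rle _ (fun n => Cmod (t n))); auto.
  intros n. rewrite Rabs_Rabsolu. apply im_le_Cmod.
Qed.

Lemma CSeries_ext t u : (forall n, t n = u n) -> CSeries t = CSeries u.
Proof. intros H. unfold CSeries. f_equal; apply Series_ext; intros n; rewrite H; reflexivity. Qed.

Lemma CSeries_plus t u : cabs t -> cabs u ->
  CSeries (fun n => t n + u n)%C = (CSeries t + CSeries u)%C.
Proof.
  intros Ht Hu. unfold CSeries, Cplus; simpl. f_equal; apply Series_plus; apply ex_series_Rabs;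
    auto using cabs_re, cabs_im.
Qed.

Lemma CSeries_scal (c : C) t : cabs t -> CSeries (fun n => c * t n)%C = (c * CSeries t)%C.
Proof.
  intros Ht. assert (H1 := ex_series_Rabs _ (cabs_re t Ht)). assert (H2 := ex_series_Rabs _ (cabs_im t Ht)).
  unfold CSeries, Cmult; simpl. f_equal.
  - rewrite <- !Series_scal_l. apply Series_minus; apply ex_series_Rscal; auto.
  - rewrite <- !Series_scal_l. apply Series_plus; apply ex_series_Rscal; auto.
Qed.

Lemma cabs_le t (b : nat -> R) : (forall n, Cmod (t n) <= b n) -> ex_series b -> cabs t.
Proof.
  intros H Hb. apply (ex_series_Rle _ b); auto.
  intros n. rewrite Rabs_pos_eq by apply Cmod_ge_0. apply H.
Qed.

Lemma cabs_plus t u : cabs t -> cabs u -> cabs (fun n => t n + u n)%C.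
Proof.
  intros Ht Hu. apply cabs_le with (fun n => Cmod (t n) + Cmod (u n)).
  - intros; apply Cmod_triangle.
  - apply (ex_series_plus (K := R_AbsRing) (V := R_NormedModule)); auto.
Qed.

Lemma cabs_scal c t : cabs t -> cabs (fun n => c * t n)%C.
Proof.
  intros Ht. apply cabs_le with (fun n => Cmod c * Cmod (t n)).
  - intros; rewrite Cmod_mult; lra.
  - apply ex_series_Rscal; auto.
Qed.

Lemma CSeries_bound t (b : nat -> R) :
  (forall n, Cmod (t n) <= b n) -> ex_series b -> Cmod (CSeries t) <= 2 * Series b.
Proof.
  intros H Hb. assert (Ht := cabs_le t b H Hb).
  eapply Rle_trans; [apply Cmod_le_re_im|]. simpl.
  assert (B1 : Rabs (Series (fun n => Re (t n))) <= Series b).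
  { eapply Rle_trans; [apply Series_Rabs, cabs_re, Ht|]. apply Series_le; auto.
    intros n. split; [apply Rabs_pos|]. eapply Rle_trans; [apply re_le_Cmod|auto]. }
  assert (B2 : Rabs (Series (fun n => Im (t n))) <= Series b).
  { eapply Rle_trans; [apply Series_Rabs, cabs_im, Ht|]. apply Series_le; auto.
    intros n. split; [apply Rabs_pos|]. eapply Rle_trans; [apply im_le_Cmod|auto]. }
  lra.
Qed.

(* Coefficients whose power series converges on the whole unit disc. *)
Definition tame (a : nat -> R) : Prop :=
  forall rho, 0 < rho < 1 -> ex_series (fun n => Rabs (a n) * rho ^ n).

Lemma tame_le a b : (forall n, Rabs (a n) <= Rabs (b n)) -> tame b -> tame a.
Proof.
  intros H Hb rho Hr.
  apply (ex_series_Rle _ (fun n => Rabs (b n) * rho ^ n)); auto.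
  intros n. assert (P : 0 < rho ^ n) by (apply pow_lt; lra).
  rewrite Rabs_mult, Rabs_Rabsolu, (Rabs_pos_eq (rho ^ n)) by lra.
  apply Rmult_le_compat_r; auto. lra.
Qed.

Lemma tame_plus a b : tame a -> tame b -> tame (fun n => a n + b n).
Proof.
  intros Ha Hb rho Hr.
  apply (ex_series_Rle _
    (fun n => Rabs (a n) * rho ^ n + Rabs (b n) * rho ^ n)).
  - intros n. assert (P : 0 < rho ^ n) by (apply pow_lt; lra).
    rewrite Rabs_mult, Rabs_Rabsolu, (Rabs_pos_eq (rho ^ n)) by lra.
    rewrite <- Rmult_plus_distr_r. apply Rmult_le_compat_r; [lra|]. apply Rabs_triang.
  - apply (ex_series_plus (K := R_AbsRing) (V := R_NormedModule)); auto.
Qed.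

Lemma tame_scal c a : tame a -> tame (fun n => c * a n).
Proof.
  intros Ha rho Hr.
  apply (ex_series_ext (fun n => Rabs c * (Rabs (a n) * rho ^ n))).
  - intros n. rewrite Rabs_mult. symmetry. apply Rmult_assoc.
  - apply ex_series_Rscal; auto.
Qed.

(** Bernoulli's inequality absorbs the factor [n] into the passage from [rho] to a slightly larger
    radius [r'] that is still below 1. *)
Lemma tame_INR a : tame a -> tame (fun n => INR n * a n).
Proof.
  intros Ha rho Hr. set (r' := (rho + 1) / 2).
  assert (Hr' : rho < r' < 1) by (unfold r'; lra).
  set (y := r' / rho - 1).
  assert (y0 : 0 < y).
  { unfold y. assert (1 < r' / rho); [|lra]. apply Rmult_lt_reg_r with rho; [lra|].
    unfold Rdiv. rewrite Rmult_assoc, Rinv_l; lra. }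
  apply (ex_series_Rle _ (fun n => / y * (Rabs (a n) * r' ^ n))).
  - intros n. assert (P : 0 < rho ^ n) by (apply pow_lt; lra).
    rewrite !Rabs_mult, !Rabs_Rabsolu, (Rabs_pos_eq (rho ^ n)), (Rabs_pos_eq (INR n)) by (try apply pos_INR; lra).
    assert (E : r' ^ n = (1 + y) ^ n * rho ^ n).
    { rewrite <- Rpow_mult_distr. f_equal. unfold y. field. lra. }
    rewrite E. assert (B := poly n y y0).
    assert (A0 := Rabs_pos (a n)).
    replace (INR n * Rabs (a n) * rho ^ n) with (/ y * (Rabs (a n) * ((INR n * y) * rho ^ n))) by (field; lra).
    apply Rmult_le_compat_l. { left. apply Rinv_0_lt_compat; auto. }
    apply Rmult_le_compat_l; auto. apply Rmult_le_compat_r; lra.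
  - apply ex_series_Rscal. apply Ha. lra.
Qed.

Lemma tame_pow k : tame (fun n => INR n ^ k).
Proof.
  induction k as [|k IH]; [|simpl; apply tame_INR; auto].
  intros rho Hr. apply (ex_series_ext (fun n => rho ^ n)).
  - intros n. simpl. rewrite Rabs_R1. symmetry. apply Rmult_1_l.
  - apply ex_series_geom. rewrite Rabs_pos_eq; lra.
Qed.

Lemma sigma_bound r n : 0 <= Defs.sigma r n <= INR n ^ S r.
Proof.
  rewrite sigma_lsum. unfold divs. rewrite lsum_filter_if.
  assert (K : forall l, (forall d, In d l -> (d <= n)%nat) ->
    0 <= lsum (fun d => if Nat.eqb (n mod d) 0 then INR d ^ r else 0) l <= INR (length l) * INR n ^ r).
  { induction l as [|d l IH]; intros H; [unfold lsum; simpl; lra|].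
    unfold lsum; cbn [map fold_right length].
    change (fold_right Rplus 0 (map (fun d => if Nat.eqb (n mod d) 0 then INR d ^ r else 0) l)) with
      (lsum (fun d => if Nat.eqb (n mod d) 0 then INR d ^ r else 0) l).
    destruct IH as [I1 I2]; [intros; apply H; right; auto|].
    assert (D : 0 <= INR d ^ r <= INR n ^ r).
    { split; [apply pow_le, pos_INR|]. apply pow_incr. split; [apply pos_INR|]. apply le_INR, H. left; auto. }
    rewrite S_INR. destruct (Nat.eqb (n mod d) 0); lra. }
  destruct (K (seq 1 n)) as [K1 K2].
  - intros d Hd. apply in_seq in Hd. lia.
  - rewrite length_seq in K2. simpl. lra.
Qed.

Lemma tame_sigma r : tame (Defs.sigma r).
Proof.
  apply tame_le with (fun n => INR n ^ S r); [|apply tame_pow].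
  intros n. destruct (sigma_bound r n) as [H1 H2]. rewrite !Rabs_pos_eq; auto. apply pow_le, pos_INR.
Qed.

Definition cser (a : nat -> R) (q : C) : C := CSeries (fun n => RtoC (a n) * q ^ n)%C.

Lemma tame_cabs a q : tame a -> Cmod q < 1 -> cabs (fun n => RtoC (a n) * q ^ n)%C.
Proof.
  intros Ha Hq. assert (Q0 := Cmod_ge_0 q).
  apply cabs_le with (fun n => Rabs (a n) * ((Cmod q + 1) / 2) ^ n).
  - intros n. rewrite Cmod_mult, Cmod_R, Cmod_pow. apply Rmult_le_compat_l; [apply Rabs_pos|].
    apply pow_incr. lra.
  - apply Ha. lra.
Qed.

Lemma cser_ext a b q : (forall n, a n = b n) -> cser a q = cser b q.
Proof. intros H. apply CSeries_ext. intros n. rewrite H. reflexivity. Qed.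

Lemma cser_plus a b q : tame a -> tame b -> Cmod q < 1 ->
  cser (fun n => a n + b n) q = (cser a q + cser b q)%C.
Proof.
  intros Ha Hb Hq. unfold cser. rewrite <- CSeries_plus by (apply tame_cabs; auto).
  apply CSeries_ext. intros n. rewrite RtoC_plus. ring.
Qed.

Lemma cser_scal c a q : tame a -> Cmod q < 1 -> cser (fun n => c * a n) q = (RtoC c * cser a q)%C.
Proof.
  intros Ha Hq. unfold cser. rewrite <- CSeries_scal by (apply tame_cabs; auto).
  apply CSeries_ext. intros n. rewrite RtoC_mult. ring.
Qed.

Definition cauchy_prod (a b : nat -> R) (n : nat) : R := sum_f_R0 (fun k => a k * b (n - k)%nat) n.

Lemma tame_cauchy_prod a b : tame a -> tame b -> tame (cauchy_prod a b).
Proof.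
  intros Ha Hb rho Hr.
  assert (A := Ha rho Hr). assert (B := Hb rho Hr).
  assert (PN : forall n, 0 < rho ^ n) by (intros; apply pow_lt; lra).
  assert (AB : forall c : nat -> R, ex_series (fun n => Rabs (c n) * rho ^ n) ->
     ex_series (fun n => Rabs (Rabs (c n) * rho ^ n))).
  { intros c Hc. eapply ex_series_ext; [|apply Hc]. intros n. symmetry. apply Rabs_pos_eq.
    apply Rmult_le_pos; [apply Rabs_pos|left; auto]. }
  assert (P := is_series_mult _ _ _ _ (Series_correct _ A) (Series_correct _ B) (AB a A) (AB b B)).
  apply (ex_series_Rle _
    (fun n => sum_f_R0 (fun k => Rabs (a k) * rho ^ k * (Rabs (b (n - k)%nat) * rho ^ (n - k))) n)).
  - intros n. rewrite Rabs_mult, Rabs_Rabsolu, (Rabs_pos_eq (rho ^ n)) by (left; auto).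
    unfold cauchy_prod. eapply Rle_trans.
    { apply Rmult_le_compat_r; [left; auto|]. apply sum_f_R0_triangle. }
    rewrite Rmult_comm, scal_sum. apply sum_Rle. intros k Hk.
    replace (rho ^ n) with (rho ^ k * rho ^ (n - k)) by (rewrite <- pow_add; f_equal; lia).
    rewrite Rabs_mult. right. ring.
  - eexists. apply P.
Qed.

Lemma sum_f_R0_minus (f g : nat -> R) n :
  sum_f_R0 f n - sum_f_R0 g n = sum_f_R0 (fun k => f k - g k) n.
Proof. symmetry. apply minus_sum. Qed.

(** Real Cauchy products are formed for the four pairings of real and imaginary parts;
    [q^k q^(n-k) = q^n] recombines them term by term. *)
Lemma cser_mult a b q : tame a -> tame b -> Cmod q < 1 ->
  cser (cauchy_prod a b) q = (cser a q * cser b q)%C.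
Proof.
  intros Ha Hb Hq. assert (A := tame_cabs a q Ha Hq). assert (B := tame_cabs b q Hb Hq).
  set (u := fun n => (RtoC (a n) * q ^ n)%C) in *. set (v := fun n => (RtoC (b n) * q ^ n)%C) in *.
  assert (Ar := cabs_re u A). assert (Ai := cabs_im u A).
  assert (Br := cabs_re v B). assert (Bi := cabs_im v B).
  assert (Sr := Series_correct _ (ex_series_Rabs _ Ar)). assert (Si := Series_correct _ (ex_series_Rabs _ Ai)).
  assert (Tr := Series_correct _ (ex_series_Rabs _ Br)). assert (Ti := Series_correct _ (ex_series_Rabs _ Bi)).
  assert (Prr := is_series_mult _ _ _ _ Sr Tr Ar Br).
  assert (Pii := is_series_mult _ _ _ _ Si Ti Ai Bi).
  assert (Pri := is_series_mult _ _ _ _ Sr Ti Ar Bi).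
  assert (Pir := is_series_mult _ _ _ _ Si Tr Ai Br).
  assert (UV : forall n k, (k <= n)%nat -> (u k * v (n - k)%nat = RtoC (a k * b (n - k)%nat) * q ^ n)%C).
  { intros n k Hk. assert (Eq : (q ^ n = q ^ k * q ^ (n - k))%C) by (rewrite <- Cpow_add_r; f_equal; lia).
    unfold u, v. rewrite Eq, RtoC_mult. ring. }
  unfold cser at 1. unfold CSeries at 1. apply injective_projections.
  - simpl. apply is_series_unique.
    assert (P := is_series_minus _ _ _ _ Prr Pii).
    eapply is_series_ext; [|apply P]. intros n.
    change (plus ?x (opp ?y)) with (x - y). unfold minus, plus, opp; simpl.
    fold (Rminus (sum_f_R0 (fun k => Re (u k) * Re (v (n - k)%nat)) n) (sum_f_R0 (fun k => Im (u k) * Im (v (n - k)%nat)) n)).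
    rewrite sum_f_R0_minus.
    rewrite (sum_eq _ (fun k => (a k * b (n - k)%nat) * Re (q ^ n)%C)).
    + rewrite <- scal_sum. unfold cauchy_prod, Re. simpl. ring.
    + intros k Hk. specialize (UV n k Hk). apply (f_equal Re) in UV. unfold u, v in UV.
      unfold u, v, Re, Im in *. simpl in *.
      etransitivity; [|etransitivity; [exact UV|]]; ring.
  - simpl. apply is_series_unique.
    assert (P := is_series_plus _ _ _ _ Pri Pir).
    eapply is_series_ext; [|apply P]. intros n. unfold plus; simpl.
    rewrite <- sum_plus.
    rewrite (sum_eq _ (fun k => (a k * b (n - k)%nat) * Im (q ^ n)%C)).
    + rewrite <- scal_sum. unfold cauchy_prod, Im. simpl. ring.
    + intros k Hk. specialize (UV n k Hk). apply (f_equal Im) in UV. unfold u, v in UV.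
      unfold u, v, Re, Im in *. simpl in *.
      etransitivity; [|etransitivity; [exact UV|]]; ring.
Qed.

(** The factor [rho^2] on the left avoids the exponent [n - 2], and the crude [n^2] in place of a
    binomial coefficient is enough for the induction. *)
Lemma cpow_taylor (q h : C) (rho : R) n :
  Cmod q <= rho -> Cmod (q + h) <= rho ->
  rho ^ 2 * Cmod ((q + h) ^ n - q ^ n - h * (RtoC (INR n) * q ^ (n - 1)))
  <= INR n ^ 2 * rho ^ n * Cmod h ^ 2.
Proof.
  intros H1 H2. assert (Q0 := Cmod_ge_0 q). assert (H0 := Cmod_ge_0 h).
  assert (R0 : 0 <= rho) by lra.
  induction n as [|n IH].
  - simpl. replace (1 - 1 - h * (0 * 1))%C with (RtoC 0) by ring. rewrite Cmod_0. lra.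
  - set (d := ((q + h) ^ n - q ^ n - h * (RtoC (INR n) * q ^ (n - 1)))%C) in *.
    replace ((q + h) ^ S n - q ^ S n - h * (RtoC (INR (S n)) * q ^ (S n - 1)))%C
      with ((q + h) * d + h * h * (RtoC (INR n) * q ^ (n - 1)))%C.
    2:{ unfold d. rewrite S_INR, RtoC_plus. replace (S n - 1)%nat with n by lia.
        destruct n as [|n]; [simpl; ring|]. replace (S n - 1)%nat with n by lia. simpl. ring. }
    assert (T := Cmod_triangle ((q + h) * d) (h * h * (RtoC (INR n) * q ^ (n - 1)))).
    rewrite !Cmod_mult, Cmod_pow, Cmod_R, Rabs_pos_eq in T by apply pos_INR.
    set (x := Cmod h) in *. set (D := Cmod d) in *. assert (D0 : 0 <= D) by apply Cmod_ge_0.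
    assert (N0 := pos_INR n). assert (RN : 0 <= rho ^ n) by (apply pow_le; auto).
    assert (B1 : rho ^ 2 * (Cmod (q + h) * D) <= rho * (INR n ^ 2 * rho ^ n * x ^ 2)).
    { replace (rho ^ 2 * (Cmod (q + h) * D)) with (Cmod (q + h) * (rho ^ 2 * D)) by ring.
      apply Rmult_le_compat; auto using Cmod_ge_0. apply Rmult_le_pos; auto. apply pow_le; auto. }
    assert (B2 : rho ^ 2 * (x * x * (INR n * Cmod q ^ (n - 1))) <= x ^ 2 * INR n * (rho * rho ^ n)).
    { destruct n as [|n]; [simpl; nra|]. replace (S n - 1)%nat with n by lia.
      replace (rho ^ 2 * (x * x * (INR (S n) * Cmod q ^ n))) with (x ^ 2 * INR (S n) * (rho ^ 2 * Cmod q ^ n)) by ring.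
      apply Rmult_le_compat_l; [apply Rmult_le_pos; auto; apply pow_le; auto|].
      replace (rho * rho ^ S n) with (rho ^ 2 * rho ^ n) by (simpl; ring).
      apply Rmult_le_compat_l; [apply pow_le; auto|]. apply pow_incr. lra. }
    apply Rle_trans with (rho ^ 2 * (Cmod (q + h) * D + x * x * (INR n * Cmod q ^ (n - 1)))).
    + apply Rmult_le_compat_l; auto. apply pow_le; auto.
    + rewrite S_INR. rewrite Rmult_plus_distr_l.
      assert (P : 0 <= x ^ 2 * (rho * rho ^ n)).
      { apply Rmult_le_pos; [apply pow_le; auto|]. apply Rmult_le_pos; auto. }
      replace ((INR n + 1) ^ 2 * rho ^ S n * x ^ 2) with
        (rho * (INR n ^ 2 * rho ^ n * x ^ 2) + x ^ 2 * INR n * (rho * rho ^ n) + (INR n + 1) * (x ^ 2 * (rho * rho ^ n)))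
        by (simpl; ring).
      assert (0 <= (INR n + 1) * (x ^ 2 * (rho * rho ^ n))) by (apply Rmult_le_pos; lra). lra.
Qed.

(** Termwise differentiation, with the tails controlled by [cpow_taylor] and the series with
    coefficients [n^2 a n]. The conclusion is about [q * l] because [f'] in the variable [z] is
    [q d/dq]. *)
Lemma cser_cder a q : tame a -> Cmod q < 1 ->
  exists l, cder (cser a) q l /\ (q * l)%C = cser (fun n => INR n * a n) q.
Proof.
  intros Ha Hq. assert (Q0 := Cmod_ge_0 q).
  set (rho := (Cmod q + 1) / 2). assert (Hr : Cmod q < rho < 1) by (unfold rho; lra).
  set (t := fun n => (RtoC (a n) * (RtoC (INR n) * q ^ (n - 1)))%C).
  assert (An : tame (fun n => INR n * a n)) by (apply tame_INR; auto).
  assert (Ann : tame (fun n => INR n * (INR n * a n))) by (apply tame_INR; auto).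
  assert (Ht : cabs t).
  { apply cabs_le with (fun n => / rho * (Rabs (INR n * a n) * rho ^ n)).
    - intros n. unfold t. rewrite !Cmod_mult, !Cmod_R, Cmod_pow, Rabs_mult.
      destruct n as [|n]; [simpl; rewrite Rabs_R0; lra|]. replace (S n - 1)%nat with n by lia.
      replace (/ rho * (Rabs (INR (S n)) * Rabs (a (S n)) * rho ^ S n)) with
        (Rabs (a (S n)) * (Rabs (INR (S n)) * rho ^ n)) by (simpl pow; field; lra).
      apply Rmult_le_compat_l; [apply Rabs_pos|]. apply Rmult_le_compat_l; [apply Rabs_pos|].
      apply pow_incr. lra.
    - apply ex_series_Rscal. apply An. lra. }
  exists (CSeries t). split.
  - set (b := fun n => Rabs (INR n * (INR n * a n)) * rho ^ n).
    assert (Hb : ex_series b) by (apply Ann; lra).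
    set (K := / rho ^ 2 * (2 * Series b)).
    assert (K0 : 0 <= K).
    { apply Rmult_le_pos. { left. apply Rinv_0_lt_compat, pow_lt. lra. }
      apply Rmult_le_pos; [lra|].
      assert (Z : 0 = Series (fun _ => 0)).
      { symmetry. rewrite (Series_ext _ (fun n => 0 * b n)) by (intros; ring).
        rewrite Series_scal_l. ring. }
      rewrite Z. apply Series_le; auto. intros n. split; [lra|]. apply Rmult_le_pos; [apply Rabs_pos|apply pow_le; lra]. }
    intros eps He. exists (Rmin (rho - Cmod q) (eps / (K + 1))). split.
    { apply Rmin_pos; [lra|]. apply Rdiv_lt_0_compat; lra. }
    intros w Hw.
    assert (W1 := Rlt_le_trans _ _ _ Hw (Rmin_l _ _)). assert (W2 := Rlt_le_trans _ _ _ Hw (Rmin_r _ _)).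
    set (h := (w - q)%C) in *. assert (Ew : w = (q + h)%C) by (unfold h; ring).
    assert (Wr : Cmod (q + h) <= rho) by (eapply Rle_trans; [apply Cmod_triangle|lra]).
    assert (Wq : Cmod w < 1) by (rewrite Ew; lra).
    assert (E : (cser a w - cser a q - h * CSeries t)%C =
       CSeries (fun n => RtoC (a n) * ((q + h) ^ n - q ^ n - h * (RtoC (INR n) * q ^ (n - 1))))%C).
    { unfold cser. rewrite Ew in *.
      assert (C1 := tame_cabs a (q + h)%C Ha Wq). assert (C2 := tame_cabs a q Ha Hq).
      transitivity (CSeries (fun n => RtoC (a n) * (q + h) ^ n)%C +
         (CSeries (fun n => (-1) * (RtoC (a n) * q ^ n))%C + CSeries (fun n => (- h) * t n)%C))%C.
      - rewrite !CSeries_scal by auto. ring.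
      - rewrite <- !CSeries_plus; auto using cabs_scal, cabs_plus.
        apply CSeries_ext. intros n. unfold t. ring. }
    rewrite E.
    assert (X := Cmod_ge_0 h). set (x := Cmod h) in *.
    eapply Rle_trans.
    { apply (CSeries_bound _ (fun n => (/ rho ^ 2 * x ^ 2) * b n)).
      - intros n. rewrite Cmod_mult, Cmod_R. assert (T := cpow_taylor q h rho n ltac:(lra) Wr). fold x in T.
        set (D := Cmod _) in *. unfold b. rewrite !Rabs_mult, (Rabs_pos_eq (INR n)) by apply pos_INR.
        assert (R2 : 0 < rho ^ 2) by (apply pow_lt; lra).
        replace (/ rho ^ 2 * x ^ 2 * (INR n * (INR n * Rabs (a n)) * rho ^ n)) with
          (Rabs (a n) * (/ rho ^ 2 * (INR n ^ 2 * rho ^ n * x ^ 2))) by (field; lra).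
        apply Rmult_le_compat_l; [apply Rabs_pos|].
        apply Rmult_le_reg_l with (rho ^ 2); auto. rewrite <- Rmult_assoc, Rinv_r, Rmult_1_l; lra.
      - apply ex_series_Rscal; auto. }
    rewrite Series_scal_l.
    replace (2 * (/ rho ^ 2 * x ^ 2 * Series b)) with (K * x * x) by (unfold K; field; lra).
    apply Rmult_le_compat_r; auto.
    apply Rle_trans with ((K + 1) * (eps / (K + 1))); [|right; field; lra].
    apply Rmult_le_compat; lra.
  - rewrite <- CSeries_scal by auto. apply CSeries_ext. intros n. unfold t.
    rewrite RtoC_mult. destruct n as [|n]; [simpl; ring|]. replace (S n - 1)%nat with n by lia. simpl. ring.
Qed.

(** * The q-expansions of [E2], [E4], [E6] and their derivatives *)

Definition eis_coef (c : R) (r : nat) (n : nat) : R :=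
  match n with O => 1 | S _ => c * Defs.sigma r n end.

Lemma tame_eis c r : tame (eis_coef c r).
Proof.
  (* [INR 0 ^ n] is 1 at [n = 0] and 0 elsewhere, which accounts for the constant term. *)
  apply tame_le with (fun n => INR 0 ^ n + Rabs c * Defs.sigma r n).
  - intros [|n]; simpl.
    + unfold Defs.sigma; simpl. replace (1 + Rabs c * 0) with 1 by ring. lra.
    + rewrite Rmult_0_l, Rplus_0_l, !Rabs_mult, Rabs_Rabsolu. lra.
  - apply tame_plus; [|apply tame_scal, tame_sigma].
    apply tame_le with (fun n => INR n ^ 0); [|apply tame_pow].
    intros [|n]; simpl; rewrite ?Rmult_0_l, ?Rabs_R0, ?Rabs_R1; lra.
Qed.

Lemma qexp_cexp z : qexp z = cexp (RtoC (2 * PI) * Ci * z).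
Proof.
  unfold qexp, cexp. destruct z as [x y]. simpl.
  replace ((2 * PI * 0 - 0 * 1) * x - (2 * PI * 1 + 0 * 0) * y) with (- (2 * PI * y)) by ring.
  replace ((2 * PI * 0 - 0 * 1) * y + (2 * PI * 1 + 0 * 0) * x) with (2 * PI * x) by ring.
  reflexivity.
Qed.

Lemma cder_qexp z : cder qexp z (RtoC (2 * PI) * Ci * qexp z).
Proof.
  apply (cder_ext (fun z => cexp (RtoC (2 * PI) * Ci * z))%C); [intros; symmetry; apply qexp_cexp|].
  rewrite qexp_cexp. eapply cder_eq.
  - apply (cder_comp cexp (fun z => RtoC (2 * PI) * Ci * z)%C); [|apply cder_cexp].
    apply (cder_mult (fun _ => RtoC (2 * PI) * Ci)%C); [apply cder_const|apply cder_id].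
  - ring.
Qed.

Lemma Cmod_qexp z : inH z -> Cmod (qexp z) < 1.
Proof.
  intros Hz. unfold qexp. rewrite Cmod_mult, Cmod_R, Rabs_pos_eq by (left; apply exp_pos).
  assert (E : Cmod (cos (2 * PI * Re z), sin (2 * PI * Re z)) = 1).
  { rewrite <- (Cmod_cexp_i (2 * PI * Re z)). f_equal. unfold cexp. simpl.
    replace (0 * (2 * PI * Re z) - 1 * 0) with 0 by ring.
    replace (0 * 0 + 1 * (2 * PI * Re z)) with (2 * PI * Re z) by ring. rewrite exp_0.
    apply injective_projections; simpl; ring. }
  rewrite E, Rmult_1_r, <- exp_0. apply exp_increasing. unfold inH in Hz.
  assert (P := PI_RGT_0). nra.
Qed.

Lemma Eis_cser c r z : inH z -> Eis c r z = cser (eis_coef c r) (qexp z).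
Proof.
  intros Hz. assert (Q := Cmod_qexp z Hz).
  assert (T := tame_cabs _ _ (tame_eis c r) Q).
  assert (T' := tame_cabs _ _ (tame_sigma r) Q).
  assert (Sh : forall t, cabs t -> CSeries t = (t O + CSeries (fun n => t (S n)))%C).
  { intros t Ht. unfold CSeries. apply injective_projections; simpl;
      rewrite Series_incr_1 by (apply ex_series_Rabs; auto using cabs_re, cabs_im); reflexivity. }
  unfold cser. rewrite Sh by auto. unfold Eis. f_equal; [simpl; ring|].
  rewrite <- CSeries_scal.
  - apply CSeries_ext. intros n. simpl eis_coef. rewrite RtoC_mult. simpl. ring.
  - unfold cabs in T'. apply (ex_series_incr_1 (K := R_AbsRing) (V := R_NormedModule)) in T'. exact T'.
Qed.

Lemma Eis_cder c r z : inH z ->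
  cder (Eis c r) z (RtoC (2 * PI) * Ci * cser (fun n => (INR n * eis_coef c r n)%R) (qexp z)).
Proof.
  intros Hz. destruct (cser_cder _ (qexp z) (tame_eis c r) (Cmod_qexp z Hz)) as (l & Hl & E).
  apply (cder_local (fun w => cser (eis_coef c r) (qexp w)) _ z _ (Im z)); [exact Hz| |].
  - intros w Hw. symmetry. apply Eis_cser, (inH_disc z w Hw).
  - eapply cder_eq; [apply (cder_comp (cser (eis_coef c r)) qexp); [apply cder_qexp|apply Hl]|].
    rewrite <- E. ring.
Qed.

Lemma Eis_cdiff c r z : inH z -> cdiff (Eis c r) z.
Proof. intros Hz. eexists. apply Eis_cder, Hz. Qed.

Lemma fprime_cder f z l : cder f z l -> fprime f z = (l / (RtoC (2 * PI) * Ci))%C.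
Proof. intros H. unfold fprime. rewrite (Cderiv_eq f z l H). reflexivity. Qed.

Lemma fprime_Eis c r z : inH z -> fprime (Eis c r) z = cser (fun n => INR n * eis_coef c r n) (qexp z).
Proof.
  intros Hz. rewrite (fprime_cder _ _ _ (Eis_cder c r z Hz)).
  assert (H := two_pi_i_neq_0). set (I := (RtoC (2 * PI) * Ci)%C) in *.
  field. exact H.
Qed.

Lemma sum_f_R0_lsum f n : sum_f_R0 f n = f O + lsum f (seq 1 n).
Proof.
  induction n as [|n IH]; [unfold lsum; simpl; ring|].
  rewrite seq_S, lsum_app. simpl sum_f_R0. rewrite IH. unfold lsum; cbn [map fold_right].
  change (1 + n)%nat with (S n). ring.
Qed.

(** The end terms [k = 0] and [k = n] meet a constant term 1 and give the single divisor sums; the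
    inner terms form the convolution. *)
Lemma cauchy_prod_eis c r c' r' n : (0 < n)%nat ->
  cauchy_prod (eis_coef c r) (eis_coef c' r') n =
  c * Defs.sigma r n + c' * Defs.sigma r' n + c * c' * conv r r' n.
Proof.
  intros Hn. destruct n as [|n]; [lia|]. unfold cauchy_prod. simpl sum_f_R0.
  rewrite sum_f_R0_lsum, Nat.sub_diag. unfold conv. rewrite <- lsum_scal.
  replace (S n - 1)%nat with n by lia.
  rewrite (lsum_ext _ (fun k => c * c' * (Defs.sigma r k * Defs.sigma r' (S n - k))) (seq 1 n)).
  - simpl eis_coef. ring.
  - intros k Hk. apply in_seq in Hk. destruct k as [|k]; [lia|].
    assert (E : exists j, (n - k = S j)%nat) by (exists (n - k - 1)%nat; lia).
    destruct E as [j Ej]. cbn [Nat.sub]. rewrite Ej. change (eis_coef c r (S k)) with (c * Defs.sigma r (S k)).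
    change (eis_coef c' r' (S j)) with (c' * Defs.sigma r' (S j)). ring.
Qed.

Theorem ramanujan_E4 z : inH z ->
  fprime E4 z = (RtoC (1 / 3) * (E2 z * E4 z - E6 z))%C.
Proof.
  intros Hz. assert (Q := Cmod_qexp z Hz). unfold E4. rewrite fprime_Eis by auto.
  unfold E2, E6. rewrite !Eis_cser by auto.
  assert (T1 := tame_eis (-24) 1). assert (T2 := tame_eis 240 3). assert (T3 := tame_eis (-504) 5).
  assert (E : forall n, cauchy_prod (eis_coef (-24) 1) (eis_coef 240 3) n =
     3 * (INR n * eis_coef 240 3 n) + eis_coef (-504) 5 n).
  { intros [|n]; [unfold cauchy_prod; simpl; ring|].
    rewrite cauchy_prod_eis by lia. assert (H := conv_1_3 (S n) ltac:(lia)).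
    unfold eis_coef. lra. }
  rewrite <- cser_mult by auto. rewrite (cser_ext _ _ _ E).
  rewrite cser_plus, cser_scal by (auto; try (apply tame_scal); apply tame_INR; auto).
  set (X := cser _ _). set (Y := cser _ _).
  replace (RtoC (1 / 3) * (RtoC 3 * X + Y - Y))%C with (RtoC (1 / 3) * RtoC 3 * X)%C by ring.
  rewrite <- RtoC_mult. replace (1 / 3 * 3) with 1 by field. ring.
Qed.

Theorem ramanujan_E6 z : inH z ->
  fprime E6 z = (RtoC (1 / 2) * (E2 z * E6 z - E4 z * E4 z))%C.
Proof.
  intros Hz. assert (Q := Cmod_qexp z Hz). unfold E6. rewrite fprime_Eis by auto.
  unfold E2, E4. rewrite !Eis_cser by auto.
  assert (T1 := tame_eis (-24) 1). assert (T2 := tame_eis 240 3). assert (T3 := tame_eis (-504) 5).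
  assert (E : forall n, cauchy_prod (eis_coef (-24) 1) (eis_coef (-504) 5) n =
     2 * (INR n * eis_coef (-504) 5 n) + cauchy_prod (eis_coef 240 3) (eis_coef 240 3) n).
  { intros [|n]; [unfold cauchy_prod; simpl; ring|].
    rewrite !cauchy_prod_eis by lia. assert (H := conv_1_5_3_3 (S n) ltac:(lia)).
    unfold eis_coef. lra. }
  rewrite <- !cser_mult by auto. rewrite (cser_ext _ _ _ E).
  rewrite cser_plus, cser_scal by (auto; try (apply tame_cauchy_prod; auto); try (apply tame_scal); apply tame_INR; auto).
  set (X := cser _ _). set (Y := cser _ _).
  replace (RtoC (1 / 2) * (RtoC 2 * X + Y - Y))%C with (RtoC (1 / 2) * RtoC 2 * X)%C by ring.
  rewrite <- RtoC_mult. replace (1 / 2 * 2) with 1 by field. ring.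
Qed.

Lemma E2_cdiff z : inH z -> cdiff E2 z.
Proof. apply Eis_cdiff. Qed.
Lemma E4_cdiff z : inH z -> cdiff E4 z.
Proof. apply Eis_cdiff. Qed.
Lemma E6_cdiff z : inH z -> cdiff E6 z.
Proof. apply Eis_cdiff. Qed.

(** * Meromorphic functions and meromorphic modular forms *)

(* Exceptional sets are closed and discrete in H; [mer_eq f g] unfolds to [ae (fun z => f z = g z)]. *)
Definition ae (P : C -> Prop) : Prop :=
  forall z0, inH z0 -> exists eps, 0 < eps /\
    forall z, inH z -> 0 < Cmod (z - z0) < eps -> P z.

Lemma ae_all (P : C -> Prop) : (forall z, inH z -> P z) -> ae P.
Proof. intros H z0 _. exists 1. split; [lra|]. auto. Qed.

Lemma ae_and (P Q : C -> Prop) : ae P -> ae Q -> ae (fun z => P z /\ Q z).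
Proof.
  intros HP HQ z0 Hz0. destruct (HP z0 Hz0) as [e1 [P1 H1]]. destruct (HQ z0 Hz0) as [e2 [P2 H2]].
  exists (Rmin e1 e2). split. { apply Rmin_pos; auto. }
  intros z Hz [Z1 Z2]. split.
  - apply H1; auto. split; auto. eapply Rlt_le_trans; [apply Z2|apply Rmin_l].
  - apply H2; auto. split; auto. eapply Rlt_le_trans; [apply Z2|apply Rmin_r].
Qed.

Lemma ae_imp (P Q : C -> Prop) : ae P -> (forall z, inH z -> P z -> Q z) -> ae Q.
Proof.
  intros HP H z0 Hz0. destruct (HP z0 Hz0) as [e [P1 H1]]. exists e. split; auto.
Qed.

Lemma ae_imp2 (P Q S : C -> Prop) :
  ae P -> ae Q -> (forall z, inH z -> P z -> Q z -> S z) -> ae S.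
Proof. intros HP HQ H. apply (ae_imp _ _ (ae_and _ _ HP HQ)). intros z Hz [A B]; auto. Qed.

Lemma ae_ex (P : C -> Prop) : ae P -> exists z, inH z /\ P z.
Proof.
  intros H. assert (HI : inH Ci) by (unfold inH; simpl; lra).
  destruct (H Ci HI) as [e [e0 He]]. set (d := e / 2).
  exists (Ci + d)%C. assert (K : inH (Ci + d)%C) by (unfold inH; simpl; lra). split; auto.
  apply He; auto. replace (Ci + d - Ci)%C with (RtoC d) by ring.
  rewrite Cmod_R, Rabs_pos_eq; unfold d; lra.
Qed.

(** Exceptional sets are closed, so a property that holds off one holds near each good point. This
    makes derivatives respect [mer_eq]. *)
Lemma ae_local (P : C -> Prop) :
  ae P -> ae (fun z => exists d, 0 < d /\ forall w, Cmod (w - z) < d -> P w).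
Proof.
  intros H z0 Hz0. destruct (H z0 Hz0) as [e [e0 He]]. exists e. split; auto.
  intros z Hz [Z1 Z2].
  exists (Rmin (Im z) (Rmin (Cmod (z - z0)) (e - Cmod (z - z0)))).
  split. { repeat apply Rmin_pos; auto; lra. }
  intros w Hw.
  assert (W1 := Rlt_le_trans _ _ _ Hw (Rmin_l _ _)).
  assert (W := Rlt_le_trans _ _ _ Hw (Rmin_r _ _)).
  assert (W2 := Rlt_le_trans _ _ _ W (Rmin_l _ _)).
  assert (W3 := Rlt_le_trans _ _ _ W (Rmin_r _ _)).
  apply He; [apply (inH_disc z w W1)|].
  assert (T1 := Cmod_sub_triangle w z z0). assert (T2 := Cmod_sub_triangle z w z0).
  rewrite (Cmod_sub_sym z w) in T2. lra.
Qed.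

Lemma mer_eq_sym f g : mer_eq f g -> mer_eq g f.
Proof. intros H. apply (ae_imp _ _ H). intros; auto. Qed.

Lemma mer_eq_trans f g h : mer_eq f g -> mer_eq g h -> mer_eq f h.
Proof. intros H1 H2. apply (ae_imp2 _ _ _ H1 H2). intros; congruence. Qed.

Lemma Dop_mer_eq k f g : mer_eq f g -> mer_eq (Dop k f) (Dop k g).
Proof.
  intros H. apply (ae_imp _ _ (ae_local _ H)). intros z Hz (d & d0 & Hd).
  unfold Dop, fprime. rewrite (Cderiv_local f g z d d0 Hd).
  rewrite (Hd z); auto. rewrite Cmod_self; auto.
Qed.

(** Describing the derivative after multiplication by [z - c] avoids the exponent [n - 1], and it is
    the form in which [Mer_fprime] needs it. *)
Lemma cder_pow_shift_val (c : C) (n : nat) (z : C) :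
  exists l, cder (fun w => (w - c) ^ n)%C z l /\ ((z - c) * l = RtoC (INR n) * (z - c) ^ n)%C.
Proof.
  induction n as [|n (l & IH & E)].
  - exists 0. split; [apply (cder_const 1)|]. simpl. ring.
  - exists (1 * (z - c) ^ n + (z - c) * l)%C. split.
    + simpl. apply (cder_mult (fun w => w - c)%C); auto.
      eapply cder_eq; [apply cder_minus; [apply cder_id|apply cder_const]|]. ring.
    + rewrite S_INR, RtoC_plus. simpl. rewrite E. ring.
Qed.

Lemma Mer_cdiff (f : C -> C) :
  Mer f <-> forall z0, inH z0 -> exists eps, 0 < eps /\ exists m g,
    cdiff_disc g z0 eps /\
    (forall z, 0 < Cmod (z - z0) < eps -> (Cpow (z - z0) m * f z = g z)%C).
Proof.
  split; intros H z0 Hz0.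
  - destruct (H z0 Hz0) as (e & e0 & _ & m & g & Hg & E). exists e. split; auto.
    exists m, g. split; auto. intros z Hz. apply cder_ex, Hg, Hz.
  - destruct (H z0 Hz0) as (e & e0 & m & g & Hg & E).
    exists (Rmin e (Im z0)). split. { apply Rmin_pos; auto. } split; [apply Rmin_r|].
    exists m, g. split.
    + intros z Hz. apply cder_ex, Hg. eapply Rlt_le_trans; [apply Hz|apply Rmin_l].
    + intros z Hz. apply E. split; [lra|]. eapply Rlt_le_trans; [apply Hz|apply Rmin_l].
Qed.

Lemma Mer_mer_eq f g : mer_eq f g -> Mer f -> Mer g.
Proof.
  intros H Hf. apply Mer_cdiff. intros z0 Hz0.
  destruct (proj1 (Mer_cdiff f) Hf z0 Hz0) as (e & e0 & m & u & Hu & E).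
  destruct (H z0 Hz0) as (e1 & e10 & H1).
  exists (Rmin e (Rmin e1 (Im z0))). split. { repeat apply Rmin_pos; auto. }
  exists m, u. split.
  - intros z Hz. apply Hu. eapply Rlt_le_trans; [apply Hz|apply Rmin_l].
  - intros z [Z0 Hz].
    assert (Z1 := Rlt_le_trans _ _ _ Hz (Rmin_l _ _)).
    assert (Z := Rlt_le_trans _ _ _ Hz (Rmin_r _ _)).
    assert (Z2 := Rlt_le_trans _ _ _ Z (Rmin_l _ _)).
    assert (Z3 := Rlt_le_trans _ _ _ Z (Rmin_r _ _)).
    rewrite <- E by lra. rewrite H1; auto. apply (inH_disc z0 z Z3).
Qed.

Lemma Mer_holH f : holH f -> Mer f.
Proof.
  intros H. apply Mer_cdiff. intros z0 Hz0. exists (Im z0). split; auto.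
  exists O, f. split; [apply holH_disc; auto|]. intros z _. simpl. ring.
Qed.

Lemma Mer_const c : Mer (fun _ => c).
Proof. apply Mer_holH. intros z _. apply cdiff_const. Qed.

Lemma Mer_ae_cdiff f : Mer f -> ae (cdiff f).
Proof.
  intros H z0 Hz0.
  destruct (proj1 (Mer_cdiff f) H z0 Hz0) as (e & e0 & m & u & Hu & E).
  exists e. split; auto. intros z Hz [Z1 Z2].
  apply (cdiff_local (fun w => u w / (w - z0) ^ m)%C _ z (Rmin (Cmod (z - z0)) (e - Cmod (z - z0)))).
  - apply Rmin_pos; lra.
  - intros w Hw.
    destruct (Rmin_Rgt_l _ _ _ Hw) as [W1 W2].
    assert (T1 := Cmod_sub_triangle w z z0). assert (T2 := Cmod_sub_triangle z w z0).
    rewrite (Cmod_sub_sym z w) in T2.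
    rewrite <- E by lra. field. apply Cpow_nz, Cmod_pos_sub. lra.
  - apply cdiff_div; [apply Hu; auto| |apply Cpow_nz, Cmod_pos_sub, Z1].
    apply (cdiff_pow (fun w => w - z0)%C), cdiff_shift.
Qed.

Lemma Mer_combine (f g h : C -> C) (z0 : C) :
  Mer f -> Mer g -> inH z0 ->
  (forall e m u n v, 0 < e -> cdiff_disc u z0 e -> cdiff_disc v z0 e ->
     (forall z, 0 < Cmod (z - z0) < e -> (Cpow (z - z0) m * f z = u z)%C) ->
     (forall z, 0 < Cmod (z - z0) < e -> (Cpow (z - z0) n * g z = v z)%C) ->
     exists k w, cdiff_disc w z0 e /\
     (forall z, 0 < Cmod (z - z0) < e -> (Cpow (z - z0) k * h z = w z)%C)) ->
  exists eps, 0 < eps /\ exists m w, cdiff_disc w z0 eps /\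
    (forall z, 0 < Cmod (z - z0) < eps -> (Cpow (z - z0) m * h z = w z)%C).
Proof.
  intros Hf Hg Hz0 H.
  destruct (proj1 (Mer_cdiff f) Hf z0 Hz0) as (e1 & e10 & m & u & Hu & E1).
  destruct (proj1 (Mer_cdiff g) Hg z0 Hz0) as (e2 & e20 & n & v & Hv & E2).
  exists (Rmin e1 e2). assert (M1 := Rmin_l e1 e2). assert (M2 := Rmin_r e1 e2).
  assert (M0 : 0 < Rmin e1 e2) by (apply Rmin_pos; auto). split; auto.
  apply (H _ m u n v); auto; intros z Hz.
  - apply Hu; lra.
  - apply Hv; lra.
  - apply E1; lra.
  - apply E2; lra.
Qed.

Lemma cdiff_shift_pow c n z : cdiff (fun w => (w - c) ^ n)%C z.
Proof. apply (cdiff_pow (fun w => w - c)%C), cdiff_shift. Qed.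

Lemma Mer_plus f g : Mer f -> Mer g -> Mer (fun z => f z + g z)%C.
Proof.
  intros Hf Hg. apply Mer_cdiff. intros z0 Hz0. apply (Mer_combine f g); auto.
  intros e m u n v He Hu Hv E1 E2.
  exists (m + n)%nat, (fun z => (z - z0) ^ n * u z + (z - z0) ^ m * v z)%C. split.
  - intros z Hz. apply cdiff_plus; apply cdiff_mult; auto using cdiff_shift_pow.
  - intros z Hz. rewrite <- E1, <- E2, Cpow_add_r by auto. ring.
Qed.

Lemma Mer_mult f g : Mer f -> Mer g -> Mer (fun z => f z * g z)%C.
Proof.
  intros Hf Hg. apply Mer_cdiff. intros z0 Hz0. apply (Mer_combine f g); auto.
  intros e m u n v He Hu Hv E1 E2.
  exists (m + n)%nat, (fun z => u z * v z)%C. split.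
  - intros z Hz. apply cdiff_mult; auto.
  - intros z Hz. rewrite <- E1, <- E2, Cpow_add_r by auto. ring.
Qed.

(** From [(z - z0)^m f = g] follows [(z - z0)^(m+1) f' = (z - z0) g' - m g], up to the constant
    [2 PI i]. The right side is holomorphic because [g'] is. *)
Lemma Mer_fprime f : Mer f -> Mer (fprime f).
Proof.
  intros Hf. assert (Hc := Mer_ae_cdiff f Hf). apply Mer_cdiff. intros z0 Hz0.
  destruct (proj1 (Mer_cdiff f) Hf z0 Hz0) as (e1 & e10 & m & g & Hg & E).
  destruct (Hc z0 Hz0) as (e2 & e20 & H2).
  set (e := Rmin e1 (Rmin e2 (Im z0))).
  assert (e0 : 0 < e) by (repeat apply Rmin_pos; auto).
  assert (L1 : e <= e1) by apply Rmin_l.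
  assert (L2 : e <= e2) by (eapply Rle_trans; [apply Rmin_r|apply Rmin_l]).
  assert (L3 : e <= Im z0) by (eapply Rle_trans; [apply Rmin_r|apply Rmin_r]).
  exists e. split; auto.
  set (I := (RtoC (2 * PI) * Ci)%C). assert (I0 : I <> 0) by apply two_pi_i_neq_0.
  exists (S m), (fun z => ((z - z0) * Cderiv g z - RtoC (INR m) * g z) * / I)%C. split.
  - intros z Hz. apply cdiff_mult; [|apply cdiff_const]. apply cdiff_minus; apply cdiff_mult.
    + apply cdiff_shift.
    + apply (derivative_cdiff g z (e1 - Cmod (z - z0))); [lra|].
      intros w Hw. apply Hg. assert (T := Cmod_sub_triangle w z z0). lra.
    + apply cdiff_const.
    + apply Hg. lra.
  - intros z [Z1 Z2].
    assert (Hz : inH z) by (apply (inH_disc z0 z); lra).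
    destruct (H2 z Hz) as [l Hl]; [lra|].
    destruct (cder_pow_shift_val z0 m z) as (p & Hp & Ep).
    unfold fprime. rewrite (Cderiv_eq f z l Hl). fold I.
    assert (D : Cderiv g z = (p * f z + (z - z0) ^ m * l)%C).
    { apply Cderiv_eq.
      apply (cder_local (fun w => (w - z0) ^ m * f w)%C g z _ (Rmin (Cmod (z - z0)) (e - Cmod (z - z0)))).
      - apply Rmin_pos; lra.
      - intros w Hw.
        assert (W1 := Rlt_le_trans _ _ _ Hw (Rmin_l _ _)).
        assert (W2 := Rlt_le_trans _ _ _ Hw (Rmin_r _ _)).
        assert (T1 := Cmod_sub_triangle w z z0). assert (T2 := Cmod_sub_triangle z w z0).
        rewrite (Cmod_sub_sym z w) in T2. apply E. lra.
      - apply (cder_mult (fun w => (w - z0) ^ m)%C); auto. }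
    rewrite D, <- E by lra.
    replace ((z - z0) * (p * f z + (z - z0) ^ m * l))%C with
      ((z - z0) * p * f z + (z - z0) ^ S m * l)%C by (simpl; ring).
    rewrite Ep. unfold Cdiv. ring.
Qed.

Lemma Mer_Dop k f : Mer f -> Mer (Dop k f).
Proof.
  intros Hf. unfold Dop.
  apply (Mer_mer_eq (fun z => fprime f z + (- RtoC (k / 12) * E2 z) * f z)%C).
  - apply ae_all. intros z _. ring.
  - apply Mer_plus; [apply Mer_fprime; auto|]. apply Mer_mult; auto.
    apply Mer_mult; [apply Mer_const|]. apply Mer_holH. intros z; apply E2_cdiff.
Qed.

Lemma fprime_plus f g z : cdiff f z -> cdiff g z ->
  fprime (fun z => f z + g z)%C z = (fprime f z + fprime g z)%C.
Proof.
  intros [a Ha] [b Hb].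
  rewrite (fprime_cder _ _ _ Ha), (fprime_cder _ _ _ Hb), (fprime_cder _ _ _ (cder_plus _ _ _ _ _ Ha Hb)).
  unfold Cdiv. ring.
Qed.

Lemma fprime_mult f g z : cdiff f z -> cdiff g z ->
  fprime (fun z => f z * g z)%C z = (fprime f z * g z + f z * fprime g z)%C.
Proof.
  intros [a Ha] [b Hb].
  rewrite (fprime_cder _ _ _ Ha), (fprime_cder _ _ _ Hb), (fprime_cder _ _ _ (cder_mult _ _ _ _ _ Ha Hb)).
  unfold Cdiv. ring.
Qed.

Lemma Dop_plus k f g z : cdiff f z -> cdiff g z ->
  Dop k (fun z => f z + g z)%C z = (Dop k f z + Dop k g z)%C.
Proof. intros Hf Hg. unfold Dop. rewrite fprime_plus by auto. ring. Qed.

Lemma Dop_mult k l f g z : cdiff f z -> cdiff g z ->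
  Dop (k + l) (fun z => f z * g z)%C z = (Dop k f z * g z + f z * Dop l g z)%C.
Proof.
  intros Hf Hg. unfold Dop. rewrite fprime_mult by auto.
  replace ((k + l) / 12) with (k / 12 + l / 12) by field. rewrite RtoC_plus. ring.
Qed.

Lemma Dop_0_const c z : Dop 0 (fun _ => c) z = 0.
Proof.
  unfold Dop. rewrite (fprime_cder _ _ _ (cder_const c z)).
  replace (0 / 12) with 0 by field. unfold Cdiv. ring.
Qed.

(** * Homogeneous polynomials in [E4] and [E6], and their quotients *)

Lemma MF_ext w f g : (forall z, inH z -> f z = g z) -> MF w f -> MF w g.
Proof.
  intros H (l & W & E). exists l. split; auto. intros z Hz. rewrite <- H; auto.
Qed.

Lemma MF_zero w : MF w (fun _ => RtoC 0).
Proof. exists nil. split; [constructor|]. reflexivity. Qed.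

Lemma MF_monomial (a b : nat) (c : C) :
  MF (INR (4 * a + 6 * b)) (fun z => c * E4 z ^ a * E6 z ^ b)%C.
Proof.
  exists ((a, b, c) :: nil). split; [constructor; [reflexivity|constructor]|].
  intros z _. cbn [fold_right map fst snd]. ring.
Qed.

Lemma MF_plus w f g : MF w f -> MF w g -> MF w (fun z => f z + g z)%C.
Proof.
  intros (l & W & E) (l' & W' & E'). exists (l ++ l'). split; [apply Forall_app; auto|].
  intros z Hz. rewrite E, E' by auto. rewrite map_app, fold_right_app.
  generalize (map (fun t : nat * nat * C => (snd t * E4 z ^ fst (fst t) * E6 z ^ snd (fst t))%C) l).
  generalize (fold_right Cplus 0 (map (fun t : nat * nat * C => (snd t * E4 z ^ fst (fst t) * E6 z ^ snd (fst t))%C) l')).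
  intros s u. induction u as [|x u IH]; simpl; [ring|]. rewrite <- IH. ring.
Qed.

(** Induction on the construction from constants, [E4] and [E6]. The extensionality clause is there
    because [MF] constrains a function only on the upper half plane. *)
Lemma MF_ind (P : R -> (C -> C) -> Prop) :
  (forall w f g, (forall z, inH z -> f z = g z) -> P w f -> P w g) ->
  (forall w, P w (fun _ => RtoC 0)) ->
  (forall c, P 0 (fun _ => c)) -> P 4 E4 -> P 6 E6 ->
  (forall w v f g, P w f -> P v g -> P (w + v) (fun z => f z * g z)%C) ->
  (forall w f g, P w f -> P w g -> P w (fun z => f z + g z)%C) ->
  forall w f, MF w f -> P w f.
Proof.
  intros Hext H0 Hc H4 H6 Hm Hp w f (l & W & E).
  apply (Hext w (fun z => fold_right Cplus (RtoC 0)
              (map (fun t => (snd t * Cpow (E4 z) (fst (fst t))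
                                   * Cpow (E6 z) (snd (fst t)))%C) l))).
  { intros z Hz. rewrite E; auto. }
  clear E f. induction l as [|[[a b] c] l IH]; [apply H0|].
  inversion W as [|? ? W1 W2]; subst. cbn [fst snd] in *.
  apply (Hp _ (fun z => c * E4 z ^ a * E6 z ^ b)%C); [|apply IH; auto].
  assert (A : P (INR (4 * a)) (fun z => c * E4 z ^ a)%C).
  { clear -Hext Hc H4 Hm. induction a as [|a IH].
    - simpl. apply (Hext _ (fun _ => c)); auto. intros; ring.
    - apply (Hext _ (fun z => E4 z * (c * E4 z ^ a))%C); [intros; simpl; ring|].
      replace (INR (4 * S a)) with (4 + INR (4 * a)).
      + apply (Hm _ _ E4); auto.
      + rewrite !mult_INR, (S_INR a). simpl. ring. }
  rewrite plus_INR. clear -Hext A H6 Hm. induction b as [|b IH].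
  - rewrite Nat.mul_0_r, Rplus_0_r. apply (Hext _ (fun z => c * E4 z ^ a)%C); auto. intros; simpl; ring.
  - apply (Hext _ (fun z => E6 z * (c * E4 z ^ a * E6 z ^ b))%C); [intros; simpl; ring|].
    replace (INR (4 * a) + INR (6 * S b)) with (6 + (INR (4 * a) + INR (6 * b))).
    + apply (Hm _ _ E6); auto.
    + rewrite !mult_INR, (S_INR b). simpl. ring.
Qed.

Lemma MF_weight w w' f : w = w' -> MF w f -> MF w' f.
Proof. intros <-. auto. Qed.

Lemma MF_const c : MF 0 (fun _ => c).
Proof.
  apply (MF_ext _ (fun z => c * E4 z ^ 0 * E6 z ^ 0)%C); [intros; simpl; ring|].
  apply (MF_weight _ _ _ eq_refl (MF_monomial 0 0 c)).
Qed.

Lemma MF_E4 : MF 4 E4.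
Proof.
  apply (MF_ext _ (fun z => 1 * E4 z ^ 1 * E6 z ^ 0)%C); [intros; simpl; ring|].
  refine (MF_weight _ _ _ _ (MF_monomial 1 0 1)). simpl. ring.
Qed.

Lemma MF_E6 : MF 6 E6.
Proof.
  apply (MF_ext _ (fun z => 1 * E4 z ^ 0 * E6 z ^ 1)%C); [intros; simpl; ring|].
  refine (MF_weight _ _ _ _ (MF_monomial 0 1 1)). simpl. ring.
Qed.

Lemma MF_mult w v f g : MF w f -> MF v g -> MF (w + v) (fun z => f z * g z)%C.
Proof.
  intros (l & W & E) (l' & W' & E').
  apply (MF_ext _ (fun z => fold_right Cplus (RtoC 0)
     (map (fun t => (snd t * E4 z ^ (fst (fst t)) * E6 z ^ (snd (fst t)))%C) l) * g z)%C).
  { intros z Hz. rewrite E; auto. }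
  clear E f. induction l as [|[[a b] c] l IH].
  - apply (MF_ext _ (fun _ => RtoC 0)); [intros; simpl; ring|apply MF_zero].
  - inversion W as [|? ? W1 W2]; subst. cbn [fst snd] in *.
    apply (MF_ext _ (fun z => c * E4 z ^ a * E6 z ^ b * g z + fold_right Cplus (RtoC 0)
     (map (fun t => (snd t * E4 z ^ (fst (fst t)) * E6 z ^ (snd (fst t)))%C) l) * g z)%C);
      [intros; cbn [map fold_right fst snd]; ring|].
    apply MF_plus; auto.
    exists (map (fun t => ((a + fst (fst t))%nat, (b + snd (fst t))%nat, (c * snd t)%C)) l'). split.
    + apply Forall_map. apply (Forall_impl _ (P := fun t => INR (4 * fst (fst t) + 6 * snd (fst t)) = v)); auto.
      intros [[a' b'] c'] <-. cbn [fst snd]. rewrite <- plus_INR. f_equal. lia.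
    + intros z Hz. rewrite E' by auto. rewrite map_map. clear.
      induction l' as [|[[a' b'] c'] l' IH]; cbn [map fold_right fst snd] in *; [ring|].
      rewrite <- IH, !Cpow_add_r. ring.
Qed.

Lemma MF_holH w f : MF w f -> holH f.
Proof.
  apply (MF_ind (fun _ f => holH f)).
  - intros _ f' g H Hf z Hz. apply (cdiff_local f' g z (Im z)); auto.
    intros u Hu. apply H, (inH_disc z u Hu).
  - intros _ z _. apply cdiff_const.
  - intros c z _. apply cdiff_const.
  - intros z; apply E4_cdiff.
  - intros z; apply E6_cdiff.
  - intros _ _ f' g Hf Hg z Hz. apply cdiff_mult; auto.
  - intros _ f' g Hf Hg z Hz. apply cdiff_plus; auto.
Qed.

Lemma Dop_local_H k f g z : inH z -> (forall z, inH z -> f z = g z) -> Dop k f z = Dop k g z.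
Proof.
  intros Hz H. unfold Dop, fprime. rewrite (Cderiv_local f g z (Im z)); auto.
  - rewrite H; auto.
  - intros w Hw. apply H, (inH_disc z w Hw).
Qed.

(* Ramanujan's identities say [D_4 E4 = - E6 / 3] and [D_6 E6 = - E4^2 / 2]. *)
Lemma MF_Dop w f : MF w f -> MF (w + 2) (Dop w f).
Proof.
  intros Hf.
  cut (MF w f /\ MF (w + 2) (Dop w f)); [tauto|]. revert w f Hf.
  apply (MF_ind (fun w f => MF w f /\ MF (w + 2) (Dop w f))).
  - intros w f g H [H1 H2]. split; [apply (MF_ext _ f); auto|].
    apply (MF_ext _ (Dop w f)); auto. intros z Hz. apply Dop_local_H; auto.
  - intros w. split; [apply MF_zero|]. apply (MF_ext _ (fun _ => RtoC 0)); [|apply MF_zero].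
    intros z _. unfold Dop. rewrite (fprime_cder _ _ _ (cder_const 0 z)). unfold Cdiv. ring.
  - intros c. split; [apply MF_const|]. apply (MF_ext _ (fun _ => RtoC 0)); [|apply MF_zero].
    intros z _. rewrite Dop_0_const. reflexivity.
  - split; [apply MF_E4|].
    apply (MF_ext _ (fun z => RtoC (- (1 / 3)) * E6 z)%C).
    + intros z Hz. unfold Dop. rewrite ramanujan_E4 by auto.
      replace (4 / 12) with (1 / 3) by field. rewrite RtoC_opp. ring.
    + apply (MF_weight (0 + 6)); [ring|]. apply (MF_mult 0 6 (fun _ => RtoC (- (1/3)))); [apply MF_const|apply MF_E6].
  - split; [apply MF_E6|].
    apply (MF_ext _ (fun z => RtoC (- (1 / 2)) * (E4 z * E4 z))%C).
    + intros z Hz. unfold Dop. rewrite ramanujan_E6 by auto.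
      replace (6 / 12) with (1 / 2) by field. rewrite RtoC_opp. ring.
    + apply (MF_weight (0 + (4 + 4))); [ring|].
      apply (MF_mult 0 (4 + 4) (fun _ => RtoC (- (1/2)))); [apply MF_const|]. apply MF_mult; apply MF_E4.
  - intros w v f g [F1 F2] [G1 G2]. split; [apply MF_mult; auto|].
    apply (MF_ext _ (fun z => Dop w f z * g z + f z * Dop v g z)%C).
    + intros z Hz. symmetry. apply Dop_mult; [apply (MF_holH w)|apply (MF_holH v)]; auto.
    + apply MF_plus.
      * apply (MF_weight (w + 2 + v)); [ring|]. apply MF_mult; auto.
      * apply (MF_weight (w + (v + 2))); [ring|]. apply MF_mult; auto.
  - intros w f g [F1 F2] [G1 G2]. split; [apply MF_plus; auto|].
    apply (MF_ext _ (fun z => Dop w f z + Dop w g z)%C).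
    + intros z Hz. symmetry. apply Dop_plus; apply (MF_holH w); auto.
    + apply MF_plus; auto.
Qed.

(** [g] has a finite order at every point, so locally it is a power of [z - z0] times a nonvanishing
    factor: the zeros are isolated and the inverse has only poles. *)
Lemma MF_inv_Mer v g : MF v g -> ~ mer_zero g -> Mer (fun z => / g z)%C /\ ae (fun z => g z <> 0).
Proof.
  intros Hg N. assert (Hh := MF_holH v g Hg).
  destruct (holH_zero_order g Hh) as [Z|Z].
  { exfalso. apply N. apply ae_all. auto. }
  assert (K : forall z0, inH z0 -> exists e, 0 < e /\ exists n u, cdiff_disc u z0 e /\
    (forall z, Cmod (z - z0) < e -> u z <> 0 /\ g z = ((z - z0) ^ n * u z)%C)).
  { intros z0 Hz0. destruct (Z z0 Hz0) as (n & u & Hu & U0 & E).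
    destruct (ccont_neq_0 u z0) as [d [d0 Hd]]; auto.
    { apply cdiff_ccont, Hu. rewrite Cmod_self. exact Hz0. }
    exists (Rmin d (Im z0)). split. { apply Rmin_pos; auto. }
    exists n, u. split.
    - intros z Hz. apply Hu. eapply Rlt_le_trans; [apply Hz|apply Rmin_r].
    - intros z Hz. split.
      + apply Hd. eapply Rlt_le_trans; [apply Hz|apply Rmin_l].
      + apply E. eapply Rlt_le_trans; [apply Hz|apply Rmin_r]. }
  split.
  - apply Mer_cdiff. intros z0 Hz0. destruct (K z0 Hz0) as (e & e0 & n & u & Hu & H).
    exists e. split; auto. exists n, (fun z => / u z)%C. split.
    + intros z Hz. apply cdiff_inv; [apply Hu; auto|apply H; auto].
    + intros z [Z1 Z2]. destruct (H z Z2) as [H1 H2]. rewrite H2. field. split; auto.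
      apply Cpow_nz, Cmod_pos_sub, Z1.
  - intros z0 Hz0. destruct (K z0 Hz0) as (e & e0 & n & u & Hu & H).
    exists e. split; auto. intros z Hz [Z1 Z2]. destruct (H z Z2) as [H1 H2]. rewrite H2.
    apply Cmult_neq_0; auto. apply Cpow_nz, Cmod_pos_sub, Z1.
Qed.

Lemma ae_neq_not_mer_zero (f : C -> C) : ae (fun z => f z <> 0) -> ~ mer_zero f.
Proof.
  intros H Z. destruct (ae_ex _ (ae_and _ _ H Z)) as (z & _ & A & B). exact (A B).
Qed.

(** For a modular form, not vanishing identically and vanishing only on a discrete set are the same.
    The second form multiplies well and lets quotients be handled pointwise. *)
Lemma Mbar_rep w h : Mbar w h <->
  exists v f g, MF (w + v) f /\ MF v g /\ ae (fun z => g z <> 0) /\ mer_eq h (fun z => f z / g z)%C.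
Proof.
  split.
  - intros (v & f & g & Hf & Hg & N & E). exists v, f, g. repeat split; auto.
    apply (MF_inv_Mer v g); auto.
  - intros (v & f & g & Hf & Hg & N & E). exists v, f, g. repeat split; auto.
    apply ae_neq_not_mer_zero; auto.
Qed.

Lemma Mbar_mer_eq w h h' : mer_eq h h' -> Mbar w h -> Mbar w h'.
Proof.
  intros H (v & f & g & Hf & Hg & N & E). exists v, f, g. repeat split; auto.
  apply (mer_eq_trans _ h); auto. apply mer_eq_sym; auto.
Qed.

Lemma Mbar_weight w w' h : w = w' -> Mbar w h -> Mbar w' h.
Proof. intros <-. auto. Qed.

Lemma C1_neq_0 : RtoC 1 <> RtoC 0.
Proof. intros E. injection E. lra. Qed.

Lemma MF_Mbar w f : MF w f -> Mbar w f.
Proof.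
  intros Hf. apply Mbar_rep. exists 0, f, (fun _ => RtoC 1). repeat split.
  - apply (MF_weight w); auto. ring.
  - apply MF_const.
  - apply ae_all. intros; apply C1_neq_0.
  - apply ae_all. intros z _. field.
Qed.

Lemma Mbar_zero w : Mbar w (fun _ => RtoC 0).
Proof. apply MF_Mbar, MF_zero. Qed.

Lemma Mbar_const c : Mbar 0 (fun _ => c).
Proof. apply MF_Mbar, MF_const. Qed.

Lemma Mbar_plus w f g : Mbar w f -> Mbar w g -> Mbar w (fun z => f z + g z)%C.
Proof.
  intros Hf Hg. apply Mbar_rep in Hf, Hg.
  destruct Hf as (v & p & q & Hp & Hq & N & E). destruct Hg as (v' & p' & q' & Hp' & Hq' & N' & E').
  apply Mbar_rep. exists (v + v'), (fun z => p z * q' z + p' z * q z)%C, (fun z => q z * q' z)%C.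
  repeat split.
  - apply MF_plus.
    + apply (MF_weight (w + v + v')); [ring|]. apply MF_mult; auto.
    + apply (MF_weight (w + v' + v)); [ring|]. apply MF_mult; auto.
  - apply MF_mult; auto.
  - apply (ae_imp2 _ _ _ N N'). intros; apply Cmult_neq_0; auto.
  - apply (ae_imp2 _ _ _ (ae_and _ _ N N') (ae_and _ _ E E')).
    intros z _ [A B] [X Y]. rewrite X, Y. field. auto.
Qed.

Lemma Mbar_mult w v f g : Mbar w f -> Mbar v g -> Mbar (w + v) (fun z => f z * g z)%C.
Proof.
  intros Hf Hg. apply Mbar_rep in Hf, Hg.
  destruct Hf as (u & p & q & Hp & Hq & N & E). destruct Hg as (u' & p' & q' & Hp' & Hq' & N' & E').
  apply Mbar_rep. exists (u + u'), (fun z => p z * p' z)%C, (fun z => q z * q' z)%C.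
  repeat split.
  - apply (MF_weight (w + u + (v + u'))); [ring|]. apply MF_mult; auto.
  - apply MF_mult; auto.
  - apply (ae_imp2 _ _ _ N N'). intros; apply Cmult_neq_0; auto.
  - apply (ae_imp2 _ _ _ (ae_and _ _ N N') (ae_and _ _ E E')).
    intros z _ [A B] [X Y]. rewrite X, Y. field. auto.
Qed.

Lemma Mbar_opp w f : Mbar w f -> Mbar w (fun z => - f z)%C.
Proof.
  intros Hf. apply (Mbar_mer_eq _ (fun z => (-(1)) * f z)%C).
  - apply ae_all. intros; ring.
  - apply (Mbar_weight (0 + w)); [ring|]. apply (Mbar_mult 0 w (fun _ => -(1))%C); auto. apply Mbar_const.
Qed.

(** The graded field property: a nonzero quotient has a nonzero numerator, which may serve as a
    denominator. *)
Lemma Mbar_nz w h : Mbar w h -> ~ mer_zero h ->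
  ae (fun z => h z <> 0) /\ Mbar (- w) (fun z => / h z)%C.
Proof.
  intros Hh N. apply Mbar_rep in Hh. destruct Hh as (v & f & g & Hf & Hg & Ng & E).
  assert (Nf : ~ mer_zero f).
  { intros Z. apply N. apply (ae_imp2 _ _ _ Z E). intros z _ A B. rewrite B, A. unfold Cdiv. ring. }
  destruct (MF_inv_Mer _ f Hf Nf) as [_ Nf'].
  split.
  - apply (ae_imp2 _ _ _ (ae_and _ _ Nf' Ng) E). intros z _ [A B] X. rewrite X.
    apply Cmult_neq_0; auto. intros Y. apply C1_neq_0.
    rewrite <- (Cinv_r (g z) B), Y. ring.
  - apply Mbar_rep. exists (w + v), g, f. repeat split; auto.
    + apply (MF_weight v); auto. ring.
    + apply (ae_imp2 _ _ _ (ae_and _ _ Nf' Ng) E). intros z _ [A B] X. rewrite X. field. auto.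
Qed.

Lemma Mbar_Mer w h : Mbar w h -> Mer h.
Proof.
  intros (v & f & g & Hf & Hg & N & E).
  apply (Mer_mer_eq (fun z => f z * / g z)%C); [apply mer_eq_sym, E|].
  apply Mer_mult; [apply Mer_holH, (MF_holH _ f Hf)|apply (MF_inv_Mer v g); auto].
Qed.

(** Leibniz' rule for [f = h g], solved for [Dop w h], expresses it through derivatives of the
    modular forms [f] and [g]. *)
Lemma Mbar_Dop w h : Mbar w h -> Mbar (w + 2) (Dop w h).
Proof.
  intros Hh. assert (HM := Mbar_Mer w h Hh). apply Mbar_rep in Hh.
  destruct Hh as (v & f & g & Hf & Hg & N & E).
  apply Mbar_rep. exists (v + v), (fun z => Dop (w + v) f z * g z + (-(1)) * (f z * Dop v g z))%C, (fun z => g z * g z)%C.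
  repeat split.
  - apply MF_plus.
    + apply (MF_weight (w + v + 2 + v)); [ring|]. apply MF_mult; auto. apply MF_Dop; auto.
    + apply (MF_weight (0 + (w + v + (v + 2)))); [ring|].
      apply (MF_mult 0 _ (fun _ => -(1))%C); [apply MF_const|]. apply MF_mult; auto. apply MF_Dop; auto.
  - apply MF_mult; auto.
  - apply (ae_imp _ _ N). intros; apply Cmult_neq_0; auto.
  - assert (F : mer_eq f (fun z => h z * g z)%C).
    { apply (ae_imp2 _ _ _ N E). intros z _ A B. rewrite B. field. auto. }
    apply (ae_imp2 _ _ _ (ae_and _ _ N E) (ae_and _ _ (Dop_mer_eq (w + v) _ _ F) (Mer_ae_cdiff h HM))).
    intros z Hz [A B] [X Y]. rewrite X, Dop_mult; auto; [|apply (MF_holH v); auto].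
    replace (f z) with (h z * g z)%C by (rewrite B; field; auto). field. auto.
Qed.

(** * Homogeneous linear algebra and differential equations *)

Fixpoint csum (n : nat) (F : nat -> C) : C :=
  match n with O => RtoC 0 | S m => (csum m F + F m)%C end.

Lemma csum_ext n F G : (forall i, (i < n)%nat -> F i = G i) -> csum n F = csum n G.
Proof. induction n as [|n IH]; simpl; intros H; auto. rewrite IH, H; auto. Qed.

Lemma csum_plus n F G : csum n (fun i => F i + G i)%C = (csum n F + csum n G)%C.
Proof. induction n as [|n IH]; simpl; [ring|]. rewrite IH. ring. Qed.

Lemma csum_scal n c F : csum n (fun i => c * F i)%C = (c * csum n F)%C.
Proof. induction n as [|n IH]; simpl; [ring|]. rewrite IH. ring. Qed.

Lemma csum_zero n (F : nat -> C) : (forall i, (i < n)%nat -> F i = 0) -> csum n F = 0.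
Proof. induction n as [|n IH]; simpl; intros H; auto. rewrite IH, H; auto. ring. Qed.

Lemma csum_exchange n m F :
  csum n (fun i => csum m (fun j => F i j)) = csum m (fun j => csum n (fun i => F i j)).
Proof.
  induction n as [|n IH]; simpl.
  - symmetry. apply csum_zero. auto.
  - rewrite IH. symmetry. apply csum_plus.
Qed.

Lemma csum_delta n j (X : nat -> C) : (j < n)%nat -> csum n (fun i => if Nat.eqb j i then X i else 0) = X j.
Proof.
  induction n as [|n IH]; [lia|]. intros Hj. simpl.
  destruct (Nat.eqb_spec j n) as [->|N].
  - rewrite csum_zero; [ring|]. intros i Hi. destruct (Nat.eqb_spec n i); [lia|auto].
  - rewrite IH by lia. ring.
Qed.

(** The increasing enumeration of the indices other than [p], used to delete a pivot row; [unskip]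
    is its inverse away from [p]. *)
Definition skip (p r : nat) : nat := if Nat.ltb r p then r else S r.
Definition unskip (p r : nat) : nat := if Nat.ltb r p then r else (r - 1)%nat.

Lemma unskip_skip p r : unskip p (skip p r) = r.
Proof.
  unfold unskip, skip. destruct (Nat.ltb_spec r p).
  - destruct (Nat.ltb_spec r p); lia.
  - destruct (Nat.ltb_spec (S r) p); lia.
Qed.

Lemma skip_neq p r : skip p r <> p.
Proof. unfold skip. destruct (Nat.ltb_spec r p); lia. Qed.

Lemma skip_unskip p r : r <> p -> skip p (unskip p r) = r.
Proof.
  intros N. unfold unskip, skip. destruct (Nat.ltb_spec r p).
  - destruct (Nat.ltb_spec r p); lia.
  - destruct (Nat.ltb_spec (r - 1) p); lia.
Qed.

Lemma csum_skip n p F : (p <= n)%nat -> csum (S n) F = (F p + csum n (fun r => F (skip p r)))%C.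
Proof.
  induction n as [|n IH]; intros Hp.
  - assert (p = O) by lia. subst. simpl. ring.
  - destruct (Nat.eq_dec p (S n)) as [->|N].
    + change (csum (S (S n)) F) with (csum (S n) F + F (S n))%C.
      rewrite (csum_ext (S n) (fun r => F (skip (S n) r)) F); [ring|].
      intros i Hi. unfold skip. destruct (Nat.ltb_spec i (S n)); [auto|lia].
    + change (csum (S (S n)) F) with (csum (S n) F + F (S n))%C. rewrite IH by lia.
      simpl. replace (skip p n) with (S n); [ring|].
      unfold skip. destruct (Nat.ltb_spec n p); lia.
Qed.

Lemma ae_forall_lt n (P : nat -> C -> Prop) :
  (forall i, (i < n)%nat -> ae (P i)) -> ae (fun z => forall i, (i < n)%nat -> P i z).
Proof.
  induction n as [|n IH]; intros H.
  - apply ae_all. intros; lia.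
  - apply (ae_imp2 _ _ _ (IH ltac:(auto)) (H n ltac:(auto))).
    intros z _ H1 H2 i Hi. destruct (Nat.eq_dec i n) as [->|]; auto. apply H1. lia.
Qed.

Lemma Mbar_csum w n (F : nat -> C -> C) :
  (forall i, (i < n)%nat -> Mbar w (F i)) -> Mbar w (fun z => csum n (fun i => F i z)).
Proof.
  induction n as [|n IH]; intros H; simpl; [apply Mbar_zero|]. apply Mbar_plus; auto.
Qed.

(* Fraction-free Gaussian elimination, so that all coefficients stay homogeneous. *)
Lemma homogeneous_dependency N : forall (wr wc : nat -> R) (v : nat -> nat -> C -> C),
  (forall r i, (r <= N)%nat -> (i < N)%nat -> Mbar (wr r + wc i) (v r i)) ->
  exists s c, (forall r, (r <= N)%nat -> Mbar (s - wr r) (c r)) /\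
    (exists r, (r <= N)%nat /\ ~ mer_zero (c r)) /\
    forall i, (i < N)%nat -> ae (fun z => csum (S N) (fun r => c r z * v r i z)%C = 0).
Proof.
  induction N as [|N IH]; intros wr wc v H.
  - exists (wr O), (fun _ _ => RtoC 1). split; [|split].
    + intros r Hr. assert (r = O) by lia. subst. apply (Mbar_weight 0); [ring|]. apply Mbar_const.
    + exists O. split; auto. apply ae_neq_not_mer_zero, ae_all. intros; apply C1_neq_0.
    + intros i Hi. lia.
  (* A pivot is sought in the last column. *)
  - destruct (classic (exists p, (p <= S N)%nat /\ ~ mer_zero (v p N))) as [(p & Hp & Np)|Z].
    + set (sk := skip p).
      assert (Hsk : forall r, (r <= N)%nat -> (sk r <= S N)%nat).
      { intros r Hr. unfold sk, skip. destruct (Nat.ltb r p); lia. }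
      (* The entries of the reduced matrix are the 2 by 2 minors with the pivot row and column. Each
         is homogeneous, and the pivot's weight is absorbed into the row weights. *)
      destruct (IH (fun r => wr (sk r) + wr p + wc N) wc
        (fun r i z => v p N z * v (sk r) i z + - (v (sk r) N z * v p i z))%C) as (s & c & Hc & (r0 & Hr0 & Nr0) & D).
      { intros r i Hr Hi. apply Mbar_plus.
        - apply (Mbar_weight ((wr p + wc N) + (wr (sk r) + wc i))); [ring|]. apply Mbar_mult; apply H; auto.
        - apply Mbar_opp. apply (Mbar_weight ((wr (sk r) + wc N) + (wr p + wc i))); [ring|].
          apply Mbar_mult; apply H; auto. }
      (* With the other coefficients multiplied by the pivot, this coefficient of row [p] cancels
         the last column identically and turns the other columns into the relation among the
         minors. *)
      set (cp := fun z => (- csum (S N) (fun r => c r z * v (sk r) N z))%C).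
      set (c1 := fun r z => if Nat.eqb r p then cp z else (v p N z * c (unskip p r) z)%C).
      assert (Ep : forall z, c1 p z = cp z) by (intros; unfold c1; rewrite Nat.eqb_refl; auto).
      assert (Es : forall r z, c1 (sk r) z = (v p N z * c r z)%C).
      { intros r z. unfold c1, sk. destruct (Nat.eqb_spec (skip p r) p) as [E|E].
        - exfalso. apply (skip_neq p r E).
        - rewrite unskip_skip. auto. }
      exists s, c1. split; [|split].
      * intros r Hr. destruct (Nat.eq_dec r p) as [->|N'].
        -- apply (Mbar_mer_eq _ cp). { apply ae_all. intros; symmetry; apply Ep. }
           apply Mbar_opp. apply (Mbar_csum _ _ (fun r z => c r z * v (sk r) N z)%C). intros i Hi.
           apply (Mbar_weight ((s - (wr (sk i) + wr p + wc N)) + (wr (sk i) + wc N))); [ring|].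
           apply Mbar_mult; [apply Hc; lia|apply H; auto]. apply Hsk; lia.
        -- apply (Mbar_mer_eq _ (fun z => v p N z * c (unskip p r) z)%C).
           { apply ae_all. intros z _. unfold c1. destruct (Nat.eqb_spec r p); [contradiction|auto]. }
           assert (L : (unskip p r <= N)%nat). { unfold unskip. destruct (Nat.ltb_spec r p); lia. }
           specialize (Hc _ L). unfold sk in Hc. rewrite skip_unskip in Hc by auto.
           apply (Mbar_weight ((wr p + wc N) + (s - (wr r + wr p + wc N)))); [ring|].
           apply Mbar_mult; auto.
      * exists (sk r0). split; auto. apply ae_neq_not_mer_zero.
        destruct (Mbar_nz _ _ (H p N Hp ltac:(lia)) Np) as [A1 _].
        destruct (Mbar_nz _ _ (Hc r0 Hr0) Nr0) as [A2 _].
        apply (ae_imp2 _ _ _ A1 A2). intros z _ B1 B2. rewrite Es. apply Cmult_neq_0; auto.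
      * intros i Hi.
        assert (G : forall z, csum (S (S N)) (fun r => c1 r z * v r i z)%C =
          csum (S N) (fun r => c r z * (v p N z * v (sk r) i z + - (v (sk r) N z * v p i z)))%C).
        { intros z. rewrite (csum_skip (S N) p) by auto. rewrite Ep. unfold cp.
          rewrite (csum_ext (S N) (fun r => c1 (skip p r) z * v (skip p r) i z)%C
            (fun r => c r z * (v p N z * v (sk r) i z + - (v (sk r) N z * v p i z)) + v p i z * (c r z * v (sk r) N z))%C).
          - rewrite csum_plus, csum_scal. ring.
          - intros r _. fold (sk r). rewrite Es. ring. }
        destruct (Nat.eq_dec i N) as [->|N'].
        -- apply ae_all. intros z _. rewrite G. apply csum_zero. intros r _. ring.
        -- apply (ae_imp _ _ (D i ltac:(lia))). intros z _ E. rewrite G. exact E.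
    + assert (Z' : forall r, (r <= S N)%nat -> mer_zero (v r N)).
      { intros r Hr. apply NNPP. intros N'. apply Z. exists r. auto. }
      destruct (IH wr wc v) as (s & c & Hc & (r0 & Hr0 & Nr0) & D).
      { intros; apply H; lia. }
      set (c1 := fun r z => if Nat.leb r N then c r z else RtoC 0).
      assert (E1 : forall r, (r <= N)%nat -> c1 r = fun z => c r z).
      { intros r Hr. unfold c1. destruct (Nat.leb_spec r N); [auto|lia]. }
      exists s, c1. split; [|split].
      * intros r Hr. unfold c1. destruct (Nat.leb_spec r N); [apply (Hc r); auto|apply Mbar_zero].
      * exists r0. split; [lia|]. rewrite E1 by auto. exact Nr0.
      * intros i Hi.
        assert (G : forall z, csum (S (S N)) (fun r => c1 r z * v r i z)%C = csum (S N) (fun r => c r z * v r i z)%C).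
        { intros z. change (csum (S (S N)) ?F) with (csum (S N) F + F (S N))%C.
          unfold c1 at 2. destruct (Nat.leb_spec (S N) N); [lia|].
          rewrite (csum_ext (S N) _ (fun r => c r z * v r i z)%C); [ring|].
          intros r Hr. rewrite E1 by lia. reflexivity. }
        destruct (Nat.eq_dec i N) as [->|N'].
        -- assert (A := ae_forall_lt (S N) (fun r z => v r N z = 0) (fun r Hr => Z' r ltac:(lia))).
           apply (ae_imp _ _ A). intros z _ B. rewrite G. apply csum_zero. intros r Hr. rewrite B by auto. ring.
        -- apply (ae_imp _ _ (D i ltac:(lia))). intros z _ E. rewrite G. exact E.
Qed.

(* [u i] is regarded as an element of weight [wt i]. *)
Definition Span (N : nat) (wt : nat -> R) (u : nat -> C -> C) (k : R) (f : C -> C) : Prop :=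
  exists c, (forall i, (i < N)%nat -> Mbar (k - wt i) (c i)) /\
    mer_eq f (fun z => csum N (fun i => c i z * u i z)%C).

Lemma Span_mer_eq N wt u k f g : mer_eq f g -> Span N wt u k f -> Span N wt u k g.
Proof.
  intros H (c & Hc & E). exists c. split; auto. apply (mer_eq_trans _ f); auto. apply mer_eq_sym; auto.
Qed.

Lemma Span_weight N wt u k k' f : k = k' -> Span N wt u k f -> Span N wt u k' f.
Proof. intros <-. auto. Qed.

Lemma Span_zero N wt u k : Span N wt u k (fun _ => RtoC 0).
Proof.
  exists (fun _ _ => RtoC 0). split; [intros; apply Mbar_zero|].
  apply ae_all. intros z _. symmetry. apply csum_zero. intros; ring.
Qed.

Lemma Span_plus N wt u k f g :
  Span N wt u k f -> Span N wt u k g -> Span N wt u k (fun z => f z + g z)%C.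
Proof.
  intros (c & Hc & E) (d & Hd & E'). exists (fun i z => c i z + d i z)%C. split.
  - intros i Hi. apply Mbar_plus; auto.
  - apply (ae_imp2 _ _ _ E E'). intros z _ A B. rewrite A, B, <- csum_plus.
    apply csum_ext. intros; ring.
Qed.

Lemma Span_scal N wt u k w h f :
  Mbar w h -> Span N wt u k f -> Span N wt u (w + k) (fun z => h z * f z)%C.
Proof.
  intros Hh (c & Hc & E). exists (fun i z => h z * c i z)%C. split.
  - intros i Hi. apply (Mbar_weight (w + (k - wt i))); [ring|]. apply Mbar_mult; auto.
  - apply (ae_imp _ _ E). intros z _ A. rewrite A, <- csum_scal. apply csum_ext. intros; ring.
Qed.

Lemma Span_in N wt u i : (i < N)%nat -> Span N wt u (wt i) (u i).
Proof.
  intros Hi. exists (fun j _ => if Nat.eqb i j then RtoC 1 else RtoC 0). split.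
  - intros j Hj. destruct (Nat.eqb_spec i j) as [->|N'].
    + apply (Mbar_weight 0); [ring|]. apply Mbar_const.
    + apply Mbar_zero.
  - apply ae_all. intros z _. rewrite (csum_ext N _ (fun j => if Nat.eqb i j then u j z else 0)).
    + rewrite csum_delta; auto.
    + intros j _. destruct (Nat.eqb i j); ring.
Qed.

Lemma Span_csum N wt u k n (F : nat -> C -> C) :
  (forall i, (i < n)%nat -> Span N wt u k (F i)) -> Span N wt u k (fun z => csum n (fun i => F i z)).
Proof.
  induction n as [|n IH]; intros H; simpl; [apply Span_zero|]. apply Span_plus; auto.
Qed.

Lemma Span_trans N wt u N' wt' u' k f :
  (forall i, (i < N)%nat -> Span N' wt' u' (wt i) (u i)) -> Span N wt u k f -> Span N' wt' u' k f.
Proof.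
  intros H (c & Hc & E). apply (Span_mer_eq _ _ _ _ (fun z => csum N (fun i => c i z * u i z)%C)).
  - apply mer_eq_sym, E.
  - apply (Span_csum _ _ _ _ N (fun i z => c i z * u i z)%C). intros i Hi.
    apply (Span_weight _ _ _ ((k - wt i) + wt i)); [ring|]. apply Span_scal; auto.
Qed.

Lemma csum_cdiff n (F : nat -> C -> C) z :
  (forall i, (i < n)%nat -> cdiff (F i) z) -> cdiff (fun z => csum n (fun i => F i z)) z.
Proof.
  induction n as [|n IH]; intros H; simpl; [apply cdiff_const|]. apply cdiff_plus; auto.
Qed.

Lemma Dop_zero k z : Dop k (fun _ => RtoC 0) z = 0.
Proof.
  unfold Dop. rewrite (fprime_cder _ _ _ (cder_const 0 z)). unfold Cdiv. ring.
Qed.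

Lemma Dop_csum k n (F : nat -> C -> C) z :
  (forall i, (i < n)%nat -> cdiff (F i) z) ->
  Dop k (fun z => csum n (fun i => F i z)) z = csum n (fun i => Dop k (F i) z).
Proof.
  induction n as [|n IH]; intros H; simpl; [apply Dop_zero|].
  rewrite Dop_plus; auto.
  - rewrite IH; auto.
  - apply csum_cdiff; auto.
Qed.

(** * Spaces stable under [delta] and monic annihilators *)

Definition Dclosed (N : nat) (wt : nat -> R) (u : nat -> C -> C) : Prop :=
  forall i, (i < N)%nat -> Mer (u i) /\ Span N wt u (wt i + 2) (Dop (wt i) (u i)).

(** Leibniz' rule on each [c i * u i], the weight [k] being split as [(k - wt i) + wt i]. The
    coefficients stay in [Mbar] by [Mbar_Dop], so stability need only be required of the
    generators. *)
Lemma Span_Dop N wt u k f : Dclosed N wt u -> Span N wt u k f -> Span N wt u (k + 2) (Dop k f).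
Proof.
  intros HD (c & Hc & E).
  assert (A : ae (fun z => forall i, (i < N)%nat -> cdiff (c i) z /\ cdiff (u i) z)).
  { apply ae_forall_lt. intros i Hi. apply ae_and; apply Mer_ae_cdiff.
    - apply (Mbar_Mer _ _ (Hc i Hi)).
    - apply HD; auto. }
  apply (Span_mer_eq _ _ _ _ (fun z => csum N (fun i =>
     Dop (k - wt i) (c i) z * u i z + c i z * Dop (wt i) (u i) z))%C).
  - apply mer_eq_sym. apply (ae_imp2 _ _ _ (Dop_mer_eq k _ _ E) A). intros z _ X Y.
    rewrite X, (Dop_csum k N (fun i z => c i z * u i z)%C).
    + apply csum_ext. intros i Hi. destruct (Y i Hi).
      replace k with ((k - wt i) + wt i) at 1 by ring. apply Dop_mult; auto.
    + intros i Hi. destruct (Y i Hi). apply cdiff_mult; auto.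
  - apply (Span_csum _ _ _ _ N (fun i z => Dop (k - wt i) (c i) z * u i z + c i z * Dop (wt i) (u i) z)%C).
    intros i Hi. apply Span_plus.
    + apply (Span_weight _ _ _ ((k - wt i + 2) + wt i)); [ring|].
      apply Span_scal; [apply Mbar_Dop; auto|apply Span_in; auto].
    + apply (Span_weight _ _ _ ((k - wt i) + (wt i + 2))); [ring|].
      apply Span_scal; auto. apply HD; auto.
Qed.

(* A monic homogeneous operator of order [n] annihilates [(f, k)]. *)
Definition Ann (n : nat) (k : R) (f : C -> C) : Prop :=
  Span n (fun i => k + 2 * INR i) (fun i => Dn k i f) (k + 2 * INR n) (Dn k n f).

Lemma Mer_Dn k i f : Mer f -> Mer (Dn k i f).
Proof. intros Hf. induction i as [|i IH]; simpl; auto. apply Mer_Dop; auto. Qed.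

Lemma Ann_Dclosed n k f :
  Mer f -> Ann n k f -> Dclosed n (fun i => k + 2 * INR i) (fun i => Dn k i f).
Proof.
  intros Hf HA i Hi. split; [apply Mer_Dn; auto|].
  change (Dop (k + 2 * INR i) (Dn k i f)) with (Dn k (S i) f).
  assert (E : k + 2 * INR i + 2 = k + 2 * INR (S i)) by (rewrite S_INR; ring). rewrite E.
  destruct (Nat.eq_dec (S i) n) as [<-|N]; [exact HA|].
  apply (Span_in n (fun i => k + 2 * INR i) (fun i => Dn k i f) (S i)). lia.
Qed.

Lemma Ann_Span_Dn n k f r :
  Mer f -> Ann n k f -> Span n (fun i => k + 2 * INR i) (fun i => Dn k i f) (k + 2 * INR r) (Dn k r f).
Proof.
  intros Hf HA. induction r as [|r IH].
  (* For [n = 0] the span is zero, and [Ann 0 k f] itself says that [f] vanishes. *)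
  - destruct n as [|n]; [exact HA|].
    apply (Span_in (S n) (fun i => k + 2 * INR i) (fun i => Dn k i f) O). lia.
  - assert (E : k + 2 * INR (S r) = k + 2 * INR r + 2) by (rewrite S_INR; ring). rewrite E.
    apply (Span_Dop n _ _ (k + 2 * INR r) (Dn k r f)); auto. apply Ann_Dclosed; auto.
Qed.

(** Every [delta^r f] already lies in the span of the first [n] derivatives, hence in that of the
    first [m]. This replaces composition with powers of [delta]. *)
Lemma Ann_le n m k f : Mer f -> (n <= m)%nat -> Ann n k f -> Ann m k f.
Proof.
  intros Hf Hnm HA. unfold Ann.
  apply (Span_trans n (fun i => k + 2 * INR i) (fun i => Dn k i f)); [|apply Ann_Span_Dn; auto].
  intros i Hi. apply (Span_in m (fun i => k + 2 * INR i) (fun i => Dn k i f) i). lia.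
Qed.

Lemma largest_index N (P : nat -> Prop) :
  (exists r, (r <= N)%nat /\ P r) ->
  exists r, (r <= N)%nat /\ P r /\ forall s, (r < s <= N)%nat -> ~ P s.
Proof.
  induction N as [|N IH]; intros (r & Hr & Pr).
  - exists r. split; [|split]; auto. intros; lia.
  - destruct (classic (P (S N))) as [H|H].
    + exists (S N). split; [|split]; auto. intros; lia.
    + destruct IH as (s & Hs & Ps & Ms).
      { exists r. split; auto. destruct (Nat.eq_dec r (S N)) as [->|]; [contradiction|lia]. }
      exists s. split; [lia|]. split; auto. intros t Ht.
      destruct (Nat.eq_dec t (S N)) as [->|]; auto. apply Ms. lia.
Qed.

Lemma csum_truncate n m (F : nat -> C) :
  (n <= m)%nat -> (forall i, (n <= i < m)%nat -> F i = 0) -> csum m F = csum n F.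
Proof.
  intros H. induction H as [|m Hm IH]; intros HF; auto. simpl. rewrite IH, HF by (intros; try apply HF; lia). ring.
Qed.

(** The top coefficient is homogeneous and nonzero, so the relation can be divided by it without
    losing homogeneity. *)
Lemma Ann_of_relation n k f (w : R) (h : nat -> C -> C) :
  (forall i, (i <= n)%nat -> Mbar (w - (k + 2 * INR i)) (h i)) ->
  ~ mer_zero (h n) ->
  ae (fun z => csum (S n) (fun i => h i z * Dn k i f z)%C = 0) ->
  Ann n k f.
Proof.
  intros Hh N E. destruct (Mbar_nz _ _ (Hh n (le_n _)) N) as [Nn Hinv].
  exists (fun i z => - (/ h n z * h i z))%C. split.
  - intros i Hi. apply Mbar_opp.
    apply (Mbar_weight (- (w - (k + 2 * INR n)) + (w - (k + 2 * INR i)))); [ring|].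
    apply Mbar_mult; auto. apply Hh. lia.
  - apply (ae_imp2 _ _ _ Nn E). intros z _ A B. simpl in B.
    rewrite (csum_ext n _ (fun i => (- / h n z) * (h i z * Dn k i f z))%C) by (intros; ring).
    rewrite csum_scal. set (X := csum n _) in *.
    replace X with (- (h n z * Dn k n f z))%C.
    + field. exact A.
    + replace X with ((X + h n z * Dn k n f z) + - (h n z * Dn k n f z))%C by ring.
      rewrite B. ring.
Qed.

Lemma Ann_of_Span N wt u k f : Mer f -> Dclosed N wt u -> Span N wt u k f -> Ann N k f.
Proof.
  intros Hf HD HS.
  assert (HR : forall r, Span N wt u (k + 2 * INR r) (Dn k r f)).
  { induction r as [|r IH].
    - apply (Span_weight _ _ _ k); [simpl; ring|exact HS].
    - assert (E : k + 2 * INR (S r) = k + 2 * INR r + 2) by (rewrite S_INR; ring). rewrite E.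
      apply (Span_Dop N wt u (k + 2 * INR r) (Dn k r f)); auto. }
  set (V := fun r => constructive_indefinite_description _ (HR r)).
  set (v := fun r => proj1_sig (V r)).
  assert (Hv : forall r, (forall i, (i < N)%nat -> Mbar (k + 2 * INR r - wt i) (v r i)) /\
     mer_eq (Dn k r f) (fun z => csum N (fun i => v r i z * u i z)%C)).
  { intros r. exact (proj2_sig (V r)). }
  (* Row [r] holds the coordinates of [delta^r f]. Having one more row than columns forces a
     relation, and the weight of an entry splits into a row and a column part. *)
  destruct (homogeneous_dependency N (fun r => k + 2 * INR r) (fun i => - wt i) v) as (s & c & Hc & Nz & D).
  { intros r i _ Hi. apply Hv; auto. }
  (* The last coefficients may vanish, so the true order [n] can be below [N]; [Ann_le] raises it
     afterwards. *)
  destruct (largest_index N (fun r => ~ mer_zero (c r)) Nz) as (n & Hn & Nn & Mn).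
  apply (Ann_le n); auto.
  apply (Ann_of_relation n k f s c); auto.
  { intros i Hi. apply Hc. lia. }
  assert (A1 : ae (fun z => forall r, (r < S N)%nat -> Dn k r f z = csum N (fun i => v r i z * u i z)%C)).
  { apply ae_forall_lt. intros r _. apply Hv. }
  assert (A2 : ae (fun z => forall i, (i < N)%nat -> csum (S N) (fun r => c r z * v r i z)%C = 0)).
  { apply ae_forall_lt. auto. }
  assert (A3 : ae (fun z => forall r, (r < S N)%nat -> (n < r)%nat -> c r z = 0)).
  { apply ae_forall_lt. intros r Hr. destruct (Nat.ltb_spec n r) as [L|L].
    - assert (Z : mer_zero (c r)) by (apply NNPP, Mn; lia). apply (ae_imp _ _ Z). auto.
    - apply ae_all. intros; lia. }
  apply (ae_imp2 _ _ _ A1 (ae_and _ _ A2 A3)). intros z _ B1 [B2 B3].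
  rewrite <- (csum_truncate (S n) (S N)); [|lia|].
  - rewrite (csum_ext (S N) _ (fun r => csum N (fun i => u i z * (c r z * v r i z)))%C).
    + rewrite csum_exchange. apply csum_zero. intros i Hi. rewrite csum_scal, B2 by auto. ring.
    + intros r Hr. rewrite B1, <- csum_scal by auto. apply csum_ext. intros; ring.
  - intros i Hi. rewrite B3 by lia. ring.
Qed.

(** * Operators as lists of terms *)

Lemma Reqb_spec x y : reflect (x = y) (Reqb x y).
Proof. unfold Reqb. destruct (Req_EM_T x y); constructor; auto. Qed.

Lemma fsum_nil z : fsum nil z = 0.
Proof. reflexivity. Qed.

Lemma fsum_cons h l z : fsum (h :: l) z = (h z + fsum l z)%C.
Proof. reflexivity. Qed.

Lemma coef_cons t a i w z :
  coef (t :: a) i w z =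
  ((if Nat.eqb (t_ord t) i then (if Reqb (t_wt t) w then t_coef t z else 0) else 0) + coef a i w z)%C.
Proof.
  unfold coef. simpl. destruct (Nat.eqb (t_ord t) i), (Reqb (t_wt t) w); simpl;
    rewrite ?fsum_cons; ring.
Qed.

Lemma act_comp_cons t a k f v z :
  act_comp (t :: a) k f v z =
  ((if Reqb (k + t_wt t + 2 * INR (t_ord t)) v then t_coef t z * Dn k (t_ord t) f z else 0)
   + act_comp a k f v z)%C.
Proof.
  unfold act_comp. simpl. destruct (Reqb (k + t_wt t + 2 * INR (t_ord t)) v); simpl;
    rewrite ?fsum_cons; ring.
Qed.

(** Collecting terms by order: once [v] is fixed, [delta^i] can only occur with a coefficient of
    weight [v - k - 2 i]. This isolates one homogeneous component of the operator. *)
Lemma act_comp_coef a k f v z m :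
  (forall t, In t a -> (t_ord t < m)%nat) ->
  act_comp a k f v z = csum m (fun i => coef a i (v - k - 2 * INR i) z * Dn k i f z)%C.
Proof.
  induction a as [|t a IH]; intros Hm.
  - rewrite csum_zero; [reflexivity|]. intros i _. unfold coef; simpl. rewrite fsum_nil. ring.
  - rewrite act_comp_cons, IH by (intros; apply Hm; right; auto).
    rewrite (csum_ext m (fun i => coef (t :: a) i (v - k - 2 * INR i) z * Dn k i f z)%C
      (fun i => (if Nat.eqb (t_ord t) i then
          (if Reqb (t_wt t) (v - k - 2 * INR i) then t_coef t z * Dn k i f z else 0) else 0)
          + coef a i (v - k - 2 * INR i) z * Dn k i f z)%C).
    + rewrite csum_plus, (csum_delta m (t_ord t)
        (fun i => if Reqb (t_wt t) (v - k - 2 * INR i) then (t_coef t z * Dn k i f z)%C else RtoC 0))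
        by (apply Hm; left; auto).
      f_equal. destruct (Reqb_spec (k + t_wt t + 2 * INR (t_ord t)) v),
        (Reqb_spec (t_wt t) (v - k - 2 * INR (t_ord t))); auto; exfalso; lra.
    + intros i _. rewrite coef_cons. destruct (Nat.eqb (t_ord t) i); [|ring].
      destruct (Reqb (t_wt t) (v - k - 2 * INR i)); ring.
Qed.

Lemma Mbar_coef a i w : valid a -> Mbar w (coef a i w).
Proof.
  intros H. induction H as [|t a Ht Ha IH].
  - apply (Mbar_mer_eq _ (fun _ => RtoC 0)); [apply ae_all; reflexivity|apply Mbar_zero].
  - apply (Mbar_mer_eq _ (fun z =>
      (if Nat.eqb (t_ord t) i then (if Reqb (t_wt t) w then t_coef t z else 0) else 0) + coef a i w z)%C).
    + apply ae_all. intros z _. symmetry. apply coef_cons.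
    + apply Mbar_plus; auto. destruct (Nat.eqb (t_ord t) i); [|apply Mbar_zero].
      destruct (Reqb_spec (t_wt t) w) as [<-|]; [|apply Mbar_zero]. exact Ht.
Qed.

(** A list of order [n] may still contain terms of higher order that cancel, so the range of
    summation needs a bound of its own. *)
Lemma ord_bound (a : list term) (n : nat) : exists m, (n < m)%nat /\ forall t, In t a -> (t_ord t < m)%nat.
Proof.
  induction a as [|t a (m & Hm & IH)].
  - exists (S n). split; [lia|]. intros t [].
  - exists (Nat.max m (S (t_ord t))). split; [lia|]. intros s [<-|Hs]; [lia|].
    specialize (IH s Hs). lia.
Qed.

(* A homogeneous component of the annihilator with nonzero top coefficient already annihilates. *)
Lemma Sbar_Ann n k f : Sbar n k f -> Ann n k f.
Proof.
  intros (_ & a & Hv & ((w & Nw) & Hhi) & Han).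
  (* The weight in the target for which the coefficient of [delta^n] is the nonzero one, of weight
     [w]. *)
  set (v := k + w + 2 * INR n).
  set (h := fun i => coef a i (v - k - 2 * INR i)).
  apply (Ann_of_relation n k f v h).
  - intros i _. apply (Mbar_weight (v - k - 2 * INR i)); [ring|]. apply Mbar_coef; auto.
  - unfold h. replace (v - k - 2 * INR n) with w by (unfold v; ring). exact Nw.
  - destruct (ord_bound a n) as (m & Hm & Hb).
    assert (A : ae (fun z => forall i, (i < m)%nat -> (n < i)%nat -> h i z = 0)).
    { apply ae_forall_lt. intros i _. destruct (Nat.ltb_spec n i) as [L|L].
      - apply (ae_imp _ _ (Hhi i (v - k - 2 * INR i) L)). auto.
      - apply ae_all. intros; lia. }
    apply (ae_imp2 _ _ _ A (Han v)). intros z _ B E.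
    rewrite (act_comp_coef a k f v z m Hb) in E.
    rewrite <- E. symmetry. apply csum_truncate; [lia|].
    intros i Hi. change (coef a i (v - k - 2 * INR i) z) with (h i z). rewrite B by lia. ring.
Qed.

Lemma coef_out a i w z : (forall t, In t a -> t_ord t <> i) -> coef a i w z = 0.
Proof.
  induction a as [|t a IH]; intros H; [reflexivity|].
  rewrite coef_cons, IH by (intros; apply H; right; auto).
  destruct (Nat.eqb_spec (t_ord t) i) as [E|]; [|ring].
  exfalso. apply (H t); auto. left; auto.
Qed.

Lemma act_comp_map_seq k f v z n (w : nat -> R) (p : nat -> C -> C) :
  (forall i, (i < n)%nat -> k + w i + 2 * INR i = v) ->
  act_comp (map (fun i => (i, w i, p i)) (seq 0 n)) k f v z = csum n (fun i => p i z * Dn k i f z)%C.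
Proof.
  assert (G : forall l, (forall i, In i l -> k + w i + 2 * INR i = v) ->
    act_comp (map (fun i => (i, w i, p i)) l) k f v z =
    fold_right Cplus (RtoC 0) (map (fun i => p i z * Dn k i f z)%C l)).
  { induction l as [|i l IH]; intros H; [reflexivity|].
    cbn [map fold_right]. rewrite act_comp_cons, IH by (intros; apply H; right; auto).
    unfold t_ord, t_wt, t_coef. cbn [fst snd].
    destruct (Reqb_spec (k + w i + 2 * INR i) v) as [|N]; auto.
    exfalso. apply N, H. left; auto. }
  intros H. rewrite G by (intros i Hi; apply in_seq in Hi; apply H; lia).
  assert (F : forall (F : nat -> C) m, fold_right Cplus (RtoC 0) (map F (seq 0 m)) = csum m F).
  { intros F m. induction m as [|m IH]; auto. rewrite seq_S, map_app, fold_right_app. simpl.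
    rewrite <- IH. generalize (map F (seq 0 m)). intros l. induction l as [|x l IHl]; simpl; [ring|].
    rewrite IHl. ring. }
  apply F.
Qed.

Lemma act_comp_off a k f v z :
  (forall t, In t a -> k + t_wt t + 2 * INR (t_ord t) <> v) -> act_comp a k f v z = 0.
Proof.
  induction a as [|t a IH]; intros H; [reflexivity|].
  rewrite act_comp_cons, IH by (intros; apply H; right; auto).
  destruct (Reqb_spec (k + t_wt t + 2 * INR (t_ord t)) v) as [E|]; [|ring].
  exfalso. apply (H t); auto. left; auto.
Qed.

(** The annihilator is [delta^n] minus the sum of the [p i delta^i], homogeneous of weight [2 n].
    Its leading coefficient 1 makes the order exactly [n], and outside weight [k + 2 n] the image is
    an empty sum. *)
Lemma Ann_Sbar n k f : Mer f -> Ann n k f -> Sbar n k f.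
Proof.
  intros Hf (p & Hp & E). split; auto.
  set (w := fun i => 2 * INR n - 2 * INR i).
  set (tl := map (fun i => (i, w i, fun z => (- p i z)%C)) (seq 0 n)).
  set (hd := (n, 0, fun _ : C => RtoC 1) : term).
  assert (Htl : forall t, In t tl -> exists i, (i < n)%nat /\ t = (i, w i, fun z => (- p i z)%C)).
  { intros t Ht. apply in_map_iff in Ht. destruct Ht as (i & <- & Hi). apply in_seq in Hi.
    exists i. split; [lia|auto]. }
  exists (hd :: tl). split; [|split].
  - constructor; [apply (Mbar_const 1)|]. apply Forall_forall. intros t Ht.
    destruct (Htl t Ht) as (i & Hi & ->). unfold t_wt, t_coef. cbn [fst snd].
    apply Mbar_opp. apply (Mbar_weight (k + 2 * INR n - (k + 2 * INR i))); [unfold w; ring|]. auto.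
  - split.
    + exists 0. apply ae_neq_not_mer_zero, ae_all. intros z _.
      rewrite coef_cons, coef_out.
      * unfold hd, t_ord, t_wt, t_coef. cbn [fst snd]. rewrite Nat.eqb_refl.
        destruct (Reqb_spec 0 0) as [_|N]; [|exfalso; auto].
        rewrite Cplus_0_r. apply C1_neq_0.
      * intros t Ht. destruct (Htl t Ht) as (i & Hi & ->). unfold t_ord. cbn [fst snd]. lia.
    + intros i v Hi. apply ae_all. intros z _. apply coef_out. intros t [<-|Ht].
      * unfold hd, t_ord. cbn [fst snd]. lia.
      * destruct (Htl t Ht) as (j & Hj & ->). unfold t_ord. cbn [fst snd]. lia.
  - intros v. destruct (Req_dec (k + 2 * INR n) v) as [<-|N].
    + apply (ae_imp _ _ E). intros z _ B.
      rewrite act_comp_cons. unfold tl. rewrite act_comp_map_seq by (intros; unfold w; ring).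
      unfold hd, t_ord, t_wt, t_coef. cbn [fst snd].
      destruct (Reqb_spec (k + 0 + 2 * INR n) (k + 2 * INR n)) as [_|N]; [|exfalso; apply N; ring].
      rewrite B, Cmult_1_l, <- csum_plus. apply csum_zero. intros; ring.
    + apply ae_all. intros z _. apply act_comp_off. intros t [<-|Ht].
      * unfold hd, t_ord, t_wt. cbn [fst snd]. lra.
      * destruct (Htl t Ht) as (i & Hi & ->). unfold t_ord, t_wt, w. cbn [fst snd]. lra.
Qed.

Lemma Span_act_comp n k f b v :
  Mer f -> Ann n k f -> valid b ->
  Span n (fun i => k + 2 * INR i) (fun i => Dn k i f) v (act_comp b k f v).
Proof.
  intros Hf HA Hb. induction Hb as [|t b Ht Hb IH].
  - apply (Span_mer_eq _ _ _ _ (fun _ => RtoC 0)); [apply ae_all; reflexivity|apply Span_zero].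
  - apply (Span_mer_eq _ _ _ _ (fun z =>
     (if Reqb (k + t_wt t + 2 * INR (t_ord t)) v then t_coef t z * Dn k (t_ord t) f z else 0)
      + act_comp b k f v z)%C).
    { apply ae_all. intros z _. symmetry. apply act_comp_cons. }
    apply Span_plus; auto. destruct (Reqb_spec (k + t_wt t + 2 * INR (t_ord t)) v) as [<-|]; [|apply Span_zero].
    apply (Span_weight _ _ _ (t_wt t + (k + 2 * INR (t_ord t)))); [ring|].
    apply Span_scal; auto. apply Ann_Span_Dn; auto.
Qed.

Lemma Mer_act_comp b k f v : Mer f -> valid b -> Mer (act_comp b k f v).
Proof.
  intros Hf Hb. induction Hb as [|t b Ht Hb IH].
  - apply (Mer_mer_eq (fun _ => RtoC 0)); [apply ae_all; reflexivity|apply Mer_const].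
  - apply (Mer_mer_eq (fun z =>
     (if Reqb (k + t_wt t + 2 * INR (t_ord t)) v then t_coef t z * Dn k (t_ord t) f z else 0)
      + act_comp b k f v z)%C).
    { apply ae_all. intros z _. symmetry. apply act_comp_cons. }
    apply Mer_plus; auto. destruct (Reqb (k + t_wt t + 2 * INR (t_ord t)) v); [|apply Mer_const].
    apply Mer_mult; [apply (Mbar_Mer _ _ Ht)|apply Mer_Dn; auto].
Qed.

(** * Stable spaces for sums, products and modular forms *)

Lemma Ann_plus n m k f g : Mer f -> Mer g -> Ann n k f -> Ann m k g -> Ann (n + m) k (fun z => f z + g z)%C.
Proof.
  intros Hf Hg Af Ag.
  (* The two families are concatenated: the first [n] indices belong to [f], the next [m] to [g]. *)
  set (wt := fun i => if Nat.ltb i n then k + 2 * INR i else k + 2 * INR (i - n)).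
  set (u := fun i => if Nat.ltb i n then Dn k i f else Dn k (i - n) g).
  assert (I1 : forall i, (i < n)%nat -> Span (n + m) wt u (k + 2 * INR i) (Dn k i f)).
  { intros i Hi. assert (S := Span_in (n + m) wt u i ltac:(lia)).
    assert (Ew : wt i = k + 2 * INR i) by (unfold wt; destruct (Nat.ltb_spec i n); [auto|lia]).
    assert (Eu : u i = Dn k i f) by (unfold u; destruct (Nat.ltb_spec i n); [auto|lia]).
    rewrite Ew, Eu in S. exact S. }
  assert (I2 : forall i, (i < m)%nat -> Span (n + m) wt u (k + 2 * INR i) (Dn k i g)).
  { intros i Hi. assert (S := Span_in (n + m) wt u (n + i) ltac:(lia)).
    assert (Ew : wt (n + i)%nat = k + 2 * INR i).
    { unfold wt. destruct (Nat.ltb_spec (n + i) n); [lia|]. do 3 f_equal. lia. }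
    assert (Eu : u (n + i)%nat = Dn k i g).
    { unfold u. destruct (Nat.ltb_spec (n + i) n); [lia|]. f_equal. lia. }
    rewrite Ew, Eu in S. exact S. }
  apply (Ann_of_Span (n + m) wt u).
  - apply Mer_plus; auto.
  - intros i Hi. destruct (Nat.ltb_spec i n) as [L|L].
    + assert (Ew : wt i = k + 2 * INR i) by (unfold wt; destruct (Nat.ltb_spec i n); [auto|lia]).
      assert (Eu : u i = Dn k i f) by (unfold u; destruct (Nat.ltb_spec i n); [auto|lia]).
      rewrite Ew, Eu. split; [apply Mer_Dn; auto|].
      apply (Span_trans n _ _ _ _ _ _ _ I1). apply (Ann_Dclosed n k f Hf Af i L).
    + assert (Ew : wt i = k + 2 * INR (i - n)) by (unfold wt; destruct (Nat.ltb_spec i n); [lia|auto]).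
      assert (Eu : u i = Dn k (i - n) g) by (unfold u; destruct (Nat.ltb_spec i n); [lia|auto]).
      rewrite Ew, Eu. split; [apply Mer_Dn; auto|].
      apply (Span_trans m _ _ _ _ _ _ _ I2). apply (Ann_Dclosed m k g Hg Ag (i - n)%nat). lia.
  - apply Span_plus; (apply (Span_weight _ _ _ (k + 2 * INR 0)); [simpl; ring|]).
    + apply (Span_trans n _ _ _ _ _ _ _ I1). apply (Ann_Span_Dn n k f 0); auto.
    + apply (Span_trans m _ _ _ _ _ _ _ I2). apply (Ann_Span_Dn m k g 0); auto.
Qed.

(** Expanding the product of two combinations; the pair [(i, j)] is encoded as [i * m + j] and
    decoded by division with remainder. *)
Lemma Span_mult n wt u m wt' u' k l f g :
  Span n wt u k f -> Span m wt' u' l g ->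
  Span (n * m) (fun q => wt (q / m)%nat + wt' (q mod m)) (fun q z => u (q / m)%nat z * u' (q mod m) z)%C
    (k + l) (fun z => f z * g z)%C.
Proof.
  intros (c & Hc & E) (d & Hd & E').
  set (W := fun q => wt (q / m)%nat + wt' (q mod m)).
  set (U := fun q z => (u (q / m)%nat z * u' (q mod m) z)%C).
  apply (Span_mer_eq _ _ _ _ (fun z => csum n (fun i => csum m (fun j => (c i z * d j z) * (u i z * u' j z))))%C).
  - apply mer_eq_sym. apply (ae_imp2 _ _ _ E E'). intros z _ A B. rewrite A, B.
    rewrite Cmult_comm, <- csum_scal. apply csum_ext. intros i _.
    rewrite Cmult_comm, <- csum_scal. apply csum_ext. intros j _. ring.
  - apply (Span_csum _ _ _ _ n (fun i z => csum m (fun j => (c i z * d j z) * (u i z * u' j z)))%C).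
    intros i Hi.
    apply (Span_csum _ _ _ _ m (fun j z => (c i z * d j z) * (u i z * u' j z))%C). intros j Hj.
    assert (Q1 : ((i * m + j) / m = i)%nat).
    { rewrite Nat.div_add_l, Nat.div_small; lia. }
    assert (Q2 : ((i * m + j) mod m = j)%nat).
    { rewrite Nat.add_comm, Nat.Div0.mod_add, Nat.mod_small; lia. }
    assert (S := Span_in (n * m) W U (i * m + j) ltac:(nia)).
    change (U (i * m + j)%nat) with (fun z => u ((i * m + j) / m)%nat z * u' ((i * m + j) mod m) z)%C in S.
    change (W (i * m + j)%nat) with (wt ((i * m + j) / m)%nat + wt' ((i * m + j) mod m)) in S.
    rewrite Q1, Q2 in S.
    apply (Span_weight _ _ _ ((k - wt i + (l - wt' j)) + (wt i + wt' j))); [ring|].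
    apply (Span_scal _ _ _ _ _ (fun z => c i z * d j z)%C); auto. apply Mbar_mult; auto.
Qed.

Lemma Ann_mult n m k l f g :
  Mer f -> Mer g -> Ann n k f -> Ann m l g -> Ann (n * m) (k + l) (fun z => f z * g z)%C.
Proof.
  intros Hf Hg Af Ag.
  set (wf := fun i => k + 2 * INR i). set (wg := fun j => l + 2 * INR j).
  set (uf := fun i => Dn k i f). set (ug := fun j => Dn l j g).
  apply (Ann_of_Span (n * m) (fun q => wf (q / m)%nat + wg (q mod m))
    (fun q z => uf (q / m)%nat z * ug (q mod m)%nat z)%C); [apply Mer_mult; auto| |].
  2:{ apply (Span_mult n wf uf m wg ug).
      - apply (Span_weight _ _ _ (k + 2 * INR 0)); [simpl; ring|]. apply (Ann_Span_Dn n k f 0); auto.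
      - apply (Span_weight _ _ _ (l + 2 * INR 0)); [simpl; ring|]. apply (Ann_Span_Dn m l g 0); auto. }
  (* If [n * m = 0] there is no generator to check; otherwise division by [m] is meaningful. *)
  intros q Hq. assert (m0 : m <> O) by (intros ->; lia).
  assert (B1 : (q / m < n)%nat) by (apply Nat.Div0.div_lt_upper_bound; lia).
  assert (B2 : (q mod m < m)%nat) by (apply Nat.mod_upper_bound; auto).
  set (i := (q / m)%nat) in *. set (j := (q mod m)%nat) in *.
  assert (M1 := Mer_Dn k i f Hf). assert (M2 := Mer_Dn l j g Hg).
  split; [apply Mer_mult; auto|].
  (* By Leibniz' rule each summand is again a product of elements of the two stable spaces, so
     [Span_mult] covers it. *)
  apply (Span_mer_eq _ _ _ _ (fun z => Dop (k + 2 * INR i) (Dn k i f) z * Dn l j g z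
     + Dn k i f z * Dop (l + 2 * INR j) (Dn l j g) z)%C).
  - apply (ae_imp2 _ _ _ (Mer_ae_cdiff _ M1) (Mer_ae_cdiff _ M2)). intros z _ C1 C2.
    symmetry. apply Dop_mult; auto.
  - apply Span_plus.
    + apply (Span_weight _ _ _ ((k + 2 * INR i + 2) + (l + 2 * INR j))); [unfold wf, wg; ring|].
      apply (Span_mult n wf uf m wg ug).
      * apply (Ann_Dclosed n k f Hf Af i B1).
      * apply (Span_in m (fun j => l + 2 * INR j) (fun j => Dn l j g) j B2).
    + apply (Span_weight _ _ _ ((k + 2 * INR i) + (l + 2 * INR j + 2))); [unfold wf, wg; ring|].
      apply (Span_mult n wf uf m wg ug).
      * apply (Span_in n (fun j => k + 2 * INR j) (fun j => Dn k j f) i B1).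
      * apply (Ann_Dclosed m l g Hg Ag j B2).
Qed.

(** Since [D_0] kills constants, the multiples of 1 form a stable space. For nonzero [h] this
    amounts to the operator [delta - (D_k h) / h]; the span argument treats [h = 0] in the same
    way. *)
Lemma Mbar_Ann k h : Mbar k h -> Ann 1 k h.
Proof.
  intros Hh. apply (Ann_of_Span 1 (fun _ => 0) (fun _ _ => RtoC 1)).
  - apply (Mbar_Mer k h Hh).
  - intros i _. split; [apply Mer_const|].
    apply (Span_mer_eq _ _ _ _ (fun _ => RtoC 0)); [|apply Span_zero].
    apply ae_all. intros z _. symmetry. apply Dop_0_const.
  - exists (fun _ => h). split.
    + intros i _. apply (Mbar_weight k); [ring|auto].
    + apply ae_all. intros z _. simpl. ring.
Qed.

Theorem theorem4p10 :
  (forall (n m : nat) (k : R) (f g : C -> C),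
      Sbar n k f -> Sbar m k g -> Sbar (n + m) k (fun z => (f z + g z)%C)) /\
  (forall (n m : nat) (k l : R) (f g : C -> C),
      Sbar n k f -> Sbar m l g -> Sbar (n * m) (k + l) (fun z => (f z * g z)%C)) /\
  (forall (m : nat) (k l : R) (b : list term) (g : C -> C),
      homog k b -> Sbar m l g -> Sbar m (k + l) (act_comp b l g (k + l))) /\
  (forall (k : R) (h : C -> C), Mbar k h -> Sbar 1 k h).
Proof.
  split; [|split; [|split]].
  - intros n m k f g Hf Hg. assert (F := Sbar_Ann _ _ _ Hf). assert (G := Sbar_Ann _ _ _ Hg).
    destruct Hf as [Mf _], Hg as [Mg _].
    apply Ann_Sbar; [apply Mer_plus; auto|apply Ann_plus; auto].
  - intros n m k l f g Hf Hg. assert (F := Sbar_Ann _ _ _ Hf). assert (G := Sbar_Ann _ _ _ Hg).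
    destruct Hf as [Mf _], Hg as [Mg _].
    apply Ann_Sbar; [apply Mer_mult; auto|apply Ann_mult; auto].
  - intros m k l b g [Hb _] Hg. assert (G := Sbar_Ann _ _ _ Hg). destruct Hg as [Mg _].
    assert (Mb := Mer_act_comp b l g (k + l) Mg Hb).
    apply Ann_Sbar; auto.
    apply (Ann_of_Span m (fun i => l + 2 * INR i) (fun i => Dn l i g)); auto.
    + apply Ann_Dclosed; auto.
    + apply Span_act_comp; auto.
  - intros k h Hh. apply Ann_Sbar; [apply (Mbar_Mer k h Hh)|apply Mbar_Ann; auto].
Qed.
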